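(* For any $C^*$-algebra $A$, the following are equivalent: (i) Every quasi-centralizer of $K(A)$ is locally bounded. (ii) $A$ has no infinite dimensional elementary direct summand.
   Context: $K(A)$ denotes the Pedersen ideal of $A$, i.e. the smallest dense two-sided ideal of $A$. A quasi-centralizer of an algebra $B$ is a bilinear map $T:B\times B\to B$ (not assumed bounded) such that $T(b_1b_2,b_3)=b_1T(b_2,b_3)$ and $T(b_1,b_2b_3)=T(b_1,b_2)b_3$ for all $b_1,b_2,b_3\in B$. A quasi-centralizer $T$ of $K(A)$ is locally bounded if there is a family $\{I_j\}$ of closed two-sided ideals of $A$ such that $A$ is the norm closure of $\sum_j I_j$ and the restriction of $T$ to $[K(A)\cap I_j]\times[K(A)\cap I_j]$ is bounded for each $j$. An elementary $C^*$-algebra is one isomorphic to the algebra $\mathcal K(H)$ of compact operators on a Hilbert space $H$. Condition (ii) says that $A$ is not of the form $A_0\oplus A_1$ for closed two-sided ideals $A_0,A_1$ with $A_1$ elementary and infinite dimensional. *)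

(* Defs.v *)
From HB Require Import structures.
From mathcomp Require Import all_boot all_order all_algebra.
From mathcomp Require Import all_classical all_reals all_analysis.
From mathcomp Require Import complex.

Set Implicit Arguments.
Unset Strict Implicit.
Unset Printing Implicit Defensive.

Import Order.TTheory GRing.Theory Num.Theory numFieldNormedType.Exports.

Local Open Scope classical_set_scope.
Local Open Scope ring_scope.
Local Open Scope complex_scope.

(* C*-algebras are not assumed unital, so the product is not a MathComp ring
   product.  Norms take (nonnegative real) values in R[i]. *)
HB.mixin Record CompleteNormedModule_isCstarAlgebra (R : realType) A
    of CompleteNormedModule R[i] A := {
  cmul : A -> A -> A ;
  cstar : A -> A ;
  cmulA : associative cmul ;
  cmulDl : left_distributive cmul +%R ;
  cmulDr : right_distributive cmul +%R ;
  cmulZl : forall (c : R[i]) x y, cmul (c *: x) y = c *: cmul x y ;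
  cmulZr : forall (c : R[i]) x y, cmul x (c *: y) = c *: cmul x y ;
  cstarK : involutive cstar ;
  cstarD : {morph cstar : x y / x + y} ;
  cstarZ : forall (c : R[i]) x, cstar (c *: x) = c^* *: cstar x ;
  cstarM : forall x y, cstar (cmul x y) = cmul (cstar y) (cstar x) ;
  normr_cmul : forall x y, `|cmul x y| <= `|x| * `|y| ;
  normr_cstar_cmul : forall x, `|cmul (cstar x) x| = `|x| ^+ 2
}.

#[short(type="cstarAlgType")]
HB.structure Definition CstarAlgebra (R : realType) :=
  {A of CompleteNormedModule R[i] A
   & CompleteNormedModule_isCstarAlgebra R A}.

Section CstarAlgebraDefs.
Variables (R : realType) (A : cstarAlgType R).
Implicit Types (I K B : set A) (T : A -> A -> A).

Definition subspace I : Prop :=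
  I 0 /\ forall (c : R[i]) x y, I x -> I y -> I (c *: x + y).

Definition two_sided_ideal I : Prop :=
  subspace I /\ forall a x, I x -> I (cmul a x) /\ I (cmul x a).

Definition closed_two_sided_ideal I : Prop := two_sided_ideal I /\ closed I.

(* That this intersection is itself a dense two-sided ideal is a theorem of
   Pedersen. *)
Definition pedersen_ideal : set A :=
  smallest (fun I => two_sided_ideal I /\ dense I) set0.

(* A map B x B -> B is represented by a map A x A -> A, of which only the
   restriction to B x B is relevant. *)
Record quasi_centralizer B T : Prop := QuasiCentralizer {
  qc_stable : forall x y, B x -> B y -> B (T x y) ;
  qc_linearl : forall (c : R[i]) x y z, B x -> B y -> B z ->
    T (c *: x + y) z = c *: T x z + T y z ;
  qc_linearr : forall (c : R[i]) x y z, B x -> B y -> B z ->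
    T z (c *: x + y) = c *: T z x + T z y ;
  qc_mull : forall b1 b2 b3, B b1 -> B b2 -> B b3 ->
    T (cmul b1 b2) b3 = cmul b1 (T b2 b3) ;
  qc_mulr : forall b1 b2 b3, B b1 -> B b2 -> B b3 ->
    T b1 (cmul b2 b3) = cmul (T b1 b2) b3
}.

Definition bounded_bilinear_on B T : Prop :=
  exists M : R, forall x y, B x -> B y -> `|T x y| <= M%:C * `|x| * `|y|.

Definition sum_of_family (J : Type) (I : J -> set A) : set A :=
  [set x | exists (n : nat) (a : 'I_n -> A),
    (forall k, exists j, I j (a k)) /\ x = \sum_(k < n) a k].

Definition locally_bounded T : Prop :=
  exists (J : Type) (I : J -> set A),
    [/\ forall j, closed_two_sided_ideal (I j),
        closure (sum_of_family I) = setT &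
        forall j, bounded_bilinear_on (pedersen_ideal `&` I j) T].

Definition finite_dimensional I : Prop :=
  exists (n : nat) (e : 'I_n -> A), (forall k, I (e k)) /\
    forall x, I x -> exists c : 'I_n -> R[i], x = \sum_(k < n) c k *: e k.

Definition direct_sum_decomposition (A0 A1 : set A) : Prop :=
  [/\ closed_two_sided_ideal A0, closed_two_sided_ideal A1,
      A0 `&` A1 = [set 0] &
      forall x, exists x0 x1, [/\ A0 x0, A1 x1 & x = x0 + x1]].

End CstarAlgebraDefs.

Arguments pedersen_ideal {R} A.

(* H is a Hilbert space for dot: H is complete, and its norm comes from dot,
   which is linear in its first variable. *)
Definition hilbert_dot (R : realType) (H : completeNormedModType R[i])
    (dot : {dot H for Num.conj}) : Prop :=
  forall u, `|u| ^+ 2 = dot u u.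

Definition compact_operators (R : realType) (H : completeNormedModType R[i]) :
    set (H -> H) :=
  [set f | linear f /\ precompact (f @` [set u | `|u| <= 1])].
Arguments compact_operators {R} H.

(* phi restricts to a *-isomorphism from I onto the algebra of compact operators
   on H; the last clause says that phi (cstar x) is the adjoint of phi x. *)
Definition star_isomorphism_compact_operators (R : realType)
    (A : cstarAlgType R) (I : set A) (H : completeNormedModType R[i])
    (dot : {dot H for Num.conj}) (phi : A -> H -> H) : Prop :=
  [/\ set_bij I (compact_operators H) phi,
      forall (c : R[i]) x y, I x -> I y ->
        phi (c *: x + y) = (fun u => c *: phi x u + phi y u),
      forall x y, I x -> I y -> phi (cmul x y) = phi x \o phi y &
      forall x u v, I x -> dot (phi (cstar x) u) v = dot u (phi x v)].

(* Meant for I a C*-subalgebra of A, such as a closed two-sided ideal. *)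
Definition elementary (R : realType) (A : cstarAlgType R) (I : set A) : Prop :=
  exists (H : completeNormedModType R[i]) (dot : {dot H for Num.conj})
    (phi : A -> H -> H),
    hilbert_dot dot /\ star_isomorphism_compact_operators I dot phi.

Definition has_infinite_dimensional_elementary_summand (R : realType)
    (A : cstarAlgType R) : Prop :=
  exists A0 A1 : set A, [/\ direct_sum_decomposition A0 A1, elementary A1 &
    ~ finite_dimensional A1].

(* Main.v *)
(** If [A = A0 (+) A1] with [A1] the compact operators on an infinite dimensional
    [H], let [f] be a discontinuous linear form on [H] and [w] a unit vector.  The
    elements of [K(A)] act on [H] with finite rank, hence
    [T(x, y) : h |-> f(y h) x w] is a quasi-centralizer of [K(A)]; it is unbounded
    on every closed ideal containing a rank one operator.

    Conversely, a quasi-centralizer [T] is bounded by [n + 1] on a closed ideal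
    [I_n], and it is locally bounded if the union of the [I_n] is dense.  A gliding
    hump argument shows that orthogonal self-adjoint elements [e_n] with a common
    local unit cannot all satisfy [e_n \notin I_(8^n)].  If the union is not dense,
    this yields a nonzero projection [p] with [p A p] one-dimensional and
    [p I_n = 0] for all [n].  Then [A] acts on the Hilbert space [H = A p]; an
    element with a local unit acts with finite rank, again by the gliding hump, so
    that [A] is the direct sum of the kernel of this action and of a copy of the
    compact operators on [H].  If [H] had finite dimension, [T] would be bounded on
    the summand, and [p] would lie in some [I_n].

    The functional calculus of a self-adjoint [x] with [|x| < 1] is built without
    spectral theory.  In the unitization [x = (w + w^-1) / 2] with [w] unitary; for
    a polynomial [P] bounded by [m] on [[-1, 1]], the coefficients of the Laurent
    polynomial [P((w + w^-1) / 2)] are at most [m] by discrete Fourier transform, so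
    [|P(x)| <= N m] with [N] of the order of the degree, and applying this to the
    powers of [P] gives [|P(x)| <= m]. *)

Require Import Defs.
From HB Require Import structures.
From mathcomp Require Import all_boot all_order all_algebra.
From mathcomp Require Import all_classical all_reals all_analysis.
From mathcomp Require Import complex.
From mathcomp Require Import zify ring lra.

Set Implicit Arguments.
Unset Strict Implicit.
Unset Printing Implicit Defensive.

Import Order.TTheory GRing.Theory Num.Theory numFieldNormedType.Exports.

Local Open Scope classical_set_scope.
Local Open Scope ring_scope.
Local Open Scope complex_scope.

(** The obstacle is that [K(A)] is not complete, so that uniform boundedness cannot be applied to
    [T] directly. What is available is that [K(A)] contains every element with a one-sided local
    unit; a norm convergent series whose terms share such a unit therefore stays in [K(A)], and this
    is the only completeness that the gliding hump uses.

    The gliding hump acts as a chain condition below a local unit: splitting off orthogonal elements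
    has to stop. It is used three times: to find a nonzero element that annihilates all [I_n], to
    find below it a hereditary subalgebra without two nonzero orthogonal self-adjoint elements,
    which yields [p], and to show that a local unit fixes only finitely many orthonormal vectors of
    [A p].

    Positivity is not read off from a spectrum either. The inner product on [A p] needs that
    [u^* u = a p] forces [a >= 0]; this comes from the fact that a nonzero projection plus squares
    of self-adjoint elements cannot vanish, itself a consequence of the polynomial norm bound for
    [1 - t^2]. *)

Lemma abel_pos (V : zmodType) (a s s' : V) : s = - a + s' -> s' = 0 -> a + s = 0.
Proof. by move=> -> ->; rewrite addr0 subrr. Qed.

Lemma abel_neg (V : zmodType) (a s s' : V) : s = a + s' -> s' = 0 -> - a + s = 0.
Proof. by move=> -> ->; rewrite addr0 addNr. Qed.

(** Builds a proof term that moves the summand [t] to the front of the right-nested sum [r]; a lone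
    [t] becomes [t + 0], hence the clean-up by [addr0] in [abel]. *)
Ltac abel_front t r :=
  match r with
  | (?b + ?s)%R =>
      let _ := match goal with _ => unify t b end in constr:(erefl (t + s)%R)
  | (?b + ?s)%R =>
      let h := abel_front t s in
      constr:(eq_trans (congr1 (+%R b) h) (addrCA b t _))
  | _ => let _ := match goal with _ => unify t r end in constr:(esym (addr0 t))
  end.

Ltac abel_step :=
  match goal with
  | |- (- ?a + ?s = 0)%R => let h := abel_front a s in apply: (abel_neg h)
  | |- (?a + ?s = 0)%R => let h := abel_front (- a)%R s in apply: (abel_pos h)
  end.

(* Decides equalities of sums of atoms and opposites of atoms in a Z-module. *)
Ltac abel :=
  apply/eqP; rewrite -subr_eq0; apply/eqP;
  rewrite ?(opprD, opprK, opprB, oppr0, addr0, add0r) -?addrA;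
  repeat (abel_step; rewrite ?(addr0, add0r)); reflexivity.

(** * Real-valued norms *)

Section RealNorm.
Variables (R : realType) (V : normedModType R[i]).
Implicit Types (x y z : V) (c : R[i]).

(** Norms over [R[i]] are complex numbers; taking the real part makes real arithmetic, and with it
    [lra] and [nra], applicable to them. *)
Definition nrm x : R := complex.Re `|x|.

Lemma norm_nrm x : `|x| = (nrm x)%:C.
Proof.
have := normr_ge0 x; rewrite lecE => /andP[/eqP h _].
by rewrite /nrm; move: h; case: (`|x|) => a b /= ->.
Qed.

Lemma nrm_ge0 x : 0 <= nrm x.
Proof. by have := normr_ge0 x; rewrite norm_nrm ler0c. Qed.

Lemma nrm0 : nrm 0 = 0.
Proof. by rewrite /nrm normr0. Qed.

Lemma nrm_eq0 x : nrm x = 0 -> x = 0.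
Proof. by move=> h; apply/eqP; rewrite -normr_eq0 norm_nrm h. Qed.

Lemma nrm_gt0 x : x <> 0 -> 0 < nrm x.
Proof. by move=> h; rewrite lt_def nrm_ge0 andbT; apply/eqP => /nrm_eq0. Qed.

Lemma nrmN x : nrm (- x) = nrm x.
Proof. by rewrite /nrm normrN. Qed.

Lemma nrmD x y : nrm (x + y) <= nrm x + nrm y.
Proof. by rewrite -lecR rmorphD /= -!norm_nrm; exact: ler_normD. Qed.

Lemma nrmBC x y : nrm (x - y) = nrm (y - x).
Proof. by rewrite /nrm distrC. Qed.

Lemma nrmB x y : nrm (x - y) <= nrm x + nrm y.
Proof. by rewrite -(nrmN y); exact: nrmD. Qed.

Lemma nrm_triangle y x z : nrm (x - z) <= nrm (x - y) + nrm (y - z).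
Proof. by have := nrmD (x - y) (y - z); rewrite addrA subrK. Qed.

Lemma nrm_dist x y : nrm x <= nrm (x - y) + nrm y.
Proof. by rewrite -{1}(subrK y x); exact: nrmD. Qed.

Lemma nrm_sum I (r : seq I) (P : pred I) (F : I -> V) :
  nrm (\sum_(i <- r | P i) F i) <= \sum_(i <- r | P i) nrm (F i).
Proof.
elim/big_rec2: _ => [|i y x _ h]; first by rewrite nrm0.
by apply: (le_trans (nrmD _ _)); rewrite lerD2l.
Qed.

Lemma nrm_small x : (forall e : R, 0 < e -> nrm x <= e) -> x = 0.
Proof.
move=> h; apply: nrm_eq0; apply/eqP; rewrite eq_le nrm_ge0 andbT.
by apply/ler_addgt0Pl => e e0; rewrite addr0 h.
Qed.

Lemma open_nrmP (O : set V) :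
  open O <-> forall x, O x -> exists2 e : R, 0 < e & forall y, nrm (x - y) < e -> O y.
Proof.
split.
  move=> oO x Ox; have /nbhs_ballP[e /= e0 he] := open_nbhs_nbhs (conj oO Ox).
  (* In the order of [R[i]], [0 < e] forces [e] to be real. *)
  move: e0; rewrite ltcE => /andP[/eqP ei er].
  exists (complex.Re e) => // y hy; apply: he; rewrite -ball_normE /=.
  by rewrite norm_nrm ltcE /= ei eqxx.
move=> h; rewrite openE => x /h[e e0 he]; apply/nbhs_ballP.
exists e%:C; first by rewrite /= ltcR.
by move=> y; rewrite -ball_normE /= norm_nrm ltcR; exact: he.
Qed.

Lemma open_nrm_ball x (e : R) : open [set y | nrm (x - y) < e].
Proof.
apply/open_nrmP => y /= hy; exists (e - nrm (x - y)); first by rewrite subr_gt0.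
by move=> z hz; apply: le_lt_trans (nrm_triangle y _ _) _; lra.
Qed.

Lemma closure_nrmP (S : set V) x :
  closure S x <-> forall e : R, 0 < e -> exists2 y, S y & nrm (x - y) < e.
Proof.
split.
  move=> cS e e0; have : nbhs x [set y | nrm (x - y) < e].
    by apply: open_nbhs_nbhs; split; [exact: open_nrm_ball|rewrite /= subrr nrm0].
  by move/cS => [y [Sy hy]]; exists y.
move=> h B; rewrite nbhsE => -[U [oU Ux] UB].
have /open_nrmP/(_ _ Ux)[e e0 he] := oU.
by have [y Sy /he/UB By] := h _ e0; exists y.
Qed.

Lemma closed_nrmP (S : set V) :
  closed S <-> forall x, (forall e : R, 0 < e -> exists2 y, S y & nrm (x - y) < e) -> S x.
Proof.
split=> [cS x h|h]; first by rewrite (closure_id S).1 //; exact/closure_nrmP.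
rewrite closure_id eqEsubset; split; first exact: subset_closure.
by move=> x /closure_nrmP; exact: h.
Qed.

Lemma dense_nrmP (S : set V) :
  dense S <-> forall x (e : R), 0 < e -> exists2 y, S y & nrm (x - y) < e.
Proof.
split=> [dS x e e0|h O [x Ox] /open_nrmP/(_ _ Ox)[e e0 he]].
  have [||y [hy Sy]] := dS [set y | nrm (x - y) < e]; last by exists y.
    by exists x; rewrite /= subrr nrm0.
  exact: open_nrm_ball.
by have [y Sy /he Oy] := h x e e0; exists y.
Qed.

End RealNorm.

Definition cabs (R : realType) (c : R[i]) : R := complex.Re `|c|.

Section ComplexAbs.
Variable R : realType.
Implicit Types (c d : R[i]) (r : R).

Lemma norm_cabs c : `|c| = (cabs c)%:C.
Proof. exact: (@norm_nrm R R[i]^o). Qed.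

Lemma cabs_ge0 c : 0 <= cabs c. Proof. exact: (@nrm_ge0 R R[i]^o). Qed.

Lemma cabs_real r : cabs r%:C = `|r|.
Proof. by rewrite /cabs normc_def /= expr0n addr0 sqrtr_sqr. Qed.

Lemma cabsM c d : cabs (c * d) = cabs c * cabs d.
Proof. by apply: complexI; rewrite rmorphM /= -!norm_cabs normrM. Qed.

Lemma cabsD c d : cabs (c + d) <= cabs c + cabs d.
Proof. exact: (@nrmD R R[i]^o). Qed.

Lemma cabsX c n : cabs (c ^+ n) = cabs c ^+ n.
Proof. by apply: complexI; rewrite rmorphXn /= -!norm_cabs normrX. Qed.

Lemma cabsV c : cabs c^-1 = (cabs c)^-1.
Proof. by apply: complexI; rewrite fmorphV /= -!norm_cabs normfV. Qed.

Lemma cabs1 : cabs (1 : R[i]) = 1. Proof. by rewrite /cabs normr1. Qed.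

Lemma mulcJ c : c * c^* = ((cabs c) ^+ 2)%:C.
Proof. by rewrite -sqr_normc norm_cabs rmorphXn. Qed.

Lemma cabs_sum I (r : seq I) (P : pred I) (F : I -> R[i]) :
  cabs (\sum_(i <- r | P i) F i) <= \sum_(i <- r | P i) cabs (F i).
Proof. exact: (@nrm_sum R R[i]^o). Qed.

Lemma nrmZ (V : normedModType R[i]) c (x : V) : nrm (c *: x) = cabs c * nrm x.
Proof. by apply: complexI; rewrite rmorphM /= -!norm_nrm -norm_cabs normrZ. Qed.

End ComplexAbs.

Lemma nrm_cauchy_cvg (R : realType) (V : completeNormedModType R[i]) (u : nat -> V) :
  (forall e : R, 0 < e -> exists N, forall m n, (N <= m)%N -> (N <= n)%N ->
     nrm (u m - u n) < e) ->
  exists l, forall e : R, 0 < e -> exists N, forall n, (N <= n)%N -> nrm (l - u n) < e.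
Proof.
move=> h; have : cauchy (u @ \oo).
  apply/cauchy_ballP => e e0; move: e0; rewrite ltcE => /andP[/eqP ei er].
  have [N hN] := h _ er.
  exists (u @` [set n | (N <= n)%N], u @` [set n | (N <= n)%N]).
    by split; exists N => // n /= Nn; exists n.
  move=> [a b] /= [[m Nm <-] [n Nn <-]]; rewrite -ball_normE /= norm_nrm.
  by rewrite ltcE /= ei eqxx /= hN.
move/cauchy_cvgP => /cvg_ex[l /cvgrPdist_lt ul]; exists l => e e0.
have [|N _ hN] := ul e%:C; first by rewrite ltcR.
by exists N => n /hN; rewrite norm_nrm ltcR.
Qed.

(** * The unitization *)

Local Notation "x ** y" := (cmul x y) (at level 40, left associativity).

Section CstarBasics.
Variables (R : realType) (A : cstarAlgType R).
Implicit Types (x y z a b : A) (c : R[i]).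

HB.instance Definition _ x :=
  @GRing.isZmodMorphism.Build A A (cmul x) (fun y z => eq_trans (cmulDr x y (- z))
    (congr1 (fun t => x ** y + t) (eq_trans (congr1 (cmul x) (esym (scaleN1r z)))
      (eq_trans (cmulZr (-1) x z) (scaleN1r _))))).

Lemma cmulx0 x : x ** 0 = 0. Proof. exact: raddf0. Qed.

Lemma cmulxN x y : x ** (- y) = - (x ** y). Proof. exact: raddfN. Qed.

Lemma cmulxB x y z : x ** (y - z) = x ** y - x ** z. Proof. exact: raddfB. Qed.

Lemma cmulx_sum I (r : seq I) (P : pred I) (F : I -> A) x :
  x ** (\sum_(i <- r | P i) F i) = \sum_(i <- r | P i) x ** F i.
Proof. exact: raddf_sum. Qed.

Lemma cmul0x x : 0 ** x = 0.
Proof. by have := cmulZl 0 0 x; rewrite !scale0r. Qed.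

Lemma cmulNx x y : (- x) ** y = - (x ** y).
Proof. by rewrite -scaleN1r cmulZl scaleN1r. Qed.

Lemma cmulBx x y z : (y - z) ** x = y ** x - z ** x.
Proof. by rewrite cmulDl cmulNx. Qed.

Lemma cmul_sumx I (r : seq I) (P : pred I) (F : I -> A) x :
  (\sum_(i <- r | P i) F i) ** x = \sum_(i <- r | P i) F i ** x.
Proof.
elim/big_rec2: _ => [|i y z _ <-]; first by rewrite cmul0x.
by rewrite cmulDl.
Qed.

Lemma cstarZc c x : cstar (c *: x) = conjc c *: cstar x.
Proof. exact: cstarZ. Qed.

Lemma cstarZr (r : R) x : cstar (r%:C *: x) = r%:C *: cstar x.
Proof. by rewrite cstarZc conjc_real. Qed.

Lemma cstar0 : cstar (0 : A) = 0.
Proof. by have := cstarZ 0 (0 : A); rewrite rmorph0 !scale0r. Qed.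

Lemma cstarN x : cstar (- x) = - cstar x.
Proof. by rewrite -scaleN1r cstarZ rmorphN rmorph1 scaleN1r. Qed.

Lemma cstarB x y : cstar (x - y) = cstar x - cstar y.
Proof. by rewrite cstarD cstarN. Qed.

Lemma cstar_sum I (r : seq I) (P : pred I) (F : I -> A) :
  cstar (\sum_(i <- r | P i) F i) = \sum_(i <- r | P i) cstar (F i).
Proof.
elim/big_rec2: _ => [|i y z _ <-]; first by rewrite cstar0.
by rewrite cstarD.
Qed.

Lemma nrmM x y : nrm (x ** y) <= nrm x * nrm y.
Proof. by have := normr_cmul x y; rewrite !norm_nrm -rmorphM lecR. Qed.

Lemma nrm_starM x : nrm (cstar x ** x) = nrm x ^+ 2.
Proof.
by have := normr_cstar_cmul x; rewrite !norm_nrm -rmorphXn /= => /complexI.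
Qed.

Lemma nrm_star x : nrm (cstar x) = nrm x.
Proof.
suff h y : nrm y <= nrm (cstar y).
  by apply/eqP; rewrite eq_le h andbT; have := h (cstar x); rewrite cstarK.
have [/eqP|y0] := eqVneq (nrm y) 0; first by move/eqP ->; exact: nrm_ge0.
have := nrmM (cstar y) y; rewrite nrm_starM expr2 ler_pM2r //.
by rewrite lt_def y0 nrm_ge0.
Qed.

Lemma nrm_Mstar x : nrm (x ** cstar x) = nrm x ^+ 2.
Proof. by rewrite -(nrm_star x) -{1}(cstarK x) nrm_starM. Qed.

Lemma starM_eq0 x : cstar x ** x = 0 -> x = 0.
Proof.
move=> h; apply: nrm_eq0; apply/eqP.
by rewrite -sqrf_eq0 -nrm_starM h nrm0.
Qed.

Lemma Mstar_eq0 x : x ** cstar x = 0 -> x = 0.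
Proof.
move=> h; apply: nrm_eq0; apply/eqP.
by rewrite -sqrf_eq0 -nrm_Mstar h nrm0.
Qed.

Lemma nrm_le_sqr x (C : R) : 0 <= C -> nrm (cstar x ** x) <= C ^+ 2 -> nrm x <= C.
Proof. by move=> C0; rewrite nrm_starM ler_pXn2r // nnegrE ?nrm_ge0. Qed.

End CstarBasics.

Section Unitization.
Variables (R : realType) (A : cstarAlgType R).

Definition unitization : Type := (R[i] * A)%type.

HB.instance Definition _ := GRing.Zmodule.copy unitization (R[i] * A)%type.

Implicit Types X Y Z : unitization.

Definition unitization_mul X Y : unitization :=
  (X.1 * Y.1, X.1 *: Y.2 + Y.1 *: X.2 + X.2 ** Y.2).

Definition unitization_one : unitization := (1, 0).

Lemma unitization_mulA : associative unitization_mul.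
Proof.
move=> [a x] [b y] [c z]; rewrite /unitization_mul /= mulrA; congr pair.
rewrite !(cmulDr, cmulDl, cmulZl, cmulZr, cmulA, scalerDr, scalerA).
by rewrite (mulrC c a) (mulrC c b); abel.
Qed.

Lemma unitization_mul1x : left_id unitization_one unitization_mul.
Proof.
by move=> [a x]; rewrite /unitization_mul /= mul1r scale1r scaler0 cmul0x !addr0.
Qed.

Lemma unitization_mulx1 : right_id unitization_one unitization_mul.
Proof.
by move=> [a x]; rewrite /unitization_mul /= mulr1 scale1r scaler0 cmulx0 addr0 add0r.
Qed.

Lemma unitization_mulDl : left_distributive unitization_mul +%R.
Proof.
move=> [a x] [b y] [c z]; rewrite /unitization_mul /= mulrDl; congr pair => /=.
by rewrite scalerDl scalerDr cmulDl; abel.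
Qed.

Lemma unitization_mulDr : right_distributive unitization_mul +%R.
Proof.
move=> [a x] [b y] [c z]; rewrite /unitization_mul /= mulrDr; congr pair => /=.
by rewrite scalerDl scalerDr cmulDr; abel.
Qed.

Lemma unitization_1neq0 : unitization_one != 0.
Proof. by apply/eqP => -[] /eqP; rewrite oner_eq0. Qed.

HB.instance Definition _ := GRing.Zmodule_isNzRing.Build unitization
  unitization_mulA unitization_mul1x unitization_mulx1 unitization_mulDl
  unitization_mulDr unitization_1neq0.

Definition unitization_scale (c : R[i]) X : unitization := (c * X.1, c *: X.2).

Fact unitization_scaleA c d X :
  unitization_scale c (unitization_scale d X) = unitization_scale (c * d) X.
Proof. by rewrite /unitization_scale /= mulrA scalerA. Qed.

Fact unitization_scale1 : left_id 1 unitization_scale.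
Proof. by move=> [a x]; rewrite /unitization_scale /= mul1r scale1r. Qed.

Fact unitization_scaleDr : right_distributive unitization_scale +%R.
Proof. by move=> c [a x] [b y]; rewrite /unitization_scale /= mulrDr scalerDr. Qed.

Fact unitization_scaleDl X : {morph unitization_scale^~ X : c d / c + d}.
Proof. by move=> c d; rewrite /unitization_scale /= mulrDl scalerDl. Qed.

HB.instance Definition _ := GRing.Zmodule_isLmodule.Build R[i] unitization
  unitization_scaleA unitization_scale1 unitization_scaleDr unitization_scaleDl.

Fact unitization_scaleAl c X Y : c *: (X * Y) = (c *: X) * Y :> unitization.
Proof.
case: X Y => a x [b y]; congr pair => /=; first by rewrite mulrA.
by rewrite !scalerDr !scalerA cmulZl (mulrC c b).
Qed.

Fact unitization_scaleAr c X Y : c *: (X * Y) = X * (c *: Y) :> unitization.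
Proof.
case: X Y => a x [b y]; congr pair => /=; first by rewrite mulrCA.
by rewrite !scalerDr !scalerA cmulZr (mulrC c a).
Qed.

HB.instance Definition _ :=
  GRing.Lmodule_isLalgebra.Build R[i] unitization unitization_scaleAl.
HB.instance Definition _ :=
  GRing.Lalgebra_isAlgebra.Build R[i] unitization unitization_scaleAr.

Definition uin (x : A) : unitization := (0, x).

Lemma uinD x y : uin (x + y) = uin x + uin y.
Proof. by congr pair; rewrite /= addr0. Qed.

Lemma uinB x y : uin (x - y) = uin x - uin y.
Proof. by congr pair; rewrite /= subr0. Qed.

Lemma uinM x y : uin (x ** y) = uin x * uin y.
Proof. by congr pair; rewrite /= ?mulr0 // !scale0r !add0r. Qed.

Lemma uinZ c x : uin (c *: x) = c *: uin x.
Proof. by congr pair; rewrite /= mulr0. Qed.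

Definition ustar X : unitization := (X.1^*, cstar X.2).

Lemma ustarM X Y : ustar (X * Y) = ustar Y * ustar X.
Proof.
case: X Y => a x [b y]; congr pair => /=; first by rewrite rmorphM mulrC.
by rewrite !cstarD !cstarZ cstarM; abel.
Qed.

Lemma ustarD X Y : ustar (X + Y) = ustar X + ustar Y.
Proof. by congr pair => /=; rewrite ?rmorphD ?cstarD. Qed.

Lemma ustarK : involutive ustar.
Proof. by move=> [a x]; rewrite /ustar /= conjcK cstarK. Qed.

Lemma ustarZ c X : ustar (c *: X) = conjc c *: ustar X.
Proof. by congr pair => /=; rewrite ?rmorphM ?cstarZ. Qed.

Lemma ustar1 : ustar 1 = 1.
Proof. by congr pair; rewrite /= ?rmorph1 ?cstar0 ?oppr0. Qed.

Lemma ustarX X n : ustar (X ^+ n) = ustar X ^+ n.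
Proof. by elim: n => [|n IHn]; rewrite ?ustar1 // exprS exprSr ustarM IHn. Qed.

Definition uact X (b : A) : A := X.1 *: b + X.2 ** b.

Lemma uact1 b : uact 1 b = b.
Proof. by rewrite /uact /= scale1r cmul0x addr0. Qed.

Lemma uactM X Y b : uact (X * Y) b = uact X (uact Y b).
Proof.
case: X Y => a x [c y]; rewrite /uact /=.
by rewrite !(cmulDl, cmulDr, cmulZl, cmulZr, scalerDr, scalerA, cmulA); abel.
Qed.

Lemma uactD X Y b : uact (X + Y) b = uact X b + uact Y b.
Proof. by rewrite /uact /= cmulDl scalerDl; abel. Qed.

Lemma uactZ c X b : uact (c *: X) b = c *: uact X b.
Proof. by rewrite /uact /= cmulZl scalerDr scalerA. Qed.

Lemma uact_uin x b : uact (uin x) b = x ** b.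
Proof. by rewrite /uact /= scale0r add0r. Qed.

Lemma uact_star X b d : cstar (uact X b) ** d = cstar b ** uact (ustar X) d.
Proof.
case: X => a x; rewrite /uact /= cstarD cstarZ cstarM.
by rewrite cmulDl cmulDr cmulZl cmulZr cmulA.
Qed.

(* The C*-norm of the unitization is the operator norm of its left action on [A]
   (for nonunital [A]); only upper bounds on it are needed. *)
Definition ubound X (C : R) : Prop := forall b, nrm (uact X b) <= C * nrm b.

Lemma ubound_le X C D : C <= D -> ubound X C -> ubound X D.
Proof.
by move=> CD h b; apply: (le_trans (h b)); rewrite ler_wpM2r ?nrm_ge0.
Qed.

Lemma uboundM X Y C D : 0 <= C -> ubound X C -> ubound Y D -> ubound (X * Y) (C * D).
Proof.
move=> C0 hX hY b; rewrite uactM; apply: (le_trans (hX _)).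
by rewrite -mulrA ler_wpM2l.
Qed.

Lemma uboundD X Y C D : ubound X C -> ubound Y D -> ubound (X + Y) (C + D).
Proof.
move=> hX hY b; rewrite uactD; apply: (le_trans (nrmD _ _)).
by rewrite mulrDl lerD.
Qed.

Lemma uboundZ c X C : ubound X C -> ubound (c *: X) (cabs c * C).
Proof. by move=> hX b; rewrite uactZ nrmZ -mulrA ler_wpM2l ?cabs_ge0. Qed.

Lemma ubound1 : ubound 1 1.
Proof. by move=> b; rewrite uact1 mul1r. Qed.

Lemma ubound0 : ubound 0 0.
Proof. by move=> b; rewrite /uact /= scale0r cmul0x addr0 nrm0 mul0r. Qed.

Lemma ubound_sum I (r : seq I) (P : pred I) (F : I -> unitization) (C : I -> R) :
  (forall i, ubound (F i) (C i)) ->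
  ubound (\sum_(i <- r | P i) F i) (\sum_(i <- r | P i) C i).
Proof. by move=> h; elim/big_ind2: _ => //; [exact: ubound0|move=> *; exact: uboundD]. Qed.

(** The C*-identity of [A], transferred to the action: [|X b|^2] is the norm of [b^* (X^* X b)]. *)
Lemma ubound_sqr X C : 0 <= C -> ubound (ustar X * X) (C ^+ 2) -> ubound X C.
Proof.
move=> C0 h b; apply: nrm_le_sqr; first by rewrite mulr_ge0 ?nrm_ge0.
rewrite uact_star -uactM; apply: (le_trans (nrmM _ _)); rewrite nrm_star.
by apply: (le_trans (ler_wpM2l (nrm_ge0 _) (h b))); rewrite exprMn; lra.
Qed.

Lemma ubound_isometry X : ustar X * X = 1 -> ubound X 1.
Proof. by move=> h; apply: ubound_sqr => //; rewrite h expr1n; exact: ubound1. Qed.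

(** Testing the bound on [b = x^*] gives [|x|^2 <= C |x|]. *)
Lemma ubound_uin x C : 0 <= C -> ubound (uin x) C -> nrm x <= C.
Proof.
move=> C0 /(_ (cstar x)); rewrite uact_uin nrm_Mstar nrm_star expr2.
have [/eqP|x0] := eqVneq (nrm x) 0; first by move/eqP ->.
by rewrite ler_pM2r // lt_def x0 nrm_ge0.
Qed.

Lemma ubound_uin_nrm x : ubound (uin x) (nrm x).
Proof. by move=> b; rewrite uact_uin nrmM. Qed.

End Unitization.

(** * Norm convergence and unitary dilation *)

Section SequenceLimits.
Variables (R : realType) (V : normedModType R[i]).
Implicit Types (u v : nat -> V) (x y l : V).

Definition ncvg u l : Prop :=
  forall e : R, 0 < e -> exists N, forall n, (N <= n)%N -> nrm (l - u n) < e.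

Lemma ncvg_cst x : ncvg (fun=> x) x.
Proof. by move=> e e0; exists 0%N => n _; rewrite subrr nrm0. Qed.

Lemma ncvg_uniq u l l' : ncvg u l -> ncvg u l' -> l = l'.
Proof.
move=> h h'; apply/eqP; rewrite -subr_eq0; apply/eqP/nrm_small => e e0.
have e2 : 0 < e / 2 by rewrite divr_gt0.
have [N hN] := h _ e2; have [N' hN'] := h' _ e2.
have := hN _ (leq_maxl N N'); have := hN' _ (leq_maxr N N').
rewrite (nrmBC l') => h1 h2.
by have := nrm_triangle (u (maxn N N')) l l'; lra.
Qed.

Lemma ncvg_eq u v l : (forall n, u n = v n) -> ncvg u l -> ncvg v l.
Proof. by move=> /funext ->. Qed.

Lemma ncvgD u v l l' : ncvg u l -> ncvg v l' -> ncvg (fun n => u n + v n) (l + l').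
Proof.
move=> h h' e e0; have e2 : 0 < e / 2 by rewrite divr_gt0.
have [N hN] := h _ e2; have [N' hN'] := h' _ e2.
exists (maxn N N') => n; rewrite geq_max => /andP[/hN h1 /hN' h2].
have -> : l + l' - (u n + v n) = (l - u n) + (l' - v n) by abel.
by have := nrmD (l - u n) (l' - v n); lra.
Qed.

Lemma ncvg_lip (W : normedModType R[i]) (f : V -> W) (C : R) u l :
  (forall x y, nrm (f x - f y) <= C * nrm (x - y)) -> ncvg u l ->
  forall e : R, 0 < e -> exists N, forall n, (N <= n)%N -> nrm (f l - f (u n)) < e.
Proof.
move=> hf h e e0; have C1 : 0 < `|C| + 1 by rewrite ltr_wpDl.
have [N hN] := h (e / (`|C| + 1)) (divr_gt0 e0 C1); exists N => n /hN.
rewrite ltr_pdivlMr // => h1; apply: le_lt_trans h1.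
apply: (le_trans (hf _ _)); rewrite mulrC ler_wpM2l ?nrm_ge0 //.
by rewrite (le_trans (ler_norm _)) // lerDl.
Qed.

Lemma ncvg_shift u l : ncvg u l -> ncvg (fun n => u n.+1) l.
Proof. by move=> h e /h[N hN]; exists N => n /leqW /hN. Qed.

End SequenceLimits.

Section GeometricCauchy.
Variables (R : realType) (V : completeNormedModType R[i]) (u : nat -> V) (C q : R).
Hypotheses (C0 : 0 <= C) (q0 : 0 <= q) (q1 : q < 1).
Hypothesis hu : forall n, nrm (u n.+1 - u n) <= C * q ^+ n.

(** Keeping [1 - q] on the left lets the geometric sum telescope without division. *)
Lemma geometric_dist n k : (1 - q) * nrm (u (n + k)%N - u n) <= C * (q ^+ n - q ^+ (n + k)).
Proof.
elim: k => [|k IHk]; first by rewrite addn0 !subrr nrm0 !mulr0.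
have h1 := nrm_triangle (u (n + k)%N) (u (n + k).+1) (u n).
have h2 := hu (n + k); rewrite addnS.
have q'0 : 0 <= 1 - q by rewrite subr_ge0 ltW.
have := ler_wpM2l q'0 h1; have := ler_wpM2l q'0 h2.
by rewrite exprSr; nra.
Qed.

Lemma geometric_ncvg : exists l, ncvg u l.
Proof.
apply: nrm_cauchy_cvg => e e0.
have q'0 : 0 < 1 - q by rewrite subr_gt0.
have C1 : 0 < 2 * C + 1 by rewrite ltr_wpDl // mulr_ge0.
(* Both [u m] and [u n] are compared with [u N], which costs [2 C q^N / (1 - q)]; the [+ 1] covers
   [C = 0]. *)
have d0 : 0 < (1 - q) * e / (2 * C + 1) by rewrite divr_gt0 ?mulr_gt0.
have hq : `|q| < 1 by rewrite ger0_norm.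
have /cvgrPdist_lt/(_ _ d0)[N _ hN] := cvg_expr hq.
have hN' := hN N (leqnn N).
exists N => m n Nm Nn.
have hm := geometric_dist N (m - N); have hn := geometric_dist N (n - N).
rewrite !subnKC // in hm hn.
move: hN'; rewrite /= sub0r normrN ger0_norm ?exprn_ge0 // ltr_pdivlMr // => hN'.
have := nrm_triangle (u N) (u m) (u n); rewrite (nrmBC (u N)) => h3.
have := exprn_ge0 m q0; have := exprn_ge0 n q0; have := exprn_ge0 N q0 => p1 p2 p3.
rewrite -(ltr_pM2l q'0).
have h4 := ler_wpM2l (ltW q'0) h3.
have := mulr_ge0 C0 p2; have := mulr_ge0 C0 p3.
by nra.
Qed.

End GeometricCauchy.

Lemma ncvgM (R : realType) (A : cstarAlgType R) (u v : nat -> A) (l l' : A) :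
  ncvg u l -> ncvg v l' -> ncvg (fun n => u n ** v n) (l ** l').
Proof.
move=> h h' e e0.
pose C := nrm l + nrm l' + 1.
have C0 : 0 < C by rewrite /C; have := nrm_ge0 l; have := nrm_ge0 l'; lra.
pose d := Num.min 1 (e / (2 * C)).
have d0 : 0 < d by rewrite lt_min ltr01 divr_gt0 ?mulr_gt0.
have [N hN] := h _ d0; have [N' hN'] := h' _ d0.
exists (maxn N N') => n; rewrite geq_max => /andP[/hN h1 /hN' h2].
have -> : l ** l' - u n ** v n = (l - u n) ** l' + u n ** (l' - v n).
  by rewrite cmulBx cmulxB; abel.
apply: (le_lt_trans (nrmD _ _)).
have d1 : d <= 1 by rewrite /d ge_min lexx.
have de : d <= e / (2 * C) by rewrite /d ge_min lexx orbT.
move: de; rewrite ler_pdivlMr ?mulr_gt0 // => de.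
have := nrmM (l - u n) l'; have := nrmM (u n) (l' - v n).
have := nrm_dist (u n) l; rewrite (nrmBC (u n)).
have := nrm_ge0 l'; have := nrm_ge0 (u n); have := nrm_ge0 (l' - v n); have := nrm_ge0 l.
rewrite /C in de *.
move: (nrm (l - u n)) (nrm (l' - v n)) (nrm (u n)) (nrm l) (nrm l') h1 h2 de => a b p r s.
move=> ad bd de r0 b0 p0 s0 pr x1 x2.
have : a * s <= d * s by rewrite ler_wpM2r // ltW.
have : p * b < (r + 1) * d.
  have : p * b <= p * d by rewrite ler_wpM2l // ltW.
  have : p * d < (r + 1) * d by rewrite ltr_pM2r //; lra.
  by lra.
by lra.
Qed.

Lemma ncvg_star (R : realType) (A : cstarAlgType R) (u : nat -> A) (l : A) :
  ncvg u l -> ncvg (fun n => cstar (u n)) (cstar l).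
Proof.
apply: (ncvg_lip (C := 1)) => x y; by rewrite -cstarB nrm_star mul1r.
Qed.

Lemma ncvgZ (R : realType) (V : normedModType R[i]) (u : nat -> V) (l : V) (c : R[i]) :
  ncvg u l -> ncvg (fun n => c *: u n) (c *: l).
Proof.
by apply: (ncvg_lip (C := cabs c)) => x y; rewrite -scalerBr nrmZ.
Qed.

Section UnitaryDilation.
Variables (R : realType) (A : cstarAlgType R) (x : A).
Hypotheses (xsa : cstar x = x) (x1 : nrm x < 1).

Let u := fix u n : A :=
  if n is n'.+1 then (2^-1 : R)%:C *: (x ** x + u n' ** u n') else 0.

Let uS n : u n.+1 = (2^-1 : R)%:C *: (x ** x + u n ** u n). Proof. by []. Qed.

Lemma dilation_iterates n : [/\ cstar (u n) = u n, u n ** x = x ** u n & nrm (u n) <= nrm x].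
Proof.
elim: n => [|n [s c h]]; first by rewrite /= cstar0 cmul0x cmulx0 nrm0 nrm_ge0.
split; rewrite uS.
- by rewrite cstarZr cstarD !cstarM xsa s.
- by rewrite cmulZl cmulZr cmulDl cmulDr -cmulA -(cmulA (u n)) c !cmulA c.
- rewrite nrmZ cabs_real ger0_norm ?invr_ge0 //.
  have := nrmD (x ** x) (u n ** u n).
  have := nrmM x x; have := nrmM (u n) (u n); have := nrm_ge0 x; have := nrm_ge0 (u n).
  move: h x1; move: (nrm x) (nrm (u n)) => p a ap p1 a0 p0.
  have : a * a <= p * p by rewrite ler_pM.
  have : p * p <= p by rewrite ler_piMr // ltW.
  by lra.
Qed.

(* [1 - u] is the square root of [1 - x^2]; it solves [u = (x^2 + u^2) / 2]. *)
Lemma dilation_exists :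
  exists u : A, [/\ cstar u = u, u ** x = x ** u & u + u = x ** x + u ** u].
Proof.
have hu n : nrm (u n.+1 - u n) <= nrm x * nrm x ^+ n.
  elim: n => [|n IHn].
    by rewrite expr0 mulr1 subr0; have [] := dilation_iterates 1.
  have -> : u n.+2 - u n.+1 =
      (2^-1 : R)%:C *: (u n.+1 ** (u n.+1 - u n) + (u n.+1 - u n) ** u n).
    rewrite (uS n.+1) {2}(uS n) -scalerBr; congr (_ *: _).
    by rewrite cmulxB cmulBx; abel.
  rewrite nrmZ cabs_real ger0_norm ?invr_ge0 //.
  have [_ _ h1] := dilation_iterates n.+1; have [_ _ h0] := dilation_iterates n.
  have := nrmD (u n.+1 ** (u n.+1 - u n)) ((u n.+1 - u n) ** u n).
  have := nrmM (u n.+1) (u n.+1 - u n); have := nrmM (u n.+1 - u n) (u n).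
  rewrite exprS; move: (nrm_ge0 (u n.+1 - u n)) (nrm_ge0 x) IHn h0 h1.
  move: (nrm (u n.+1 - u n)) (nrm x) (nrm (u n)) (nrm (u n.+1)) (nrm x ^+ n) => d p a b q.
  move=> d0 p0 hd ha hb.
  have : b * d <= p * d by rewrite ler_wpM2r.
  have : d * a <= d * p by rewrite ler_wpM2l.
  have : p * d <= p * (p * q) by rewrite ler_wpM2l.
  by lra.
have [l ul] := geometric_ncvg (nrm_ge0 x) (nrm_ge0 x) x1 hu.
exists l; split.
- apply: (ncvg_uniq (ncvg_star ul)); apply: ncvg_eq ul => n.
  by have [] := dilation_iterates n.
- apply: (ncvg_uniq (ncvgM ul (ncvg_cst x))).
  apply: ncvg_eq (ncvgM (ncvg_cst x) ul) => n.
  by have [] := dilation_iterates n.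
have : l = (2^-1 : R)%:C *: (x ** x + l ** l).
  apply: (ncvg_uniq (ncvg_shift ul)).
  exact: ncvgZ (ncvgD (ncvg_cst (x ** x)) (ncvgM ul ul)).
move=> h; rewrite {1 2}h -scalerDl -rmorphD /=.
by have -> : 2^-1 + 2^-1 = 1 :> R; [lra|rewrite scale1r].
Qed.

(** [W] is [x + i (1 - v)], unitary since [(1 - v)^2 = 1 - x^2] and [v] commutes with [x]. Its
    scalar part is ['i], which is why the unitization is introduced. *)
Lemma unitary_dilation : exists W W' : unitization A,
  [/\ ustar W = W', W * W' = 1, W' * W = 1 & uin x + uin x = W + W'].
Proof.
have [v [vsa vx hv]] := dilation_exists.
have ii : 'i * 'i = -1 :> R[i] by rewrite -expr2 sqr_i.
have iJ : conjc 'i = - 'i :> R[i] by congr (_ +i* _); rewrite oppr0.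
pose z := 'i *: v.
have iz : 'i *: z = - v by rewrite /z scalerA ii scaleN1r.
have zsa : cstar z = - z by rewrite /z cstarZc vsa iJ scaleNr.
have zx : z ** x = x ** z by rewrite /z cmulZl cmulZr vx.
have zz : z ** z = x ** x - (v + v).
  by rewrite hv /z cmulZl cmulZr scalerA ii scaleN1r; abel.
exists ('i, x - z), (- 'i, x + z); split.
- by congr pair => //=; rewrite cstarB xsa zsa opprK.
- congr pair => /=; first by rewrite mulrN ii opprK.
  rewrite scaleNr scalerDr scalerBr iz cmulBx !cmulDr zx zz; abel.
- congr pair => /=; first by rewrite mulNr ii opprK.
  rewrite scaleNr scalerBr scalerDr iz cmulDl !cmulxB zx zz; abel.
- by congr pair => /=; [rewrite subrr addr0|abel].
Qed.

End UnitaryDilation.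

(** * Norm bounds for polynomials by discrete Fourier transform *)

Section FourierCoefficients.
Variable R : realType.

(** Orders that are powers of two suffice for the transform, and such roots arise by iterated square
    roots of [-1]. The order is exact because the power [2^K] of the root is still [-1]. *)
Lemma primitive_root_pow2 K : exists z : R[i], (2 ^ K.+1).-primitive_root z.
Proof.
pose r := fix r n : R[i] := if n is n'.+1 then sqrtc (r n') else -1.
have hr n : r n ^+ (2 ^ n) = -1.
  elim: n => [|n IHn]; first by rewrite expn0 expr1.
  by rewrite expnS exprM /= sqr_sqrtc.
have z1 : r K ^+ (2 ^ K.+1) = 1 by rewrite expnSr exprM hr sqrrN expr1n.
have [m pm] := prim_order_exists (expn_gt0 2 _) z1.
move=> /dvdn_pfactor[//|j jK mj]; exists (r K); suff <- : j = K.+1 by rewrite -mj.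
apply/eqP; rewrite eqn_leq jK ltnNge /=; apply/negP => jK'.
have : r K ^+ (2 ^ K) = 1.
  by rewrite -(subnK jK') expnD mulnC exprM -mj subnK // (prim_expr_order pm) expr1n.
by move/eqP; rewrite hr eq_sym -subr_eq0 opprK -mulr2n pnatr_eq0.
Qed.

Lemma primitive_root_sum N (z : R[i]) k : N.-primitive_root z ->
  \sum_(j < N) (z ^+ k) ^+ j = if (N %| k)%N then N%:R else 0.
Proof.
move=> pz; rewrite (prim_order_dvd pz); case: eqVneq => [->|zk].
  by rewrite (eq_bigr (fun=> 1)) => [|j _]; rewrite ?expr1n // sumr_const card_ord.
have := subrX1 (z ^+ k) N; rewrite -exprM mulnC exprM (prim_expr_order pz) expr1n subrr.
by move/esym/eqP; rewrite mulf_eq0 subr_eq0 (negbTE zk) => /eqP.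
Qed.

(** Fourier inversion: [N G_k] is the sum over [j] of [z^(-jk) G(z^j)], with [N - k] standing for
    [-k]; the powers of [z] have modulus one. *)
Lemma coef_bound N (z : R[i]) (G : {poly R[i]}) (m : R) k : N.-primitive_root z ->
  (size G <= N)%N -> (forall j, cabs G.[z ^+ j] <= m) -> cabs G`_k <= m.
Proof.
move=> pz sG hG; have N0 := prim_order_gt0 pz.
have m0 : 0 <= m by apply: le_trans (hG 0%N); exact: cabs_ge0.
have [kN|kN] := leqP N k.
  by rewrite nth_default ?(leq_trans sG) // /cabs normr0.
have z1 : cabs z = 1.
  have : cabs z ^+ N = 1 by rewrite -cabsX (prim_expr_order pz) cabs1.
  by move/eqP; rewrite pexpr_eq1 ?cabs_ge0 // => /eqP.
have : \sum_(j < N) (z ^+ (N - k)) ^+ j * G.[z ^+ j] = N%:R * G`_k.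
  under eq_bigr => j _ do rewrite (horner_coef_wide _ sG) mulr_sumr.
  rewrite exchange_big /= (bigD1 (Ordinal kN)) //= [X in _ + X]big1 => [|i ik].
    rewrite addr0; under eq_bigr => j _ do
      rewrite mulrCA -!exprM (mulnC j) -exprD -mulnDl subnK ?(ltnW kN) // mulnC mulrC.
    rewrite -mulr_suml; congr (_ * _); rewrite (eq_bigr (fun=> 1)) => [|j _].
      by rewrite sumr_const card_ord.
    by rewrite mulnC exprM (prim_expr_order pz) expr1n.
  under eq_bigr => j _ do
      rewrite mulrCA -!exprM (mulnC j) -exprD -mulnDl exprM mulrC.
  rewrite -mulr_suml primitive_root_sum // ifN ?mul0r //.
  (* As [0 < N - k + i < 2 N], divisibility by [N] leaves only the value [N], that is [i = k]. *)
  have kN' := ltnW kN; apply: contra ik => /dvdnP[[|[|q]]] h; apply/eqP/val_inj => /=.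
  - by move: (ltn_ord i) kN h; lia.
  - by move: h; lia.
  - by move: (ltn_ord i) h; nia.
move=> h; have : cabs (N%:R * G`_k) <= N%:R * m.
  rewrite -h; apply: (le_trans (cabs_sum _ _ _)).
  apply: (@le_trans _ _ (\sum_(j < N) m)); last by rewrite sumr_const card_ord mulr_natl.
  by apply: ler_sum => j _; rewrite cabsM !cabsX z1 !expr1n mul1r.
rewrite cabsM; have -> : cabs (N%:R : R[i]) = N%:R.
  by rewrite -(rmorph_nat (real_complex R)) cabs_real ger0_norm.
by rewrite ler_pM2l ?ltr0n.
Qed.

End FourierCoefficients.

Lemma ubound_sqr_iter (R : realType) (A : cstarAlgType R) (Y : unitization A) (C : R) n :
  ustar Y = Y -> 0 <= C -> ubound (Y ^+ (2 ^ n)) (C ^+ (2 ^ n)) -> ubound Y C.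
Proof.
elim: n Y C => [|n IHn] Y C Ysa C0; first by rewrite expn0 !expr1.
rewrite expnS !exprM => h; apply: ubound_sqr => //; rewrite Ysa -expr2.
by apply: IHn => //; rewrite ?ustarX ?Ysa ?exprn_ge0.
Qed.

(** The size of [P^(2^n)] grows like [2^n], so the crude bound loses a factor [2^n C], which must be
    negligible against [q^(2^n)]. Bernoulli's inequality is squared once, so that [4^n (q - 1)^2]
    beats [2^n]. *)
Lemma superexp_growth (R : realType) (q C : R) :
  1 < q -> exists n, 2 ^+ n * C <= q ^+ (2 ^ n).
Proof.
move=> q1; have q0 : 0 < (q - 1) ^+ 2 by rewrite exprn_gt0 // subr_gt0.
have [n hn] : exists n : nat, 2 * C / (q - 1) ^+ 2 <= n%:R.
  exists (Num.truncn (2 * C / (q - 1) ^+ 2)).+1.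
  exact: ltW (Num.Theory.truncnS_gt _).
have bernoulli k : 1 + k%:R * (q - 1) <= q ^+ k.
  elim: k => [|k IHk]; first by rewrite mul0r addr0.
  rewrite exprS -natr1; have : 0 <= k%:R :> R by [].
  have : 0 <= q - 1 by rewrite subr_ge0 ltW.
  by nra.
exists n.+1; rewrite expnS mulnC exprM.
have h2 := bernoulli (2 ^ n)%N; rewrite natrX in h2.
have h3 : n%:R <= 2 ^+ n :> R by rewrite -natrX ler_nat ltnW // ltn_expl.
have h4 : 2 ^+ n * (q - 1) <= q ^+ (2 ^ n) by lra.
have h5 : (2 ^+ n * (q - 1)) ^+ 2 <= (q ^+ (2 ^ n)) ^+ 2.
  have p0 : 0 <= 2 ^+ n * (q - 1) by rewrite mulr_ge0 ?exprn_ge0 // subr_ge0 ltW.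
  by rewrite ler_pXn2r // nnegrE // (le_trans p0).
apply: le_trans h5; rewrite exprMn exprS (mulrC 2) expr2 -!mulrA.
rewrite ler_wpM2l ?exprn_ge0 //.
move: hn; rewrite ler_pdivrMr // => hn; apply: (le_trans hn).
by rewrite ler_wpM2r // ltW.
Qed.

Lemma horner_alg_wide (K : nzRingType) (B : algType K) (w : B) (n : nat) (P : {poly K}) :
  (size P <= n)%N -> horner_alg w P = \sum_(i < n) P`_i *: w ^+ i.
Proof.
move=> sP; have {1}-> : P = \sum_(i < n) P`_i *: 'X^i.
  apply/polyP => i; rewrite -poly_def coef_poly; case: ltnP => // ni.
  by rewrite nth_default // (leq_trans sP).
rewrite rmorph_sum; apply: eq_bigr => i _.
by rewrite -mul_polyC rmorphM /= horner_algC mulr_algl rmorphXn /= horner_algX.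
Qed.

Section LaurentPolynomial.
Variables (R : realType) (B : algType R[i]) (w w' : B).
Hypotheses (ww' : w * w' = 1) (w'w : w' * w = 1).

(* The polynomial [G] with [G(w) = w^d P((w + w^-1) / 2)]. *)
Definition symmetrized (d : nat) (P : {poly R[i]}) : {poly R[i]} :=
  \sum_(i < d.+1) (P`_i / 2 ^+ i) *: (('X ^+ 2 + 1) ^+ i * 'X ^+ (d - i)).

Lemma size_symmetrized (d : nat) (P : {poly R[i]}) : (size (symmetrized d P) <= (2 * d).+1)%N.
Proof.
apply: (leq_trans (size_sum _ _ _)); apply/bigmax_leqP => i _.
apply: (leq_trans (size_scale_leq _ _)).
apply: (leq_trans (size_polyMleq _ _)); rewrite size_polyXn addnS /=.
have := size_poly_exp_leq ('X ^+ 2 + 1 : {poly R[i]}) i.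
have -> : size ('X ^+ 2 + 1 : {poly R[i]}) = 3%N.
  by rewrite size_polyDl size_polyXn // size_poly1.
by have := ltn_ord i; move: (size _) => a /=; lia.
Qed.

Lemma horner_alg_symmetrized (d : nat) (P : {poly R[i]}) (X : B) :
  X + X = w + w' -> (size P <= d.+1)%N ->
  horner_alg w (symmetrized d P) = w ^+ d * horner_alg X P.
Proof.
move=> hX sP.
have cww' : GRing.comm w w' by rewrite /GRing.comm ww' w'w.
have cw : GRing.comm w (w + w') by apply: commrD => //; exact: commr_refl.
have wX : w * (w + w') = w ^+ 2 + 1 by rewrite mulrDr ww' expr2.
rewrite (horner_alg_wide _ sP) mulr_sumr rmorph_sum; apply: eq_bigr => i _.
rewrite -mul_polyC rmorphM /= horner_algC mulr_algl rmorphM /= !rmorphXn /= rmorphD /= rmorphXn /= horner_algX rmorph1.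
have -> : X ^+ i = (2 ^+ i)^-1 *: (w + w') ^+ i.
  rewrite -hX -mulr2n -(scaler_nat 2 X) exprZn scalerA mulVf ?scale1r //.
rewrite -scalerAr -scalerAr scalerA; congr (_ *: _).
have id : (i <= d)%N by rewrite -ltnS.
have -> : w ^+ d = w ^+ (d - i) * w ^+ i by rewrite -exprD subnK.
rewrite -wX exprMn_comm // -[RHS]mulrA.
have cwi : GRing.comm w (w ^+ i * (w + w') ^+ i).
  by apply: commrM; apply: commrX => //; exact: commr_refl.
exact: commrX (commr_sym cwi).
Qed.

End LaurentPolynomial.

Section PolynomialBound.
Variables (R : realType) (A : cstarAlgType R).

Definition upoly (x : A) (P : {poly R}) : unitization A :=
  horner_alg (uin x) (map_poly (real_complex R) P).

HB.instance Definition _ x := GRing.RMorphism.copy (upoly x)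
  (horner_alg (uin x) \o map_poly (real_complex R)).

Lemma upolyX x : upoly x 'X = uin x.
Proof. by rewrite /upoly map_polyX horner_algX. Qed.

Lemma upolyC x (c : R) : upoly x c%:P = c%:C *: 1.
Proof. by rewrite /upoly map_polyC horner_algC. Qed.

Lemma upoly_wide (x : A) n (P : {poly R}) : (size P <= n)%N ->
  upoly x P = \sum_(i < n) (P`_i)%:C *: uin x ^+ i.
Proof.
move=> sP; rewrite /upoly (@horner_alg_wide _ _ _ n) ?size_map_poly //.
by apply: eq_bigr => i _; rewrite coef_map.
Qed.

Lemma upoly_star x P : cstar x = x -> ustar (upoly x P) = upoly x P.
Proof.
move=> xsa; rewrite (upoly_wide x (leqnn _)).
have hs : ustar (uin x) = uin x by congr pair; rewrite /= ?oppr0.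
elim/big_rec: _ => [|i X _ IHX]; first by congr pair; rewrite /= ?oppr0 ?cstar0.
by rewrite ustarD ustarZ ustarX hs conjc_real IHX.
Qed.

Lemma horner_real (P : {poly R}) (r : R) : (map_poly (real_complex R) P).[r%:C] = (P.[r])%:C.
Proof. exact: horner_map. Qed.

Lemma upoly_crude_bound x (P : {poly R}) (m : R) K : cstar x = x -> nrm x < 1 ->
  (2 * size P < 2 ^ K.+1)%N -> (forall r, `|r| <= 1 -> `|P.[r]| <= m) ->
  ubound (upoly x P) (2 ^+ K.+1 * m).
Proof.
move=> xsa x1 sK hP; have [W [W' [sW WW' W'W hW]]] := unitary_dilation xsa x1.
set Pc := map_poly (real_complex R) P; set d := size P.
have sP : (size Pc <= d.+1)%N by rewrite size_map_poly.
have m0 : 0 <= m by apply: (le_trans _ (hP 0 _)) => //; rewrite normr0.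
have [z pz] := primitive_root_pow2 R K; set N := (2 ^ K.+1)%N in pz sK.
have z1 : cabs z = 1.
  have : cabs z ^+ N = 1 by rewrite -cabsX (prim_expr_order pz) cabs1.
  by move/eqP; rewrite pexpr_eq1 ?cabs_ge0 ?(prim_order_gt0 pz) // => /eqP.
have sG : (size (symmetrized d Pc) <= N)%N by exact: leq_trans (size_symmetrized d Pc) sK.
have hG j : cabs (symmetrized d Pc).[z ^+ j] <= m.
  set o := z ^+ j; have o1 : cabs o = 1 by rewrite cabsX z1 expr1n.
  have oo : o * o^*%C = 1 by rewrite mulcJ o1 expr1n.
  have oo' : o^*%C * o = 1 by rewrite mulrC.
  have hX : (complex.Re o)%:C + (complex.Re o)%:C = o + o^*%C.
    by rewrite addcJ mulr_natl mulr2n.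
  (* The Laurent identity is also applied in the algebra [R[i]], with [w = o] on the unit circle and
     [w'] its conjugate: there [|G(o)| = |P(Re o)|]. *)
  have := @horner_alg_symmetrized R R[i]^o o o^*%C oo oo' d Pc (complex.Re o)%:C hX sP.
  have hal (G : {poly R[i]}) (c : R[i]) : horner_alg (c : R[i]^o) G = G.[c].
    rewrite (horner_alg_wide _ (leqnn _)) horner_coef; exact: eq_bigr.
  rewrite !hal horner_real => ->; rewrite cabsM cabsX o1 expr1n mul1r cabs_real; apply: hP.
  by rewrite -lecR -o1 -norm_cabs; exact: normc_ge_Re.
have hWk k : ubound (W ^+ k) 1.
  by elim: k => [|k IHk]; [exact: ubound1|rewrite exprS -[1]mulr1; apply: uboundM => //; apply: ubound_isometry; rewrite sW].
have hW'k k : ubound (W' ^+ k) 1.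
  elim: k => [|k IHk]; first exact: ubound1.
  by rewrite exprS -[1]mulr1; apply: uboundM => //; apply: ubound_isometry; rewrite -sW ustarK sW.
have -> : upoly x P = W' ^+ d * horner_alg W (symmetrized d Pc).
  rewrite (horner_alg_symmetrized WW' W'W hW sP) mulrA.
  by rewrite -exprMn_comm ?W'W ?expr1n ?mul1r // /GRing.comm WW' W'W.
rewrite -[2 ^+ _ * m]mul1r; apply: uboundM => //.
rewrite (horner_alg_wide _ sG).
have -> : 2 ^+ K.+1 * m = \sum_(i < N) m.
  by rewrite sumr_const card_ord -natrX mulr_natl.
apply: ubound_sum => k; apply: (@ubound_le _ _ _ (cabs (symmetrized d Pc)`_k * 1)).
  by rewrite mulr1; exact: coef_bound pz sG hG.
exact: uboundZ.
Qed.

Lemma upoly_ubound1 x (P : {poly R}) (m : R) : cstar x = x -> nrm x < 1 -> 0 < m ->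
  (forall r, `|r| <= 1 -> `|P.[r]| <= m) -> ubound (upoly x P) m.
Proof.
move=> xsa x1 m0 hP.
have key m' : m < m' -> ubound (upoly x P) m'.
  move=> mm'; have m'0 : 0 < m' by apply: lt_trans mm'.
  have q1 : 1 < m' / m by rewrite ltr_pdivlMr // mul1r.
  (* [K] absorbs the size of [P]: twice the size of [P^(2^n)] is less than [2^(n + K + 1)] for every
     [n]. *)
  pose K := (2 * size P + 2)%N.
  have [n hn] := superexp_growth (2 ^+ K.+1) q1.
  apply: (@ubound_sqr_iter _ _ _ _ n); first exact: upoly_star.
    exact: ltW.
  rewrite -rmorphXn /=; apply: (@ubound_le _ _ _ (2 ^+ (n + K).+1 * m ^+ (2 ^ n))).
    move: hn; rewrite expr_div_n ler_pdivlMr ?exprn_gt0 // => hn.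
    by apply: le_trans hn; rewrite -mulrA -addnS exprD mulrA.
  apply: upoly_crude_bound => //.
    apply: (@leq_ltn_trans (2 * ((size P).-1 * 2 ^ n).+1)%N).
      by rewrite leq_mul2l /= size_poly_exp_leq.
    rewrite -addnS expnD.
    have := ltn_expl K (ltnSn 1); have := ltn_expl n (ltnSn 1).
    rewrite (expnS 2 K) /K; move: (2 ^ _)%N (2 ^ n)%N => a b; nia.
  by move=> r /hP h; rewrite horner_exp normrX; rewrite lerXn2r // ?nnegrE // ltW.
move=> b; apply/ler_addgt0Pl => e e0.
have d0 : 0 < e / (nrm b + 1) by rewrite divr_gt0 // ltr_wpDl ?nrm_ge0.
have := key (m + e / (nrm b + 1)); rewrite ltrDl => /(_ d0 b) h; apply: (le_trans h).
rewrite mulrDl addrC lerD2r mulrAC ler_pdivrMr ?ltr_wpDl ?nrm_ge0 //.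
by rewrite ler_wpM2l ?(ltW e0) // lerDl.
Qed.

Lemma upoly_scale (c : R) (x : A) (P : {poly R}) :
  upoly x (P \Po (c *: 'X)) = upoly (c%:C *: x) P.
Proof.
have -> : upoly (c%:C *: x) P = \sum_(i < size P) (P`_i)%:C *: uin (c%:C *: x) ^+ i.
  exact: upoly_wide.
rewrite comp_polyE rmorph_sum; apply: eq_bigr => i _.
rewrite -mul_polyC rmorphM /= upolyC mulr_algl rmorphXn /=.
by rewrite -mul_polyC rmorphM /= upolyC upolyX mulr_algl uinZ.
Qed.

Theorem upoly_ubound (x : A) (c : R) (P : {poly R}) (m : R) : cstar x = x -> nrm x < c ->
  0 < m -> (forall r, `|r| <= c -> `|P.[r]| <= m) -> ubound (upoly x P) m.
Proof.
move=> xsa xc m0 hP; have c0 : 0 < c by apply: le_lt_trans xc; exact: nrm_ge0.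
have -> : x = c%:C *: (c^-1%:C *: x).
  by rewrite scalerA -rmorphM mulfV ?lt0r_neq0 // scale1r.
rewrite -upoly_scale; apply: upoly_ubound1 => //.
- by rewrite cstarZr xsa.
- by rewrite nrmZ cabs_real gtr0_norm ?invr_gt0 // mulrC ltr_pdivrMr // mul1r.
- move=> r r1; rewrite horner_comp; apply: hP.
  by rewrite hornerZ hornerX normrM (gtr0_norm c0) ler_piMr // ltW.
Qed.

End PolynomialBound.

(** * Functional calculus of a self-adjoint element *)

(** The iteration [y + (a^2 - y^2) / 2] converges to [a] from below and is polynomial in [a^2]. The
    error bound [2 / (k + 2)] does not depend on [a], which makes the approximation of the absolute
    value uniform. *)
Lemma abs_iteration (R : realType) (y a k : R) : 0 <= k -> 0 <= y <= a -> a <= 1 ->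
  (a - y) * (k + 2) <= 2 ->
  0 <= y + 2^-1 * (a * a - y * y) <= a /\
  (a - (y + 2^-1 * (a * a - y * y))) * (k + 3) <= 2.
Proof.
move=> k0 /andP[y0 ya] a1 hd; pose d := a - y; have d0 : 0 <= d by rewrite subr_ge0.
have d1 : d <= 1 by rewrite /d; lra.
have e1 : y + 2^-1 * (a * a - y * y) = a - d * (1 - (a + y) / 2) by rewrite /d; field.
have s0 : 0 <= d * (1 - (a + y) / 2) by rewrite mulr_ge0 //; lra.
have sd : d * (1 - (a + y) / 2) <= d * (1 - d / 2) by rewrite ler_wpM2l // /d; lra.
have h3 : d * (1 - d / 2) * (k + 3) <= 2.
  have p1 : 0 <= 2 - d * (k + 2) by rewrite subr_ge0.
  have p2 : 0 <= (2 - d * (k + 2)) * ((2 - d * (k + 2)) + d * (k + 1) ).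
    by rewrite mulr_ge0 // addr_ge0 // mulr_ge0 // addr_ge0.
  rewrite -/d in hd; nra.
split; last by rewrite e1 opprB addrCA subrr addr0; apply: le_trans h3; rewrite ler_wpM2r // addr_ge0.
apply/andP; split; last by rewrite e1 gerBl.
apply: addr_ge0 => //; rewrite mulr_ge0 ?invr_ge0 // subr_ge0.
by rewrite ler_pM.
Qed.

Section PolynomialLimits.
Variables (R : realType) (c : R).
Implicit Types (f g : R -> R) (P Q : {poly R}).

(** The functions needed later arise from the identity by sums, products, absolute values and
    inverses; closure of this class under these operations replaces Weierstrass' theorem. *)
Definition polylim f : Prop := forall e : R, 0 < e ->
  exists P : {poly R}, forall r, `|r| <= c -> `|f r - P.[r]| <= e.

Lemma polylim_cst a : polylim (fun=> a).
Proof. by move=> e e0; exists a%:P => r _; rewrite hornerC subrr normr0 ltW. Qed.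

Lemma polylim_id : polylim id.
Proof. by move=> e e0; exists 'X => r _; rewrite hornerX subrr normr0 ltW. Qed.

Lemma polylim_lim f :
  (forall e : R, 0 < e -> exists2 g, polylim g & forall r, `|r| <= c -> `|f r - g r| <= e) ->
  polylim f.
Proof.
move=> h e e0; have e2 : 0 < e / 2 by rewrite divr_gt0.
have [g hg fg] := h _ e2; have [P hP] := hg _ e2; exists P => r hr.
have -> : f r - P.[r] = (f r - g r) + (g r - P.[r]) by rewrite addrA subrK.
by have := ler_normD (f r - g r) (g r - P.[r]); have := fg r hr; have := hP r hr; lra.
Qed.

Lemma polylim_ext f g : (forall r, `|r| <= c -> f r = g r) -> polylim f -> polylim g.
Proof. by move=> fg hf e /hf[P hP]; exists P => r hr; rewrite -fg // hP. Qed.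

Lemma polylimD f g : polylim f -> polylim g -> polylim (fun r => f r + g r).
Proof.
move=> hf hg e e0; have e2 : 0 < e / 2 by rewrite divr_gt0.
have [P hP] := hf _ e2; have [Q hQ] := hg _ e2; exists (P + Q) => r hr.
have -> : f r + g r - (P + Q).[r] = (f r - P.[r]) + (g r - Q.[r]) by rewrite hornerD; ring.
have := ler_normD (f r - P.[r]) (g r - Q.[r]); have := hP r hr; have := hQ r hr; lra.
Qed.

Lemma poly_bounded P : exists2 m, 0 < m & forall r, `|r| <= c -> `|P.[r]| <= m.
Proof.
elim/poly_ind: P => [|P a [m m0 IHP]].
  by exists 1 => // r _; rewrite horner0 normr0.
exists (m * `|c| + `|a| + 1) => [|r hr].
  by rewrite ltr_wpDl // addr_ge0 // mulr_ge0 // ltW.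
rewrite hornerMXaddC; apply: (le_trans (ler_normD _ _)); rewrite normrM.
have : `|P.[r]| * `|r| <= m * `|c|.
  by rewrite ler_pM ?IHP // (le_trans hr) // ler_norm.
by lra.
Qed.

Lemma polylim_bounded f : polylim f -> exists2 m, 0 < m & forall r, `|r| <= c -> `|f r| <= m.
Proof.
move=> hf; have [P hP] := hf _ ltr01; have [m m0 hm] := poly_bounded P.
exists (m + 1) => [|r hr]; first by rewrite ltr_wpDl // ltW.
have -> : f r = (f r - P.[r]) + P.[r] by rewrite subrK.
by have := ler_normD (f r - P.[r]) P.[r]; have := hP r hr; have := hm r hr; lra.
Qed.

Lemma polylimM f g : polylim f -> polylim g -> polylim (fun r => f r * g r).
Proof.
move=> hf hg e e0; have [a a0 ha] := polylim_bounded hf.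
have ea : 0 < e / (2 * a) by rewrite divr_gt0 // mulr_gt0.
have [Q hQ] := hg _ ea; have [b b0 hb] := poly_bounded Q.
have eb : 0 < e / (2 * b) by rewrite divr_gt0 // mulr_gt0.
have [P hP] := hf _ eb; exists (P * Q) => r hr.
have -> : f r * g r - (P * Q).[r] = f r * (g r - Q.[r]) + (f r - P.[r]) * Q.[r].
  by rewrite hornerM; ring.
apply: (le_trans (ler_normD _ _)); rewrite !normrM.
have : `|f r| * `|g r - Q.[r]| <= a * (e / (2 * a)) by rewrite ler_pM ?ha ?hQ.
have : `|f r - P.[r]| * `|Q.[r]| <= e / (2 * b) * b by rewrite ler_pM ?hb ?hP.
have -> : a * (e / (2 * a)) = e / 2 by field; rewrite lt0r_neq0.
have -> : e / (2 * b) * b = e / 2 by field; rewrite lt0r_neq0.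
by lra.
Qed.

Lemma polylimZ a f : polylim f -> polylim (fun r => a * f r).
Proof. by move=> hf; apply: polylimM => //; exact: polylim_cst. Qed.

Lemma polylimB f g : polylim f -> polylim g -> polylim (fun r => f r - g r).
Proof.
move=> hf hg; apply: (@polylim_ext (fun r => f r + (-1) * g r)).
  by move=> r _; rewrite mulN1r.
by apply: polylimD => //; exact: polylimZ.
Qed.

Lemma polylim_abs1 f : polylim f -> (forall r, `|r| <= c -> `|f r| <= 1) ->
  polylim (fun r => `|f r|).
Proof.
move=> hf f1.
pose p := fix p n : R -> R :=
  if n is n'.+1 then fun r => p n' r + 2^-1 * (f r * f r - p n' r * p n' r) else fun=> 0.
have hp n : polylim (p n).
  elim: n => [|n IHn]; first exact: polylim_cst.
  by apply: polylimD => //; apply: polylimZ; apply: polylimB; apply: polylimM.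
have pf n r : `|r| <= c -> 0 <= p n r <= `|f r| /\ (`|f r| - p n r) * n.+2%:R <= 2.
  move=> /f1; have := normr_ge0 (f r).
  have hff : f r * f r = `|f r| * `|f r| by rewrite -normrM ger0_norm // -expr2 sqr_ge0.
  elim: n => [|n IHn] a0 a1; first by rewrite /= lexx a0; split => //; lra.
  have [/andP[p0 pa] hd] := IHn a0 a1.
  rewrite [p n.+1 r]/= hff; have k0 : 0 <= n%:R :> R by [].
  have := @abs_iteration _ (p n r) `|f r| n%:R k0; rewrite p0 pa -(natrD _ n 2) addn2.
  by move=> /(_ isT a1 hd); rewrite -(natrD _ n 3) addn3.
apply: polylim_lim => e e0.
have [n hn] : exists n : nat, 2 / e <= n%:R.
  by exists (Num.truncn (2 / e)).+1; exact: ltW (Num.Theory.truncnS_gt _).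
exists (p n) => // r hr; have [/andP[p0 pa] hd] := pf n r hr.
rewrite ger0_norm ?subr_ge0 //; move: hn; rewrite ler_pdivrMr // => hn.
have n0 : 0 < n.+2%:R :> R by [].
rewrite -(ler_pM2r n0); apply: (le_trans hd); apply: (le_trans hn).
by rewrite mulrC ler_wpM2l ?(ltW e0) // ler_nat; lia.
Qed.

Lemma polylim_abs f : polylim f -> polylim (fun r => `|f r|).
Proof.
move=> hf; have [m m0 hm] := polylim_bounded hf.
apply: (@polylim_ext (fun r => m * `|m^-1 * f r|)).
  by move=> r _; rewrite normrM gtr0_norm ?invr_gt0 // mulrA mulfV ?mul1r ?lt0r_neq0.
apply: polylimZ; apply: polylim_abs1; first exact: polylimZ.
by move=> r /hm h; rewrite normrM gtr0_norm ?invr_gt0 // mulrC ler_pdivrMr // mul1r.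
Qed.

(** Geometric series in [q = 1 - f / b], where [b] bounds [f]: on the interval
    [0 <= q <= 1 - a / b < 1]. *)
Lemma polylim_inv f (a : R) : 0 < a -> polylim f -> (forall r, `|r| <= c -> a <= f r) ->
  polylim (fun r => (f r)^-1).
Proof.
move=> a0 hf fa; have [b b0 hb] := polylim_bounded hf.
have [c0|c0] := leP 0 c; last first.
  by move=> e e0; exists 0 => r hr; move: (normr_ge0 r) => ?; exfalso; lra.
have ab : a <= b.
  have h0 : `|0 : R| <= c by rewrite normr0.
  by apply: (le_trans (fa 0 h0)); apply: le_trans (hb 0 h0); exact: ler_norm.
pose q r := 1 - b^-1 * f r.
have hq : polylim q by apply: polylimB; [exact: polylim_cst|exact: polylimZ].
have q01 r : `|r| <= c -> 0 <= q r <= 1 - a / b.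
  move=> hr; have := fa r hr; have := hb r hr.
  rewrite ger0_norm; last by apply: le_trans (fa r hr); exact: ltW.
  move=> h1 h2; rewrite /q subr_ge0 lerD2l lerN2 mulrC ler_pdivrMr // mul1r h1.
  by rewrite ler_pM2r // invr_gt0.
have hS N : polylim (fun r => \sum_(i < N) q r ^+ i).
  elim: N => [|N IHN].
    by apply: polylim_ext (polylim_cst 0) => r _; rewrite big_ord0.
  apply: (@polylim_ext (fun r => \sum_(i < N) q r ^+ i + q r ^+ N)).
    by move=> r _; rewrite big_ord_recr.
  apply: polylimD => //; elim: N {IHN} => [|N IHN]; first exact: polylim_cst.
  by apply: polylim_ext (polylimM hq IHN) => r _; rewrite exprS.
apply: polylim_lim => e e0.
have t1 : `|1 - a / b| < 1.
  rewrite ger0_norm; first by rewrite ltrBlDr ltrDl divr_gt0.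
  by rewrite subr_ge0 ler_pdivrMr // mul1r.
have /cvgrPdist_lt/(_ _ (mulr_gt0 e0 a0))[N _ /(_ N (leqnn N))] := cvg_expr t1.
rewrite /= sub0r normrN normrX (ger0_norm (_ : 0 <= 1 - a / b)); last first.
  by rewrite subr_ge0 ler_pdivrMr // mul1r.
move=> hN; exists (fun r => b^-1 * \sum_(i < N) q r ^+ i); first exact: polylimZ.
move=> r hr; have /andP[q0 q1] := q01 r hr; have fr := fa r hr.
have f0 : 0 < f r by apply: lt_le_trans fr.
have : 1 - q r ^+ N = b^-1 * f r * \sum_(i < N) q r ^+ i.
  have := subrX1 (q r) N; have -> : q r - 1 = - (b^-1 * f r) by rewrite /q; ring.
  by move=> h; rewrite -[LHS]opprB h mulNr opprK.
move=> h; have -> : (f r)^-1 - b^-1 * \sum_(i < N) q r ^+ i = q r ^+ N / f r.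
  apply: (mulIf (lt0r_neq0 f0)); rewrite mulrBl mulVf ?lt0r_neq0 // mulfVK ?lt0r_neq0 //.
  have -> : b^-1 * (\sum_(i < N) q r ^+ i) * f r = 1 - q r ^+ N by rewrite h; ring.
  by ring.
rewrite ger0_norm ?divr_ge0 ?exprn_ge0 // ?(ltW f0) // ler_pdivrMr //.
have : q r ^+ N <= (1 - a / b) ^+ N by rewrite lerXn2r // nnegrE // (le_trans q0).
by nra.
Qed.

Lemma polylim_invmax (e : R) : 0 < e -> polylim (fun r => (Num.max `|r| e)^-1).
Proof.
move=> e0; apply: (@polylim_inv _ e) => //; last by move=> r _; rewrite le_max lexx orbT.
apply: (@polylim_ext (fun r => 2^-1 * ((`|r| + e) + `| `|r| - e|))).
  by move=> r _; rewrite maxr_absE; ring.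
apply: polylimZ; apply: polylimD; first apply: polylimD; try exact: polylim_cst.
  exact: polylim_abs polylim_id.
by apply: polylim_abs; apply: polylimB; [exact: polylim_abs polylim_id|exact: polylim_cst].
Qed.

End PolynomialLimits.

Section FunctionalCalculus.
Variables (R : realType) (A : cstarAlgType R) (x : A) (c : R).
Hypotheses (xsa : cstar x = x) (xc : nrm x < c).
Implicit Types (f g : R -> R) (y z : A) (P Q : {poly R}).

(** [y] is [f(x)]: one polynomial has to be close to [f] on [[-c, c]] and to [y] in the unitization.
    A relation is used because [f(x)] may fail to lie in [A] when [f 0 <> 0]. *)
Definition fcrel f y : Prop := forall e : R, 0 < e -> exists P : {poly R},
  (forall r, `|r| <= c -> `|f r - P.[r]| <= e) /\ ubound (uin y - upoly x P) e.

Lemma upoly_ubound_ge0 P (m : R) : 0 <= m ->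
  (forall r, `|r| <= c -> `|P.[r]| <= m) -> ubound (upoly x P) m.
Proof.
move=> m0 hP b; apply/ler_addgt0Pl => e e0.
have b0 : 0 < nrm b + 1 by rewrite ltr_wpDl ?nrm_ge0.
have d0 : 0 < e / (nrm b + 1) by rewrite divr_gt0.
have m1 : 0 < m + e / (nrm b + 1) by rewrite ltr_wpDl.
have hP' r : `|r| <= c -> `|P.[r]| <= m + e / (nrm b + 1).
  by move=> /hP h; apply: (le_trans h); rewrite lerDl ltW.
apply: (le_trans (upoly_ubound xsa xc m1 hP' b)).
rewrite mulrDl addrC lerD2r mulrAC ler_pdivrMr // ler_wpM2l ?(ltW e0) // lerDl.
exact: ler01.
Qed.

Lemma fc_norm f y (m : R) : 0 <= m -> (forall r, `|r| <= c -> `|f r| <= m) ->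
  fcrel f y -> nrm y <= m.
Proof.
move=> m0 fm h; apply/ler_addgt0Pl => e e0.
have e2 : 0 < e / 2 by rewrite divr_gt0.
have [P [hP yP]] := h _ e2.
apply: ubound_uin; first by rewrite addr_ge0 // ltW.
rewrite -[uin y](subrK (upoly x P)).
apply: (@ubound_le _ _ _ (e / 2 + (m + e / 2))); first by lra.
apply: uboundD => //; apply: upoly_ubound_ge0; first by rewrite addr_ge0 // ltW.
move=> r hr; have -> : P.[r] = f r - (f r - P.[r]) by ring.
by have := ler_normB (f r) (f r - P.[r]); have := hP r hr; have := fm r hr; lra.
Qed.

Lemma fc_add f g y z : fcrel f y -> fcrel g z -> fcrel (fun r => f r + g r) (y + z).
Proof.
move=> hf hg e e0; have e2 : 0 < e / 2 by rewrite divr_gt0.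
have [P [hP yP]] := hf _ e2; have [Q [hQ zQ]] := hg _ e2.
exists (P + Q); split=> [r hr|].
  have -> : f r + g r - (P + Q).[r] = (f r - P.[r]) + (g r - Q.[r]) by rewrite hornerD; ring.
  have := ler_normD (f r - P.[r]) (g r - Q.[r]); have := hP r hr; have := hQ r hr; lra.
have -> : uin (y + z) - upoly x (P + Q) = (uin y - upoly x P) + (uin z - upoly x Q).
  by rewrite uinD rmorphD /=; abel.
apply: (@ubound_le _ _ _ (e / 2 + e / 2)); first by lra.
exact: uboundD.
Qed.

Lemma fc_bounded f y : fcrel f y -> polylim c f.
Proof. by move=> h e /h[P [hP _]]; exists P. Qed.

Lemma fc_mul f g y z : fcrel f y -> fcrel g z -> fcrel (fun r => f r * g r) (y ** z).
Proof.
move=> hf hg e e0; have [a a0 ha] := polylim_bounded (fc_bounded hf).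
have ea : 0 < e / (2 * a) by rewrite divr_gt0 // mulr_gt0.
have [Q [hQ zQ]] := hg _ ea; have [b b0 hb] := poly_bounded c Q.
have eb : 0 < e / (2 * b) by rewrite divr_gt0 // mulr_gt0.
have [P [hP yP]] := hf _ eb.
have ea2 : a * (e / (2 * a)) = e / 2 by field; rewrite lt0r_neq0.
have eb2 : e / (2 * b) * b = e / 2 by field; rewrite lt0r_neq0.
exists (P * Q); split=> [r hr|].
  have -> : f r * g r - (P * Q).[r] = f r * (g r - Q.[r]) + (f r - P.[r]) * Q.[r].
    by rewrite hornerM; ring.
  apply: (le_trans (ler_normD _ _)); rewrite !normrM.
  have : `|f r| * `|g r - Q.[r]| <= a * (e / (2 * a)) by rewrite ler_pM ?ha ?hQ.
  have : `|f r - P.[r]| * `|Q.[r]| <= e / (2 * b) * b by rewrite ler_pM ?hb ?hP.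
  by lra.
have -> : uin (y ** z) - upoly x (P * Q) =
    uin y * (uin z - upoly x Q) + (uin y - upoly x P) * upoly x Q.
  by rewrite uinM rmorphM /= mulrBr mulrBl addrA subrK.
apply: (@ubound_le _ _ _ (a * (e / (2 * a)) + e / (2 * b) * b)); first by lra.
apply: uboundD.
  apply: uboundM => //; first exact: ltW.
  by apply: ubound_le (ubound_uin_nrm y); apply: fc_norm hf => //; exact: ltW.
apply: uboundM => //; first exact: ltW.
by apply: upoly_ubound_ge0 => //; exact: ltW.
Qed.

Lemma fc_poly (y : A) P : uin y = upoly x P -> fcrel (fun r => P.[r]) y.
Proof.
move=> h e e0; exists P; split=> [r _|]; first by rewrite subrr normr0 ltW.
by rewrite h subrr; apply: ubound_le (@ubound0 _ _); exact: ltW.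
Qed.

Lemma fc_ext f g y : (forall r, `|r| <= c -> f r = g r) -> fcrel f y -> fcrel g y.
Proof.
move=> fg h e /h[P [hP yP]]; exists P; split=> // r hr.
by rewrite -fg // hP.
Qed.

Lemma fc_id : fcrel id x.
Proof.
by apply: fc_ext (fc_poly (esym (upolyX x))) => r _; rewrite hornerX.
Qed.

Lemma fc_scale a f y : fcrel f y -> fcrel (fun r => a * f r) (a%:C *: y).
Proof.
move=> hf e e0; have a0 : 0 < `|a| + 1 by rewrite ltr_wpDl.
have ea : 0 < e / (`|a| + 1) by rewrite divr_gt0.
have ae : `|a| * (e / (`|a| + 1)) <= e.
  by rewrite mulrA ler_pdivrMr // mulrC ler_wpM2l ?(ltW e0) // lerDl.
have [P [hP yP]] := hf _ ea; exists (a%:P * P); split=> [r hr|].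
  rewrite hornerM hornerC -mulrBr normrM; apply: le_trans ae.
  by rewrite ler_wpM2l // hP.
rewrite uinZ rmorphM /= upolyC mulr_algl -scalerBr.
by apply: ubound_le ae _; have := uboundZ a%:C yP; rewrite cabs_real.
Qed.

Lemma fc_sub f g y z : fcrel f y -> fcrel g z -> fcrel (fun r => f r - g r) (y - z).
Proof.
move=> hf hg; have := fc_add hf (fc_scale (-1) hg).
rewrite rmorphN1 scaleN1r; apply: fc_ext => r _; by rewrite mulN1r.
Qed.

Lemma fc_eq f g y z : (forall r, `|r| <= c -> f r = g r) -> fcrel f y -> fcrel g z -> y = z.
Proof.
move=> fg hf hg; apply/eqP; rewrite -subr_eq0; apply/eqP/nrm_eq0/eqP.
rewrite eq_le nrm_ge0 andbT; apply: fc_norm (fc_sub hf hg) => // r /fg ->.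
by rewrite subrr normr0.
Qed.

Lemma fc_comm f g y z : fcrel f y -> fcrel g z -> y ** z = z ** y.
Proof.
move=> hf hg; apply: fc_eq (fc_mul hf hg) (fc_mul hg hf) => r _; exact: mulrC.
Qed.

Lemma fc_approx f y (e : R) : 0 < e -> f 0 = 0 -> fcrel f y -> exists Q,
  (forall r, `|r| <= c -> `|f r - ('X * Q).[r]| <= e) /\ nrm (y - (uin x * upoly x Q).2) <= e.
Proof.
move=> e0 f0 hf; have e2 : 0 < e / 2 by rewrite divr_gt0.
have c0 : 0 <= c by apply: le_trans (ltW xc); exact: nrm_ge0.
have [P [hP yP]] := hf _ e2.
have P0 : `|P.[0]| <= e / 2.
  by have := hP 0; rewrite normr0 f0 sub0r normrN; exact.
have [Q PQ] : exists Q, P = 'X * Q + (P.[0])%:P.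
  elim/poly_ind: (P) => [|Q a _]; first by exists 0; rewrite horner0 mulr0 addr0.
  by exists Q; rewrite hornerMXaddC mulr0 add0r -commr_polyX.
exists Q; have XQ : 'X * Q = P - (P.[0])%:P by rewrite {1}PQ addrK.
split=> [r hr|].
  rewrite XQ hornerD hornerN hornerC opprD opprK addrA.
  by have := ler_normD (f r - P.[r]) P.[0]; have := hP r hr; lra.
apply: ubound_uin; first exact: ltW.
have -> : uin (y - (uin x * upoly x Q).2) = (uin y - upoly x P) + (P.[0])%:C *: 1.
  have -> : upoly x P = uin x * upoly x Q + (P.[0])%:C *: 1.
    by rewrite {1}PQ rmorphD rmorphM /= upolyX upolyC.
  rewrite uinB opprD addrA subrK; congr (_ - _).
  by congr pair; rewrite /= mul0r.
apply: (@ubound_le _ _ _ (e / 2 + `|P.[0]| * 1)); first by lra.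
by apply: uboundD => //; rewrite -cabs_real; apply: uboundZ; exact: ubound1.
Qed.

Lemma fc_mem f y (S : set A) : f 0 = 0 -> fcrel f y -> Defs.subspace S -> closed S -> S x ->
  (forall z, S z -> S (x ** z)) -> S y.
Proof.
move=> f0 hf [S0 SD] cS Sx SM; move/closed_nrmP: cS; apply => e e0.
have e2 : 0 < e / 2 by rewrite divr_gt0.
have [Q [_ hQ]] := fc_approx e2 f0 hf; exists (uin x * upoly x Q).2; last by lra.
elim/poly_ind: (Q) => [|P a IHP].
  by rewrite rmorph0 mulr0 /=; exact: S0.
have -> : upoly x (P * 'X + a%:P) = upoly x P * uin x + a%:C *: 1.
  by rewrite rmorphD rmorphM /= upolyX upolyC.
rewrite mulrDr.
have -> : upoly x P * uin x = uin x * upoly x P.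
  by rewrite -upolyX -!rmorphM mulrC.
rewrite -scalerAr mulr1 addrC /=; apply: SD => //.
move: IHP; rewrite /= mul0r !scale0r !add0r; exact: SM.
Qed.

Lemma fc_star f y : f 0 = 0 -> fcrel f y -> cstar y = y.
Proof.
move=> f0 hf; apply/eqP; rewrite -subr_eq0; apply/eqP/nrm_small => e e0.
have e2 : 0 < e / 2 by rewrite divr_gt0.
have [Q [_ hQ]] := fc_approx e2 f0 hf.
set z := (uin x * upoly x Q).2 in hQ.
have zsa : cstar z = z.
  have := upoly_star ('X * Q) xsa; rewrite rmorphM /= upolyX => h.
  by rewrite {2}/z -h.
have -> : cstar y - y = cstar (y - z) - (y - z) by rewrite cstarB zsa; abel.
by have := nrmB (cstar (y - z)) (y - z); rewrite nrm_star; lra.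
Qed.

Lemma fc_exists f : f 0 = 0 -> polylim c f -> exists y, fcrel f y.
Proof.
move=> f0 hf.
pose ok n P := P.[0] = 0 /\ forall r, `|r| <= c -> `|f r - P.[r]| <= 2^-1 ^+ n.
have c0 : 0 <= c by apply: le_trans (ltW xc); exact: nrm_ge0.
have hok n : exists P, ok n P.
  (* Half of the tolerance pays for removing the constant term, so that [upoly x (p n)] has no
     scalar part. *)
  have e0 : 0 < (2^-1 : R) ^+ n / 2 by rewrite divr_gt0 // exprn_gt0 // invr_gt0.
  have [P hP] := hf _ e0; exists (P - (P.[0])%:P); split.
    by rewrite hornerD hornerN hornerC subrr.
  move=> r hr; rewrite hornerD hornerN hornerC opprD opprK addrA.
  have := ler_normD (f r - P.[r]) P.[0]; have := hP r hr.
  by have := hP 0; rewrite normr0 f0 sub0r normrN => /(_ c0); lra.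
have [p hp] := choice hok.
have p1 n : (upoly x (p n)).1 = 0.
  have [p0 _] := hp n.
  have : (upoly x (p n)).1 = (p n).[0]%:C.
    elim/poly_ind: (p n) => [|Q a _]; first by rewrite rmorph0 horner0.
    rewrite rmorphD rmorphM /= upolyX upolyC hornerMXaddC mulr0 add0r /=.
    by rewrite mulr0 add0r mulr1.
  by rewrite p0.
pose u n := (upoly x (p n)).2.
have uE n : uin (u n) = upoly x (p n) by rewrite /uin -(p1 n) -surjective_pairing.
have huP m n : ubound (uin (u m) - upoly x (p n)) (2^-1 ^+ m + 2^-1 ^+ n).
  rewrite uE -rmorphB; apply: upoly_ubound_ge0.
    by rewrite addr_ge0 // exprn_ge0 // invr_ge0.
  move=> r hr; have [_ /(_ r hr) hm] := hp m; have [_ /(_ r hr) hn] := hp n.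
  rewrite hornerD hornerN.
  have -> : (p m).[r] - (p n).[r] = (f r - (p n).[r]) - (f r - (p m).[r]) by ring.
  by apply: (le_trans (ler_normB _ _)); lra.
have h0 : 0 <= (2^-1 : R) by rewrite invr_ge0.
have h1 : (2^-1 : R) < 1 by lra.
have hu n : nrm (u n.+1 - u n) <= 2 * 2^-1 ^+ n.
  apply: ubound_uin; first by rewrite mulr_ge0 // exprn_ge0.
  rewrite uinB (uE n); apply: ubound_le (huP _ _).
  by rewrite exprS; have := exprn_ge0 n h0; lra.
have [y uy] := geometric_ncvg (ler0n _ 2) h0 h1 hu.
exists y => e e0.
have e4 : 0 < e / 4 by rewrite divr_gt0.
have [N hN] := uy _ e4.
have ha : `|2^-1 : R| < 1 by rewrite ger0_norm.
have /cvgrPdist_lt/(_ _ e4)[M _ hM] := cvg_expr ha.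
have := hM _ (leq_maxr N M); rewrite /= sub0r normrN ger0_norm ?exprn_ge0 //.
set n := maxn N M => hn; exists (p n); split.
  by move=> r hr; have [_ /(_ r hr)] := hp n; lra.
rewrite -uE -uinB; apply: ubound_le (ubound_uin_nrm _).
by have := hN _ (leq_maxl N M); rewrite -/n; lra.
Qed.

End FunctionalCalculus.

(** * Soft thresholds and local units *)

Section CutoffFunctions.
Variables (R : realType) (e : R).
Hypothesis e0 : 0 < e.

(** [r invmax(r)] is [r / e] clipped to [[-1, 1]], so that [r - e r invmax(r)] is soft thresholding
    at [e]: zero for [|r| <= e], and shifted by [e] towards zero elsewhere. *)
Definition invmax (r : R) : R := (Num.max `|r| e)^-1.

Lemma invmaxP r :
  (e <= `|r| /\ `|r| * invmax r = 1) \/ (`|r| < e /\ e * invmax r = 1).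
Proof.
rewrite /invmax; case: (leP e `|r|) => h; [left|right]; split => //.
  by rewrite mulfV // lt0r_neq0 // (lt_le_trans e0).
by rewrite mulfV // lt0r_neq0.
Qed.

Lemma invmax_gt0 r : 0 < invmax r.
Proof. by rewrite invr_gt0 lt_max e0 orbT. Qed.

Lemma invmax_le r : e * invmax r <= 1.
Proof. by rewrite ler_pdivrMr ?lt_max ?e0 ?orbT // mul1r le_max lexx orbT. Qed.

Lemma invmax_norm r : `|r| * invmax r <= 1.
Proof. by rewrite ler_pdivrMr ?lt_max ?e0 ?orbT // mul1r le_max lexx. Qed.

Lemma sqr_norm (r : R) : r * r = `|r| * `|r|.
Proof. by rewrite -normrM ger0_norm // -expr2 sqr_ge0. Qed.

Lemma clamp_le r : `|e * (r * invmax r)| <= e.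
Proof.
rewrite !normrM (gtr0_norm e0) (gtr0_norm (invmax_gt0 r)).
by rewrite ler_piMr ?(ltW e0) // invmax_norm.
Qed.

End CutoffFunctions.

Section Cutoffs.
Variables (R : realType) (A : cstarAlgType R).
Implicit Types (x y z t : A) (S I : set A).

Definition sa x : Prop := cstar x = x.

Definition stable_under x S : Prop :=
  [/\ Defs.subspace S, closed S, S x & forall z, S z -> S (x ** z)].

Lemma fc_memS x (c : R) f y S : sa x -> nrm x < c -> f 0 = 0 -> fcrel x c f y ->
  stable_under x S -> S y.
Proof. by move=> xsa xc f0 hf [h1 h2 h3 h4]; exact: (fc_mem xc f0 hf h1 h2 h3 h4). Qed.

Lemma fc_rn x (c e : R) : sa x -> nrm x < c -> 0 < e ->
  exists y, fcrel x c (fun r => r * invmax e r) y.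
Proof.
move=> xsa xc e0; apply: fc_exists => //; first by rewrite mul0r.
by apply: polylimM; [exact: polylim_id|exact: polylim_invmax].
Qed.

(** [y] is [x] soft-thresholded at [e], and [k] is the square of the clipped function, which equals
    one wherever [y] lives. Both are limits of multiples of [x], whence the last clause. *)
Lemma cutdown x (e : R) : sa x -> 0 < e -> exists y k,
  [/\ sa y, sa k, k ** y = y /\ y ** k = y, nrm (x - y) <= e &
      forall S, stable_under x S -> S y /\ S k].
Proof.
move=> xsa e0; have xc : nrm x < nrm x + 1 by rewrite ltrDl.
set c := nrm x + 1 in xc.
have [y hy] := fc_rn xsa xc e0.
have hz := fc_scale (A := A) e hy.
have hs := fc_sub (fc_id x c) hz; have hk := fc_mul xsa xc hy hy.
have s0 : (0 : R) - e * (0 * invmax e 0) = 0 by rewrite mul0r mulr0 subr0.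
have k0 : 0 * invmax e 0 * (0 * invmax e 0) = 0 by rewrite mul0r mulr0.
have ks : y ** y ** (x - e%:C *: y) = x - e%:C *: y.
  apply: (fc_eq xsa xc _ (fc_mul xsa xc hk hs) hs) => r _.
  have -> : r * invmax e r * (r * invmax e r) =
     `|r| * invmax e r * (`|r| * invmax e r) by rewrite mulrACA sqr_norm; ring.
  case: (invmaxP e0 r) => -[_ E]; first by rewrite E !mul1r.
  by rewrite [e * _]mulrCA E mulr1 subrr mulr0.
exists (x - e%:C *: y), (y ** y); split.
- exact: (@fc_star _ _ _ _ xsa xc _ _ s0 hs).
- exact: (@fc_star _ _ _ _ xsa xc _ _ k0 hk).
- by split=> //; rewrite (fc_comm xsa xc hs hk).
- rewrite opprB addrCA subrr addr0; apply: (fc_norm xsa xc (ltW e0) _ hz) => r _; exact: clamp_le.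
- by move=> S hS; split; [exact: fc_memS xsa xc s0 hs hS|exact: fc_memS xsa xc k0 hk hS].
Qed.

(** [s] is [t t^*] soft-thresholded at [M^2]. Where [s] lives, [h] inverts [t t^*], so [a s] is
    [a s t] times [t^* h], and [t^* h] has norm at most [1 / M]. If [s = 0], then [t t^*] equals its
    own clipping at [M^2]. *)
Lemma softcut t (M : R) : 0 < M -> exists s l, [/\ sa s, s = t ** cstar t ** l,
  forall a, M * nrm (a ** s) <= nrm (a ** s ** t) & (s = 0 -> nrm t <= M)].
Proof.
move=> M0; set x := t ** cstar t; have xsa : sa x by rewrite /sa cstarM cstarK.
have xc : nrm x < nrm x + 1 by rewrite ltrDl.
set c := nrm x + 1 in xc; pose e := M ^+ 2; have e0 : 0 < e by rewrite exprn_gt0.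
have [y hy] := fc_rn xsa xc e0.
have hz := fc_scale (A := A) e hy; have hs := fc_sub (fc_id x c) hz.
have [l hl] : exists l, fcrel x c (fun r => 1 - e * invmax e r) l.
  apply: fc_exists => //.
    case: (invmaxP e0 0) => -[h E]; last by rewrite E subrr.
    by rewrite normr0 leNgt e0 in h.
  by apply: polylimB; [exact: polylim_cst|apply: polylimZ; exact: polylim_invmax].
have [h hh] : exists h, fcrel x c (fun r => r * invmax e r * invmax e r) h.
  apply: fc_exists => //; first by rewrite !mul0r.
  by apply: polylimM; [apply: polylimM; [exact: polylim_id|]|]; exact: polylim_invmax.
have s0 : (0 : R) - e * (0 * invmax e 0) = 0 by rewrite mul0r mulr0 subr0.
have h0 : (0 : R) * invmax e 0 * invmax e 0 = 0 by rewrite !mul0r.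
have hsa := fc_star xsa xc h0 hh.
set s := x - e%:C *: y in hs *.
exists s, l; split.
- exact: (@fc_star _ _ _ _ xsa xc _ _ s0 hs).
- apply: (fc_eq xsa xc _ hs (fc_mul xsa xc (fc_id x c) hl)) => r _ /=; ring.
- move=> a; have sxh : s ** x ** h = s.
    apply: (fc_eq xsa xc _ (fc_mul xsa xc (fc_mul xsa xc hs (fc_id x c)) hh) hs) => r _ /=.
    case: (invmaxP e0 r) => -[_ E].
      have -> : (r - e * (r * invmax e r)) * r * (r * invmax e r * invmax e r) =
        (r - e * (r * invmax e r)) * ((r * r) * invmax e r * invmax e r) by ring.
      by rewrite sqr_norm mulrAC -[_ * invmax e r * _]mulrA mulrACA E !mulr1.
    have -> : r - e * (r * invmax e r) = 0 by rewrite mulrCA E mulr1 subrr.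
    by rewrite !mul0r.
  have th : nrm (cstar t ** h) <= M^-1.
    apply: nrm_le_sqr; first by rewrite invr_ge0 ltW.
    have -> : cstar (cstar t ** h) ** (cstar t ** h) = h ** x ** h.
      by rewrite cstarM cstarK hsa /x !cmulA.
    apply: (fc_norm xsa xc _ _ (fc_mul xsa xc (fc_mul xsa xc hh (fc_id x c)) hh)).
      by rewrite exprn_ge0 // invr_ge0 ltW.
    move=> r _ /=; rewrite !normrM (gtr0_norm (invmax_gt0 e0 r)).
    have n0 := invmax_gt0 e0 r; have n1 := invmax_le e0 r; have n2 := invmax_norm e0 r.
    have -> : M^-1 ^+ 2 = e^-1 by rewrite exprVn.
    set n := invmax e r in n0 n1 n2 *.
    have -> : `|r| * n * n * `|r| * (`|r| * n * n) = (`|r| * n) ^+ 3 * n by ring.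
    have n3 : n <= e^-1 by rewrite -[e^-1]mul1r ler_pdivlMr // mulrC.
    have p0 : 0 <= `|r| * n by rewrite mulr_ge0 // ltW.
    by apply: le_trans n3; rewrite ler_piMl ?(ltW n0) // exprn_ile1.
  have E : a ** s = (a ** s ** t) ** (cstar t ** h).
    by rewrite -{1}sxh /x !cmulA.
  rewrite {1}E.
  apply: (@le_trans _ _ (M * (nrm (a ** s ** t) * M^-1))).
    rewrite ler_wpM2l ?(ltW M0) //; apply: (le_trans (nrmM _ _)).
    by rewrite ler_wpM2l ?nrm_ge0.
  by rewrite mulrCA mulfV ?mulr1 ?lt0r_neq0.
- move=> s00; have -> : nrm t <= M = (nrm x <= e).
    by rewrite nrm_Mstar ler_pXn2r // nnegrE ?nrm_ge0 // ltW.
  have -> : x = e%:C *: y by apply/eqP; rewrite -subr_eq0 -/s s00.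
  apply: (fc_norm xsa xc (ltW e0) _ hz) => r _; exact: clamp_le.
Qed.

(** The square [k] of the clipped function of [X] lies in [I] and is nearly a left unit for [x]:
    [|x - k x|^2] is the norm of [(1 - k) X (1 - k)], at most [e] because [1 - k] vanishes where
    [|r| >= e]. *)
Lemma ideal_mem_Mstar I x : closed_two_sided_ideal I -> I (x ** cstar x) -> I x.
Proof.
move=> [[Isub Imul] cI] IX; set X := x ** cstar x in IX.
have xsa : sa X by rewrite /sa cstarM cstarK.
have xc : nrm X < nrm X + 1 by rewrite ltrDl.
set c := nrm X + 1 in xc.
move/closed_nrmP: (cI); apply => d d0.
pose e := (d / 2) ^+ 2; have d2 : 0 < d / 2 by rewrite divr_gt0.
have e0 : 0 < e by rewrite exprn_gt0.
have [y hy] := fc_rn xsa xc e0; have hk := fc_mul xsa xc hy hy.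
have y0 : (0 : R) * invmax e 0 = 0 by rewrite mul0r.
have k0 : 0 * invmax e 0 * (0 * invmax e 0) = 0 by rewrite mul0r mulr0.
have ksa := fc_star xsa xc k0 hk.
have Iy : I y.
  by apply: (fc_memS xsa xc y0 hy); split => // z /(Imul X)[].
exists (y ** y ** x); first by have [] := Imul x (y ** y); have [] := Imul y y Iy.
apply: (@le_lt_trans _ _ (d / 2)); last by lra.
rewrite -nrm_star; apply: nrm_le_sqr; first exact: ltW.
have hX := fc_id X c.
have -> : cstar (cstar (x - y ** y ** x)) ** cstar (x - y ** y ** x) =
    (X - (y ** y) ** X) - (X - (y ** y) ** X) ** (y ** y).
  rewrite cstarK cstarB [cstar (_ ** x)]cstarM ksa !cmulxB !cmulBx /X !cmulA.
  by abel.
have h1 := fc_sub hX (fc_mul xsa xc hk hX).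
apply: (fc_norm xsa xc (ltW e0) _ (fc_sub h1 (fc_mul xsa xc h1 hk))) => r _ /=.
have -> : r * invmax e r * (r * invmax e r) =
     `|r| * invmax e r * (`|r| * invmax e r) by rewrite mulrACA sqr_norm; ring.
have n1 := invmax_norm e0 r; have n0 := invmax_gt0 e0 r.
have [[_ E]|[re E]] := invmaxP e0 r.
  by rewrite E !mul1r subrr mul0r subr0 normr0 ltW.
set k := `|r| * invmax e r in n1 *.
have k00 : 0 <= k by rewrite mulr_ge0 // ltW.
have -> : r - k * k * r - (r - k * k * r) * (k * k) = r * ((1 - k * k) * (1 - k * k)) by ring.
have kk : 0 <= k * k <= 1 by rewrite mulr_ge0 //= mulr_ile1.
case/andP: kk => kk0 kk1; have g0 : 0 <= (1 - k * k) * (1 - k * k) by rewrite mulr_ge0 // subr_ge0.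
rewrite normrM (ger0_norm g0); apply: le_trans (ltW re).
by rewrite ler_piMr // mulr_ile1 ?subr_ge0 ?gerBl.
Qed.

Lemma ideal_star I x : closed_two_sided_ideal I -> I x -> I (cstar x).
Proof.
move=> hI Ix; apply: ideal_mem_Mstar => //; rewrite cstarK.
by have [[_ Imul] _] := hI; have [] := Imul (cstar x) x Ix.
Qed.

(** Since [|x| = 1], soft thresholding of [x] at [1 - a] leaves a nonzero element. It is orthogonal
    to [x^2 - x^2 k], which lives below the threshold, so that [x^2 = x^2 k]. Then
    [x^4 - x^2 = x^4 - x^2 k], whose norm is at most [9 a]. *)
Lemma sa_idempotent x S : sa x -> nrm x = 1 -> stable_under x S ->
  (forall y z, S y -> S z -> sa y -> sa z -> y ** z = 0 -> y = 0 \/ z = 0) ->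
  x ** x ** (x ** x) = x ** x.
Proof.
move=> xsa x1 hS hmin; apply/eqP; rewrite -subr_eq0; apply/eqP/nrm_small => d d0.
pose a := Num.min (1 / 2) (d / 20).
have a0 : 0 < a by rewrite lt_min !divr_gt0.
have a1 : a <= 1 / 2 by rewrite ge_min lexx.
have ad : a <= d / 20 by rewrite ge_min lexx orbT.
pose c := 1 + a; have xc : nrm x < c by rewrite x1 ltrDl.
pose e := 1 - a; have e0 : 0 < e by rewrite /e; lra.
have [y hy] := fc_rn xsa xc e0.
have hz := fc_scale (A := A) e hy; have hs := fc_sub (fc_id x c) hz.
have hk := fc_mul xsa xc hy hy.
have hx2 := fc_mul xsa xc (fc_id x c) (fc_id x c).
have hw := fc_sub hx2 (fc_mul xsa xc hx2 hk).
have s0 : (0 : R) - e * (0 * invmax e 0) = 0 by rewrite mul0r mulr0 subr0.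
have w0 : (0 : R) * 0 - 0 * 0 * (0 * invmax e 0 * (0 * invmax e 0)) = 0 by rewrite !mul0r subr0.
have sn0 : x - e%:C *: y <> 0.
  move=> h; have : nrm (e%:C *: y) <= e.
    apply: (fc_norm xsa xc (ltW e0) _ hz) => r _; exact: clamp_le.
  have <- : x = e%:C *: y by apply/eqP; rewrite -subr_eq0 h.
  by rewrite x1 /e; lra.
have hws : (x ** x - x ** x ** (y ** y)) ** (x - e%:C *: y) = 0.
  apply/nrm_eq0/eqP; rewrite eq_le nrm_ge0 andbT.
  apply: (fc_norm xsa xc _ _ (fc_mul xsa xc hw hs)) => // r _ /=.
  rewrite normr_le0.
  have -> : r * invmax e r * (r * invmax e r) =
     `|r| * invmax e r * (`|r| * invmax e r) by rewrite mulrACA sqr_norm; ring.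
  case: (invmaxP e0 r) => -[_ E]; first by rewrite E !mulr1 subrr mul0r.
  by rewrite mulf_eq0; apply/orP; right; rewrite mulrCA E mulr1 subrr.
have [|//] := hmin _ _ (fc_memS xsa xc w0 hw hS) (fc_memS xsa xc s0 hs hS)
  (@fc_star _ _ _ _ xsa xc _ _ w0 hw) (@fc_star _ _ _ _ xsa xc _ _ s0 hs) hws.
move/eqP; rewrite subr_eq0 => /eqP hx.
rewrite {3}hx.
apply: (fc_norm xsa xc (ltW d0) _ (fc_sub (fc_mul xsa xc hx2 hx2) (fc_mul xsa xc hx2 hk))).
move=> r rc /=; have n0 := invmax_gt0 e0 r; have n1 := invmax_norm e0 r.
have -> : r * r * (r * r) - r * r * (r * invmax e r * (r * invmax e r)) =
   r * r * (r * r - `|r| * invmax e r * (`|r| * invmax e r)).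
  by rewrite [in RHS]mulrACA -sqr_norm; ring.
rewrite sqr_norm; rewrite /c in rc.
have q0 : 0 <= `|r| by [].
case: (invmaxP e0 r) => -[re E].
  rewrite E mulr1; move: (`|r|) rc q0 re => q qc q0 qe; rewrite /e in qe.
  have q1 : `|q * q - 1| <= 3 * a by rewrite ler_norml; apply/andP; split; nra.
  rewrite normrM ger0_norm ?mulr_ge0 //.
  have : q * q <= 3 by nra.
  have := normr_ge0 (q * q - 1); nra.
move: re n1; set n := invmax e r in E n0 *; move: (`|r|) q0 {rc} => q q0 qe n1.
have nE : n = e^-1 by apply: (mulfI (lt0r_neq0 e0)); rewrite E mulfV ?lt0r_neq0.
have -> : q * q * (q * q - q * n * (q * n)) = - ((q * q) * (q * q) * (n * n - 1)) by ring.
have n1' : 1 <= n * n.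
  by have : 1 <= n; [rewrite nE invf_ge1 // /e; lra|nra].
have e1 : e * e * (e * e) * (n * n - 1) = e * e * (1 - e * e).
  have -> : e * e * (e * e) * (n * n - 1) = e * e * ((e * n) * (e * n) - e * e) by ring.
  by rewrite E mulr1.
have qq : q * q <= e * e by rewrite ler_pM // ltW.
rewrite normrN ger0_norm; last by rewrite !mulr_ge0 // subr_ge0.
apply: (@le_trans _ _ (e * e * (e * e) * (n * n - 1))).
  by rewrite ler_wpM2r ?subr_ge0 // ler_pM // mulr_ge0.
by rewrite e1 /e; nra.
Qed.

End Cutoffs.

(** * Positivity by sums of squares *)

Section Positivity.
Variables (R : realType) (A : cstarAlgType R).
Implicit Types (x y u p : A).

Lemma ubound_1subsqr y : sa y -> nrm y < 1 -> ubound (1 - uin (y ** y)) 1.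
Proof.
move=> ysa y1; have -> : 1 - uin (y ** y) = upoly y (1 - 'X ^+ 2).
  by rewrite rmorphB rmorph1 rmorphXn /= upolyX uinM expr2.
apply: (upoly_ubound_ge0 ysa y1) => // r r1.
rewrite hornerD hornerN hornerXn hornerC.
have : 0 <= r ^+ 2 <= 1 by rewrite sqr_ge0 /= -real_normK ?num_real // exprn_ile1.
by case/andP=> h0 h1; rewrite ler_norml; apply/andP; split; lra.
Qed.

(** If the sum vanished, then after scaling by [s] the [n] contractions [1 - (s y_i)^2] would add up
    to [n + s^2 p]. This acts on [p] as the scalar [n + s^2], whereas a sum of [n] contractions has
    norm at most [n]. *)
Lemma sum_sqr_projection p (n : nat) (y : 'I_n -> A) : p <> 0 -> p ** p = p ->
  (forall i, sa (y i)) -> p + \sum_i y i ** y i <> 0.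
Proof.
move=> p0 pp ysa h.
pose m := 1 + \sum_i nrm (y i); have m0 : 0 < m by rewrite ltr_pwDl // sumr_ge0 // => i _; exact: nrm_ge0.
pose s := m^-1; have s0 : 0 < s by rewrite invr_gt0.
have ym i : nrm (y i) < m.
  rewrite /m (bigD1 i) //= addrCA ltrDl ltr_pwDl // sumr_ge0 // => j _; exact: nrm_ge0.
have hy i : ubound (1 - uin ((s%:C *: y i) ** (s%:C *: y i))) 1.
  apply: ubound_1subsqr; first by rewrite /sa cstarZr ysa.
  by rewrite nrmZ cabs_real gtr0_norm // mulrC ltr_pdivrMr // mul1r.
have : ubound (\sum_i (1 - uin ((s%:C *: y i) ** (s%:C *: y i)))) (\sum_(i < n) 1).
  exact: ubound_sum.
rewrite sumr_const card_ord sumrB sumr_const card_ord.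
have -> : \sum_i uin ((s%:C *: y i) ** (s%:C *: y i)) = - uin ((s * s)%:C *: p).
  have -> : p = - \sum_i y i ** y i by apply/eqP; rewrite -addr_eq0 h.
  rewrite scalerN scaler_sumr; have -> (z : A) : - uin (- z) = uin z by congr pair; rewrite /= ?opprK ?oppr0.
  elim/big_rec2: _ => [|i z1 z2 _ ->]; first by congr pair.
  by rewrite uinD cmulZl cmulZr scalerA -rmorphM.
move=> /(_ p); rewrite opprK /uact /= addr0.
have -> : (1 *+ n : unitization A).1 = n%:R.
  by elim: (n) => // k IHk; rewrite !mulrS /= IHk.
have -> : (1 *+ n : unitization A).2 = 0.
  by elim: (n) => // k IHk; rewrite !mulrS /= IHk addr0.
rewrite add0r cmulZl pp -scalerDl -(rmorph_nat (real_complex R)) -rmorphD nrmZ cabs_real.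
rewrite ger0_norm; last by rewrite addr_ge0 // mulr_ge0 // ltW.
rewrite ler_pM2r; last exact: nrm_gt0.
by rewrite gerDl leNgt mulr_gt0.
Qed.

(** If [a < 0], a multiple [v] of [u] satisfies [v^* v = - p], and [f = v v^*] satisfies
    [f^2 = - f]. Twice the real and imaginary parts of [v] (up to sign) give
    [h^2 + k^2 = 2 f - 2 p], so that [p + p^2 + f^2 + f^2 + h^2 + k^2 = 0], contrary to
    [sum_sqr_projection]. *)
Lemma starM_scalar_ge0 p u (a : R) : sa p -> p ** p = p -> p <> 0 -> u ** p = u ->
  cstar u ** u = a%:C *: p -> 0 <= a.
Proof.
move=> psa pp p0 up huu; rewrite leNgt; apply/negP => a0.
pose b := Num.sqrt (- a)^-1; have b2 : b ^+ 2 = (- a)^-1.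
  by rewrite sqr_sqrtr // invr_ge0 oppr_ge0 ltW.
pose v := b%:C *: u.
have hvv : cstar v ** v = - p.
  rewrite /v cstarZr cmulZl cmulZr huu !scalerA -!rmorphM /=.
  by rewrite -expr2 b2 invrN mulNr mulVf ?ltr0_neq0 // rmorphN rmorph1 scaleN1r.
have vp : v ** p = v by rewrite /v cmulZl up.
pose f := v ** cstar v.
have fsa : sa f by rewrite /sa cstarM cstarK.
have ff : f ** f = - f.
  by rewrite /f cmulA -(cmulA v) hvv cmulxN cmulNx vp.
have ii : 'i * 'i = -1 :> R[i] by rewrite -expr2 sqr_i.
have iJ : conjc 'i = - 'i :> R[i] by congr (_ +i* _); rewrite oppr0.
pose h := v + cstar v; pose k := 'i *: (v - cstar v).
have hsa : sa h by rewrite /sa cstarD cstarK addrC.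
have ksa : sa k by rewrite /sa cstarZc iJ cstarB cstarK scaleNr -scalerN opprB.
have hk : h ** h + k ** k = (cstar v ** v + f) + (cstar v ** v + f).
  rewrite /h /k /f cmulZl cmulZr scalerA ii scaleN1r.
  by rewrite !(cmulDl, cmulDr, cmulxN, cmulNx); abel.
pose y (i : 'I_5) : A := [:: p; f; f; h; k]`_i.
have ysa i : sa (y i) by case: i => [[|[|[|[|[|//]]]]] i].
apply: (sum_sqr_projection p0 pp ysa).
rewrite !big_ord_recr big_ord0 /= /y /= add0r pp ff -(addrA _ (h ** h)) hk hvv.
by abel.
Qed.

End Positivity.

(** * The Pedersen ideal and hereditary subalgebras *)

Section PedersenIdeal.
Variables (R : realType) (A : cstarAlgType R).
Implicit Types (x y z k d : A) (S I D : set A).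
Local Notation K := (pedersen_ideal A).

Lemma closure_subspace S : Defs.subspace S -> Defs.subspace (closure S).
Proof.
move=> [S0 SD]; split; first exact: subset_closure.
move=> c x y /closure_nrmP cx /closure_nrmP cy; apply/closure_nrmP => e e0.
have c0 : 0 < cabs c + 1 by rewrite ltr_wpDl ?cabs_ge0.
have [x' Sx' hx] := cx _ (divr_gt0 e0 (mulr_gt0 (ltr0Sn R 1) c0)).
have [y' Sy' hy] := cy _ (divr_gt0 e0 (ltr0Sn R 1)).
exists (c *: x' + y'); first exact: SD.
have -> : c *: x + y - (c *: x' + y') = c *: (x - x') + (y - y') by rewrite scalerBr; abel.
apply: (le_lt_trans (nrmD _ _)); rewrite nrmZ.
move: hx; rewrite ltr_pdivlMr ?mulr_gt0 // => hx.
have := nrm_ge0 (x - x'); have := cabs_ge0 c; nra.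
Qed.

Lemma subspaceD S x y : Defs.subspace S -> S x -> S y -> S (x + y).
Proof. by move=> [_ SD] Sx Sy; rewrite -[x]scale1r; exact: SD. Qed.

Lemma subspaceZ S c x : Defs.subspace S -> S x -> S (c *: x).
Proof. by move=> [S0 SD] Sx; rewrite -[c *: x]addr0; exact: SD. Qed.

Lemma subspaceB S x y : Defs.subspace S -> S x -> S y -> S (x - y).
Proof.
by move=> hS Sx Sy; apply: subspaceD => //; rewrite -scaleN1r; exact: subspaceZ.
Qed.

Lemma subspace_sum S J (r : seq J) (P : pred J) (F : J -> A) :
  Defs.subspace S -> (forall i, S (F i)) -> S (\sum_(i <- r | P i) F i).
Proof.
move=> hS hF; elim/big_ind: _ => //; first by case: hS.
by move=> x y; exact: subspaceD.
Qed.

Lemma subspace_sa S : Defs.subspace S -> (forall x, sa x -> S x) -> forall x, S x.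
Proof.
move=> hS h x; have ii : 'i * 'i = -1 :> R[i] by rewrite -expr2 sqr_i.
have iJ : conjc 'i = - 'i :> R[i] by congr (_ +i* _); rewrite oppr0.
have -> : x = (2^-1 : R)%:C *: ((x + cstar x) + (- 'i) *: ('i *: (x - cstar x))).
  rewrite scalerA mulNr ii opprK scale1r.
  have -> : x + cstar x + (x - cstar x) = x + x by abel.
  by rewrite scalerDr -scalerDl -rmorphD; have -> : 2^-1 + 2^-1 = 1 :> R; [lra|rewrite scale1r].
apply: subspaceZ => //; apply: subspaceD => //.
  by apply: h; rewrite /sa cstarD cstarK addrC.
by apply: subspaceZ => //; apply: h; rewrite /sa cstarZc iJ cstarB cstarK scaleNr -scalerN opprB.
Qed.

(** By [cutdown], self-adjoint elements with a self-adjoint local unit are dense among the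
    self-adjoint ones; most statements about all of [A] are reduced to them in this way. *)
Lemma subspace_local_units S : Defs.subspace S -> closed S ->
  (forall y k, sa y -> sa k -> k ** y = y -> y ** k = y -> S y) -> forall x, S x.
Proof.
move=> hS /closed_nrmP cS h; apply: subspace_sa => // x xsa; apply: cS => e e0.
have e2 : 0 < e / 2 by rewrite divr_gt0.
have [y [k [ysa ksa [ky yk] xy _]]] := cutdown xsa e2.
by exists y; [exact: h ky yk|lra].
Qed.

(** [g] is the sum of the [d^n] for [n >= 1]: [1 + g] inverts [1 - d], with no unit required in
    [A]. *)
Lemma neumann_right d : nrm d < 1 -> exists g, g = d + g ** d.
Proof.
move=> d1; pose g := fix g n : A := if n is n'.+1 then d + g n' ** d else 0.
have hg n : nrm (g n.+1 - g n) <= nrm d * nrm d ^+ n.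
  elim: n => [|n IHn]; first by rewrite /= cmul0x addr0 subr0 expr0 mulr1.
  have -> : g n.+2 - g n.+1 = (g n.+1 - g n) ** d by rewrite cmulBx /=; abel.
  apply: (le_trans (nrmM _ _)); rewrite exprSr mulrA.
  by rewrite ler_wpM2r ?nrm_ge0.
have [l gl] := geometric_ncvg (nrm_ge0 d) (nrm_ge0 d) d1 hg.
exists l; apply: (ncvg_uniq (ncvg_shift gl)).
exact: ncvgD (ncvg_cst d) (ncvgM gl (ncvg_cst d)).
Qed.

Lemma neumann_left d : nrm d < 1 -> exists g, g = d + d ** g.
Proof.
rewrite -nrm_star => /neumann_right[g hg]; exists (cstar g).
by rewrite {1}hg cstarD cstarM cstarK.
Qed.

Lemma pedersenP x :
  K x <-> forall I, two_sided_ideal I -> dense I -> I x.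
Proof.
split=> [h I hI dI|h I [[hI dI] _]]; last exact: h.
by apply: h; split.
Qed.

Lemma pedersen_two_sided : two_sided_ideal K.
Proof.
split; first split.
- by apply/pedersenP => I [[I0 _] _] _.
- move=> c x y /pedersenP Kx /pedersenP Ky; apply/pedersenP => I hI dI.
  by have [[_ ID] _] := hI; apply: ID; [exact: Kx|exact: Ky].
move=> a x /pedersenP Kx; split; apply/pedersenP => I hI dI; have [_ /(_ a x)] := hI.
  by case; first exact: Kx.
by case; first exact: Kx.
Qed.

(* If [y] is close to [k] in a dense ideal then [z] is recovered from [y z] by
   inverting [1 - (k - y)] in the unitization. *)
Lemma pedersen_left_unit k z : k ** z = z -> K z.
Proof.
move=> kz; apply/pedersenP => I [sI mI] /dense_nrmP/(_ k 1 ltr01)[y Iy ky].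
have [g hg] := neumann_right ky.
have Iv : I (y ** z) by have [] := mI z y Iy.
have -> : z = y ** z + g ** (y ** z).
  have -> : y ** z = z - (k - y) ** z by rewrite cmulBx kz; abel.
  set d := k - y in hg *; clearbody d.
  by rewrite cmulxB {1}hg cmulDl -(cmulA g); abel.
by apply: subspaceD => //; have [] := mI g _ Iv.
Qed.

Lemma pedersen_right_unit k z : z ** k = z -> K z.
Proof.
move=> kz; apply/pedersenP => I [sI mI] /dense_nrmP/(_ k 1 ltr01)[y Iy ky].
have [g hg] := neumann_left ky.
have Iv : I (z ** y) by have [] := mI z y Iy.
have -> : z = z ** y + z ** y ** g.
  have -> : z ** y = z - z ** (k - y) by rewrite cmulxB kz; abel.
  set d := k - y in hg *; clearbody d.
  by rewrite cmulBx {1}hg cmulDr (cmulA z d); abel.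
by apply: subspaceD => //; have [] := mI g _ Iv.
Qed.

End PedersenIdeal.

Section Hereditary.
Variables (R : realType) (A : cstarAlgType R).
Implicit Types (x y z k a c : A) (S I D : set A).

(** The clause [hered_mid] expresses that a C*-subalgebra is hereditary without mentioning the order
    on positive elements. *)
Record hereditary D : Prop := Hereditary {
  hered_sub : Defs.subspace D ;
  hered_closed : closed D ;
  hered_star : forall x, D x -> D (cstar x) ;
  hered_mul : forall x y, D x -> D y -> D (x ** y) ;
  hered_mid : forall x a y, D x -> D y -> D (x ** a ** y) }.

Lemma hered_stable D x : hereditary D -> D x -> stable_under x D.
Proof. by move=> hD Dx; split; [exact: hered_sub|exact: hered_closed| |move=> z; exact: hered_mul]. Qed.

Lemma ideal_mul I x a : closed_two_sided_ideal I -> I x -> I (a ** x) /\ I (x ** a).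
Proof. by move=> [[_ hI] _]; exact: hI. Qed.

Lemma ideal_stable I x : closed_two_sided_ideal I -> I x -> stable_under x I.
Proof. by move=> [[h1 h2] h3] Ix; split=> // z Iz; have [] := h2 x z Iz. Qed.

Lemma ideal_hereditary I : closed_two_sided_ideal I -> hereditary I.
Proof.
move=> hI; have [[h1 h2] h3] := hI; split=> //.
- by move=> x; exact: ideal_star.
- by move=> x y _ Iy; have [] := h2 x y Iy.
- by move=> x a y _ Iy; have [] := h2 (x ** a) y Iy.
Qed.

Lemma hereditaryI D D' : hereditary D -> hereditary D' -> hereditary (D `&` D').
Proof.
move=> [[h0 h1] h2 h3 h4 h5] [[g0 g1] g2 g3 g4 g5]; split.
- split; first by split.
  by move=> c x y [? ?] [? ?]; split; [exact: h1|exact: g1].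
- exact: closedI.
- by move=> x [? ?]; split; [exact: h3|exact: g3].
- by move=> x y [? ?] [? ?]; split; [exact: h4|exact: g4].
- by move=> x a y [? ?] [? ?]; split; [exact: h5|exact: g5].
Qed.

Lemma closed_lin_eq (f : A -> A) (C : R) : (forall x y, f (x - y) = f x - f y) ->
  (forall x, nrm (f x) <= C * nrm x) -> closed [set x | f x = 0].
Proof.
move=> fB fC; apply/closed_nrmP => x h /=; apply: nrm_small => e e0.
have c0 : 0 < `|C| + 1 by rewrite ltr_wpDl.
have [y /= fy xy] := h _ (divr_gt0 e0 c0).
rewrite -[f x]subr0 -fy -fB; apply: (le_trans (fC _)).
move: xy; rewrite ltr_pdivlMr // => xy; apply: le_trans (ltW xy).
by rewrite mulrC ler_wpM2l ?nrm_ge0 // (le_trans (ler_norm C)) // lerDl.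
Qed.

Definition unit_corner k : set A := [set x | k ** x = x /\ x ** k = x].

Lemma unit_corner_hereditary k : sa k -> hereditary (unit_corner k).
Proof.
move=> ksa; split.
- split; first by split; rewrite ?cmulx0 ?cmul0x.
  by move=> c x y [h1 h2] [h3 h4]; split; rewrite ?(cmulDr, cmulDl, cmulZr, cmulZl) ?h1 ?h2 ?h3 ?h4.
- have -> : unit_corner k = [set x | k ** x - x = 0] `&` [set x | x ** k - x = 0].
    by apply/seteqP; split=> x [/= /eqP h /eqP h']; split; apply/eqP; rewrite ?subr_eq0 // -subr_eq0.
  apply: closedI; apply: (@closed_lin_eq _ (nrm k + 1)) => x.
  + by move=> y; rewrite cmulxB; abel.
  + by have := nrmB (k ** x) x; have := nrmM k x; lra.
  + by move=> y; rewrite cmulBx; abel.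
  + by have := nrmB (x ** k) x; have := nrmM x k; lra.
- by move=> x [h1 h2]; split; [rewrite -{1}ksa -cstarM h2|rewrite -{1}ksa -cstarM h1].
- by move=> x y [h1 h2] [h3 h4]; split; [rewrite cmulA h1|rewrite -cmulA h4].
- by move=> x a y [h1 h2] [h3 h4]; split; [rewrite !cmulA h1|rewrite -cmulA h4].
Qed.

Definition orth D c : set A := [set x | [/\ D x, x ** c = 0 & c ** x = 0]].

Lemma orth_hereditary D c : sa c -> hereditary D -> hereditary (orth D c).
Proof.
move=> csa hD; have -> : orth D c = D `&` ([set x | x ** c = 0] `&` [set x | c ** x = 0]).
  by apply/seteqP; split=> x; [case|case=> ? []].
apply: hereditaryI => //; split.
- split; first by split; rewrite /= ?cmulx0 ?cmul0x.
  move=> b x y [/= h1 h2] [/= h3 h4]; split => /=.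
    by rewrite cmulDl cmulZl h1 h3 scaler0 addr0.
  by rewrite cmulDr cmulZr h2 h4 scaler0 addr0.
- apply: closedI; apply: (@closed_lin_eq _ (nrm c)) => x.
  + by move=> y; exact: cmulBx.
  + by rewrite mulrC; exact: nrmM.
  + by move=> y; exact: cmulxB.
  + exact: nrmM.
- move=> x [/= h1 h2]; split; rewrite /= -{1}csa -cstarM ?h1 ?h2; exact: cstar0.
- by move=> x y [/= h1 h2] [/= h3 h4]; split; rewrite /= -?cmulA ?h3 ?cmulx0 // cmulA h2 cmul0x.
- move=> x a y [/= h1 h2] [/= h3 h4]; split; rewrite /=; first by rewrite -cmulA h3 cmulx0.
  by rewrite !cmulA h2 !cmul0x.
Qed.

(** Each new element is chosen in the orthogonal complement of the previous ones, so [P] has to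
    survive the passage to [orth D c]. *)
Lemma orthogonal_sequence (P : set A -> Prop) (Q : nat -> A -> Prop) D :
  (forall n D, P D -> exists c, [/\ D c, sa c, Q n c & P (orth D c)]) -> P D ->
  exists c : nat -> A, [/\ forall n, D (c n), forall n, sa (c n), forall n, Q n (c n) &
    forall m n, m != n -> c m ** c n = 0].
Proof.
move=> step PD.
(* The choice is made for all pairs at once, with a default outside [P], because the recursion that
   defines [Ds] must be total. *)
have [f hf] : exists f : nat -> set A -> A, forall n D, P D ->
    [/\ D (f n D), sa (f n D), Q n (f n D) & P (orth D (f n D))].
  have /choice[f hf] : forall nD : nat * set A, exists c, P nD.2 ->
      [/\ nD.2 c, sa c, Q nD.1 c & P (orth nD.2 c)].
    move=> [n E]; have [PE|nPE] := pselect (P E); last by exists 0.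
    by have [c hc] := step n E PE; exists c.
  by exists (fun n D => f (n, D)) => n E; exact: hf (n, E).
pose Ds := fix Ds n := if n is n'.+1 then orth (Ds n') (f n' (Ds n')) else D.
have PDs n : P (Ds n) by elim: n => //= n IHn; have [] := hf n _ IHn.
have sub m n x : Ds (m + n)%N x -> Ds m x.
  by elim: n => [|n IHn]; rewrite ?addn0 // addnS => -[/IHn].
exists (fun n => f n (Ds n)); split=> [n|n|n|].
- by have [h _ _ _] := hf n _ (PDs n); move: h; rewrite -{1}[n]add0n => /sub.
- by have [] := hf n _ (PDs n).
- by have [] := hf n _ (PDs n).
move=> m n; rewrite neq_ltn => /orP[] h.
  have [hn _ _ _] := hf n _ (PDs n).
  by have [] : Ds m.+1 (f n (Ds n)) by apply: (sub _ (n - m.+1)%N); rewrite subnKC.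
have [hm _ _ _] := hf m _ (PDs m).
by have [] : Ds n.+1 (f m (Ds m)) by apply: (sub _ (m - n.+1)%N); rewrite subnKC.
Qed.

Lemma hered_idempotent D x : hereditary D -> D x -> sa x -> nrm x = 1 ->
  (forall y z, D y -> D z -> sa y -> sa z -> y ** z = 0 -> y = 0 \/ z = 0) ->
  x ** x ** (x ** x) = x ** x.
Proof.
move=> hD Dx xsa x1 hmin.
exact: sa_idempotent xsa x1 (hered_stable hD Dx) hmin.
Qed.

(** The square of every normalized self-adjoint element of [D] is a projection. A projection [q]
    below [p] equals [p], as [q (p - q) = 0]; and [d^2 = p] gives [(d - p)(d + p) = 0], whence [d]
    is [p] or [-p]. So the self-adjoint elements of [p A p] are multiples of [p]. *)
Lemma hered_minimal_projection D x : hereditary D -> D x -> x <> 0 ->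
  (forall y z, D y -> D z -> sa y -> sa z -> y ** z = 0 -> y = 0 \/ z = 0) ->
  exists p, [/\ D p, sa p, p ** p = p, p <> 0 &
    forall a, exists c : R[i], p ** a ** p = c *: p].
Proof.
move=> hD Dx x0 hmin.
have sq y : D y -> sa y -> y <> 0 -> let b := (nrm y)^-1%:C *: y in
    [/\ D b, sa b & let q := b ** b in [/\ D q, sa q, q ** q = q & q <> 0]].
  move=> Dy ysa y0 b; have ny := nrm_gt0 y0.
  have bsa : sa b by rewrite /sa cstarZr ysa.
  have Db : D b by apply: subspaceZ => //; exact: hered_sub.
  have b1 : nrm b = 1 by rewrite nrmZ cabs_real gtr0_norm ?invr_gt0 // mulVf ?lt0r_neq0.
  split=> //; split.
  - exact: hered_mul.
  - by rewrite /sa cstarM bsa.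
  - exact: hered_idempotent hD Db bsa b1 hmin.
  - rewrite -{1}bsa => /starM_eq0 h; move: b1; rewrite h nrm0 => /eqP.
    by rewrite eq_sym oner_eq0.
pose y := cstar x ** x.
have ysa : sa y by rewrite /sa cstarM cstarK.
have Dy : D y by apply: hered_mul => //; exact: hered_star.
have y0 : y <> 0 by move/starM_eq0.
have [_ _ /= [Dp psa pp p0]] := sq y Dy ysa y0; set p := _ ** _ in Dp psa pp p0; clearbody p.
exists p; split=> //.
have key a : sa a -> exists c : R[i], p ** a ** p = c *: p.
  move=> asa; set b := p ** a ** p.
  have [->|b0] := pselect (b = 0); first by exists 0; rewrite scale0r.
  have Db : D b by exact: hered_mid.
  have bsa : sa b by rewrite /sa /b !cstarM psa asa cmulA.
  have pb : p ** b = b by rewrite /b !cmulA pp.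
  have bp : b ** p = b by rewrite /b -!cmulA pp.
  have nb := nrm_gt0 b0.
  have [Dd dsa /= [Dq qsa qq q0]] := sq b Db bsa b0.
  set d := _ *: b in Dd dsa Dq qsa qq q0; set q := d ** d in Dq qsa qq q0.
  have pd : p ** d = d by rewrite /d cmulZr pb.
  have dp : d ** p = d by rewrite /d cmulZl bp.
  have pq : p ** q = q by rewrite /q cmulA pd.
  have qp : q ** p = q by rewrite /q -cmulA dp.
  have bd : b = (nrm b)%:C *: d.
    by rewrite /d scalerA -rmorphM mulfV ?lt0r_neq0 // scale1r.
  have hD0 := hered_sub hD.
  have Dpq : D (p - q) by exact: subspaceB.
  have pqsa : sa (p - q) by rewrite /sa cstarB psa qsa.
  have qpq : q ** (p - q) = 0 by rewrite cmulxB qp qq subrr.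
  have [//|/eqP] := hmin q (p - q) Dq Dpq qsa pqsa qpq.
  rewrite subr_eq0 => /eqP pq'.
  have D1 : D (d - p) by exact: subspaceB.
  have D2 : D (d + p) by exact: subspaceD.
  have s1 : sa (d - p) by rewrite /sa cstarB psa dsa.
  have s2 : sa (d + p) by rewrite /sa cstarD psa dsa.
  have dd : (d - p) ** (d + p) = 0.
    by rewrite cmulBx !cmulDr pd dp pp -/q -pq'; abel.
  have [/eqP|/eqP] := hmin _ _ D1 D2 s1 s2 dd.
    by rewrite subr_eq0 => /eqP dp'; exists (nrm b)%:C; rewrite -dp'.
  by rewrite addr_eq0 => /eqP dp'; exists (- (nrm b)%:C); rewrite scaleNr -scalerN -dp'.
apply: subspace_sa => //; split; first by exists 0; rewrite cmulx0 cmul0x scale0r.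
move=> c u v [c1 h1] [c2 h2]; exists (c * c1 + c2).
by rewrite cmulDr cmulZr cmulDl cmulZl h1 h2 scalerDl scalerA.
Qed.

End Hereditary.

(** * Boundedness ideals of a quasi-centralizer *)

Section BoundedIdeals.
Variables (R : realType) (A : cstarAlgType R) (T : A -> A -> A).
Local Notation K := (pedersen_ideal A).
Hypothesis hT : quasi_centralizer K T.
Implicit Types (x y z w k a s t u : A) (M : R).

Let Ksub : Defs.subspace K := (pedersen_two_sided A).1.
Let Kmul a x : K x -> K (a ** x) /\ K (x ** a) := (pedersen_two_sided A).2 a x.
Let K0 : K 0 := Ksub.1.

Lemma KM a x : K x -> K (a ** x). Proof. by move/Kmul => /(_ a)[]. Qed.
Lemma KMr a x : K x -> K (x ** a). Proof. by move/Kmul => /(_ a)[]. Qed.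

Lemma Kscale (c : R[i]) x : K x -> K (c *: x). Proof. exact: subspaceZ Ksub. Qed.

Lemma qc0x w : K w -> T 0 w = 0.
Proof.
move=> Kw; have := qc_linearl hT (-1) K0 K0 Kw.
by rewrite scaler0 addr0 scaleN1r addNr.
Qed.

Lemma qcx0 z : K z -> T z 0 = 0.
Proof.
move=> Kz; have := qc_linearr hT (-1) K0 K0 Kz.
by rewrite scaler0 addr0 scaleN1r addNr.
Qed.

Lemma qcZl (c : R[i]) z w : K z -> K w -> T (c *: z) w = c *: T z w.
Proof.
by move=> Kz Kw; have := qc_linearl hT c Kz K0 Kw; rewrite addr0 qc0x // addr0.
Qed.

Lemma qcZr (c : R[i]) z w : K z -> K w -> T z (c *: w) = c *: T z w.
Proof.
by move=> Kz Kw; have := qc_linearr hT c Kw K0 Kz; rewrite addr0 qcx0 // addr0.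
Qed.

(** What is kept of [softcut]: the factor [t] puts [s] in [K] when [t] is a value of [T], and the
    inequality says that [t] is at least [M] on [s]. *)
Definition soft_threshold t M s : Prop :=
  [/\ sa s, exists l, s = t ** cstar t ** l &
      forall a, M * nrm (a ** s) <= nrm (a ** s ** t)].

(* An ideal on which [T] is bounded by [M]: it annihilates the part of
   [T z w (T z w)^*] lying above [M^2], for all [z] and [w] in the unit ball. *)
Definition bounded_ideal M : set A := [set u | forall z w s a,
  K z -> K w -> nrm z <= 1 -> nrm w <= 1 -> soft_threshold (T z w) M s ->
  u ** a ** s = 0].

Lemma soft_threshold_K z w M s : K z -> K w -> soft_threshold (T z w) M s -> K s.
Proof.
by move=> Kz Kw [_ [l ->] _]; rewrite -cmulA; apply: KMr; exact: (qc_stable hT).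
Qed.

Lemma bounded_ideal_closed M : closed_two_sided_ideal (bounded_ideal M).
Proof.
split; first split.
- split; first by move=> z w s a _ _ _ _ _; rewrite !cmul0x.
  move=> c x y hx hy z w s a Kz Kw z1 w1 hs.
  by rewrite !cmulDl !cmulZl (hx z w) // (hy z w) // scaler0 addr0.
- move=> b x hx; split=> z w s a Kz Kw z1 w1 hs.
    by rewrite -(cmulA b) -(cmulA b) (hx z w) // cmulx0.
  by rewrite -(cmulA x) (hx z w).
apply/closed_nrmP => x h z w s a Kz Kw z1 w1 hs.
apply: nrm_small => e e0; have c0 : 0 < nrm (a ** s) + 1 by rewrite ltr_wpDl ?nrm_ge0.
have [y hy xy] := h _ (divr_gt0 e0 c0).
have -> : x ** a ** s = (x - y) ** (a ** s).
  by rewrite cmulBx !cmulA (hy z w) // subr0.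
apply: (le_trans (nrmM _ _)); move: xy; rewrite ltr_pdivlMr // => xy.
apply: le_trans (ltW xy); rewrite ler_wpM2l ?nrm_ge0 // lerDl; exact: ler01.
Qed.

Lemma bounded_ideal_mono M M' : M <= M' -> bounded_ideal M `<=` bounded_ideal M'.
Proof.
move=> MM' u hu z w s a Kz Kw z1 w1 [ssa hs1 hs2]; apply: (hu z w) => //; split=> // b.
by apply: le_trans (hs2 b); rewrite ler_wpM2r ?nrm_ge0.
Qed.

(** [a s] lies in [K], so the module property gives [(T z w) a s = T z (w a s)], and [w a s = 0]. *)
Lemma bounded_ideal_qc M z w : K z -> K w -> bounded_ideal M w -> bounded_ideal M (T z w).
Proof.
move=> Kz Kw hw z' w' s a Kz' Kw' z1 w1 hs.
have Ks := soft_threshold_K Kz' Kw' hs.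
rewrite -cmulA -(qc_mulr hT Kz Kw (KM a Ks)) cmulA (hw z' w') //.
by rewrite qcx0.
Qed.

(** [T z w] belongs to the ideal, hence so does its own threshold [s]. The ideal annihilates [s], so
    [s^3 = 0] and [s = 0], which bounds [T z w] by [softcut]. *)
Lemma bounded_ideal_bound1 M z w : 0 < M -> K z -> K w -> bounded_ideal M w ->
  nrm z <= 1 -> nrm w <= 1 -> nrm (T z w) <= M.
Proof.
move=> M0 Kz Kw hw z1 w1; have ht := bounded_ideal_qc Kz Kw hw.
have [s [l [ssa sE h1 h2]]] := softcut (T z w) M0; apply: h2.
have hs : bounded_ideal M s.
  have [[_ Imul] _] := bounded_ideal_closed M.
  by rewrite sE -cmulA; have [] := Imul (cstar (T z w) ** l) _ ht.
have sss : s ** s ** s = 0 by apply: (hs z w) => //; split=> //; exists l.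
have : cstar (s ** s) ** (s ** s) = 0 by rewrite cstarM ssa !cmulA sss cmul0x.
by move/starM_eq0; rewrite -{1}ssa => /starM_eq0.
Qed.

Lemma bounded_ideal_bound M z w : 0 < M -> K z -> K w -> bounded_ideal M w ->
  nrm (T z w) <= M * nrm z * nrm w.
Proof.
move=> M0 Kz Kw hw.
have [->|z0] := pselect (z = 0); first by rewrite qc0x // nrm0 mulr0 mul0r.
have [->|w0] := pselect (w = 0); first by rewrite qcx0 // nrm0 mulr0.
have nz := nrm_gt0 z0; have nw := nrm_gt0 w0.
have := @bounded_ideal_bound1 M ((nrm z)^-1%:C *: z) ((nrm w)^-1%:C *: w) M0.
have [[sI _] _] := bounded_ideal_closed M.
rewrite qcZr ?qcZl //; try exact: Kscale.
rewrite !nrmZ !cabs_real !gtr0_norm ?invr_gt0 // !mulVf ?lt0r_neq0 //.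
move=> h; have : (nrm w)^-1 * ((nrm z)^-1 * nrm (T z w)) <= M.
  by apply: h => //; [exact: Kscale|exact: Kscale|exact: subspaceZ sI hw].
rewrite ler_pdivrMl // ler_pdivrMl //.
by have -> : nrm z * (nrm w * M) = M * nrm z * nrm w by ring.
Qed.

(** The shift keeps the bound positive, as [bounded_ideal_bound] requires. *)
Definition level (n : nat) : set A := bounded_ideal n.+1%:R.

Lemma level_closed n : closed_two_sided_ideal (level n).
Proof. exact: bounded_ideal_closed. Qed.

Lemma level_mono m n : (m <= n)%N -> level m `<=` level n.
Proof. by move=> mn; apply: bounded_ideal_mono; rewrite ler_nat. Qed.

Lemma levels_dense_locally_bounded :
  (forall x, closure [set x | exists n, level n x] x) -> locally_bounded T.
Proof.
move=> h; exists nat, level; split.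
- exact: level_closed.
- apply/seteqP; split=> // x _; apply: closure_subset (h x) => y [n hn].
  exists 1%N, (fun=> y); split; first by move=> _; exists n.
  by rewrite big_ord1.
move=> n; exists n.+1%:R => x y [Kx _] [Ky hy].
rewrite !norm_nrm -!rmorphM lecR; exact: bounded_ideal_bound.
Qed.

Lemma not_bounded_ideal M u : ~ bounded_ideal M u -> exists z w s a,
  [/\ K z, K w, nrm z <= 1 /\ nrm w <= 1, soft_threshold (T z w) M s & u ** a ** s <> 0].
Proof.
move=> /existsNP[z] /existsNP[w] /existsNP[s] /existsNP[a] h.
exists z, w, s, a; apply: contrapT => h'; apply: h => Kz Kw z1 w1 hs.
by apply: contrapT => h; apply: h'.
Qed.

(* Blocks [Z_n], [W_n] supported on the [e_n] with [|T(Z_n, W_n)| >= 8^n] are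
   glued to [Z = sum 2^-n Z_n] and [W = sum 2^-n W_n], which lie in [K] because
   they have a local unit; then [T(Z, W)] would have norm at least [2^n]. *)
Lemma no_orthogonal_sequence k (e : nat -> A) : sa k ->
  (forall n, unit_corner k (e n)) -> (forall n, sa (e n)) ->
  (forall m n, m != n -> e m ** e n = 0) ->
  ~ forall n, ~ bounded_ideal (8 ^+ n) (e n).
Proof.
move=> ksa ek esa eo hne.
have /choice[d hd] : forall n, exists d : A * A * A * A,
    let: (z, w, s, a) := d in
    [/\ K z, K w, nrm z <= 1 /\ nrm w <= 1, soft_threshold (T z w) (8 ^+ n) s &
        e n ** a ** s <> 0].
  move=> n; have [z [w [s [a h]]]] := not_bounded_ideal (hne n).
  by exists (z, w, s, a).
pose z n := (d n).1.1.1; pose w n := (d n).1.1.2.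
pose s n := (d n).1.2; pose a n := (d n).2.
have {}hd n : [/\ K (z n), K (w n), nrm (z n) <= 1 /\ nrm (w n) <= 1,
    soft_threshold (T (z n) (w n)) (8 ^+ n) (s n) & e n ** a n ** s n <> 0].
  by have := hd n; rewrite /z /w /s /a; case: (d n) => -[[]].
have Kz n : K (z n) by have [] := hd n.
have Kw n : K (w n) by have [] := hd n.
have Ks n : K (s n) by have [_ _ _ hs _] := hd n; exact: soft_threshold_K (Kz n) (Kw n) hs.
have Ke n : K (e n) by have [h _] := ek n; exact: pedersen_left_unit h.
pose t n := T (z n) (w n); pose v n := e n ** a n ** s n; pose y n := v n ** t n.
have Kv n : K (v n) by exact: KM.
have Ky n : K (y n) by exact: KMr.
have v0 n : 0 < nrm (v n) by apply: nrm_gt0; have [] := hd n.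
have vy n : 8 ^+ n * nrm (v n) <= nrm (y n) by have [_ _ _ [_ _ h] _] := hd n; exact: h.
have y0 n : 0 < nrm (y n) by apply: lt_le_trans (vy n); rewrite mulr_gt0 // exprn_gt0.
have Kys n : K (cstar (y n)).
  by rewrite /y /v !cstarM esa; apply: KM; apply: KM; exact: KM.
(* [Z n] and [W n] are chosen so that [T (Z n) (W n)] is a positive multiple of [y y^*], of norm
   [|y| / |v| >= 8^n]. *)
pose Z n := (nrm (v n))^-1%:C *: (v n ** z n).
pose W n := (nrm (y n))^-1%:C *: (w n ** cstar (y n)).
have KZ n : K (Z n) by apply: Kscale; exact: KM.
have KW n : K (W n) by apply: Kscale; exact: KMr.
have Z1 n : nrm (Z n) <= 1.
  rewrite nrmZ cabs_real gtr0_norm ?invr_gt0 // ler_pdivrMl // mulr1.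
  have [_ _ [z1 _] _ _] := hd n.
  by apply: (le_trans (nrmM _ _)); rewrite ler_piMr ?nrm_ge0.
have W1 n : nrm (W n) <= 1.
  rewrite nrmZ cabs_real gtr0_norm ?invr_gt0 // ler_pdivrMl // mulr1.
  have [_ _ [_ w1] _ _] := hd n.
  by apply: (le_trans (nrmM _ _)); rewrite nrm_star ler_piMl ?nrm_ge0.
have kZ n : k ** Z n = Z n by have [h _] := ek n; rewrite /Z /v cmulZr !cmulA h.
have Wk n : W n ** k = W n.
  have [_ h] := ek n; rewrite /W /y /v !cstarM esa cmulZl -!cmulA h //.
pose S (F : nat -> A) N := \sum_(n < N) (2^-1 ^+ n)%:C *: F n.
have glue F : (forall n, nrm (F n) <= 1) -> exists l, ncvg (S F) l.
  move=> F1; have h0 : 0 <= (2^-1 : R) by rewrite invr_ge0.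
  have h1 : (2^-1 : R) < 1 by lra.
  apply: (geometric_ncvg ler01 h0 h1) => n; rewrite /S big_ord_recr /= addrAC subrr add0r.
  by rewrite nrmZ cabs_real ger0_norm ?exprn_ge0 // mul1r ler_piMr // exprn_ge0.
have [ZZ hZ] := glue Z Z1; have [WW hW] := glue W W1.
have KZZ : K ZZ.
  apply: (@pedersen_left_unit _ _ k); apply: (ncvg_uniq _ hZ).
  apply: ncvg_eq (ncvgM (ncvg_cst k) hZ) => n.
  by rewrite /S cmulx_sum; apply: eq_bigr => i _; rewrite cmulZr kZ.
have KWW : K WW.
  apply: (@pedersen_right_unit _ _ k); apply: (ncvg_uniq _ hW).
  apply: ncvg_eq (ncvgM hW (ncvg_cst k)) => n.
  by rewrite /S cmul_sumx; apply: eq_bigr => i _; rewrite cmulZl Wk.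
have yv m n : m != n -> cstar (y m) ** v n = 0.
  by move=> mn; rewrite /y /v !cstarM esa !cmulA -(cmulA _ (e m)) (eo _ _ mn) cmulx0 !cmul0x.
have yy m n : m != n -> cstar (y m) ** y n = 0.
  by move=> mn; have -> : y n = v n ** t n by []; rewrite cmulA yv // cmul0x.
have yZ m : cstar (y m) ** ZZ = (2^-1 ^+ m)%:C *: (cstar (y m) ** Z m).
  apply: (ncvg_uniq (ncvgM (ncvg_cst (cstar (y m))) hZ)) => ep ep0.
  exists m.+1 => n mn; rewrite /S cmulx_sum (bigD1 (Ordinal mn)) //= [X in - (_ + X)]big1 => [|i im].
    by rewrite addr0 (cmulZr (2^-1 ^+ m)%:C) subrr nrm0.
  have mi : m != i by apply: contraNneq im => h; apply/eqP/val_inj.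
  by rewrite /Z !cmulZr cmulA (yv _ _ mi) cmul0x !scaler0.
have Wy m : WW ** y m = (2^-1 ^+ m)%:C *: (W m ** y m).
  apply: (ncvg_uniq (ncvgM hW (ncvg_cst (y m)))) => ep ep0.
  exists m.+1 => n mn; rewrite /S cmul_sumx (bigD1 (Ordinal mn)) //= [X in - (_ + X)]big1 => [|i im].
    by rewrite addr0 (cmulZl (2^-1 ^+ m)%:C) subrr nrm0.
  have mi : val i != m by apply: contraNneq im => h; apply/eqP/val_inj.
  by rewrite /W !cmulZl -(cmulA (w i)) (yy _ _ mi) cmulx0 !scaler0.
have TZW m : T (Z m) (W m) = ((nrm (v m))^-1 * (nrm (y m))^-1)%:C *: (y m ** cstar (y m)).
  rewrite /Z /W qcZl ?qcZr //; try exact: KMr; try exact: KM; try (apply: Kscale; exact: KMr).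
  rewrite scalerA -rmorphM (qc_mulr hT) //; last exact: KMr.
  by rewrite (qc_mull hT).
(* Compression by [y m] isolates the [m]-th block. The weights [2^-m] of [Z] and [W] multiply to
   [4^-m]; the base [8] leaves a factor [2^m]. *)
have key m : 4^-1 ^+ m * nrm (y m) <= nrm (T ZZ WW) * nrm (v m).
  have E : cstar (y m) ** T ZZ WW ** y m =
     ((4^-1 ^+ m) * ((nrm (v m))^-1 * (nrm (y m))^-1))%:C *:
       (cstar (y m) ** y m ** (cstar (y m) ** y m)).
    rewrite -(qc_mull hT) // -(qc_mulr hT) //; last exact: KM.
    rewrite yZ Wy qcZl ?qcZr //; try exact: KM; try exact: KMr.
      rewrite (qc_mull hT) // ?(qc_mulr hT) //; last exact: KMr.
      rewrite TZW cmulZl cmulZr !scalerA -!rmorphM !cmulA -!exprMn mulrA.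
      have -> : (2^-1 / 2 : R) = 4^-1 by field.
      by rewrite mulrA.
    by apply: Kscale; exact: KMr.
  have : nrm (cstar (y m) ** T ZZ WW ** y m) <= nrm (T ZZ WW) * nrm (y m) ^+ 2.
    apply: (le_trans (nrmM _ _)); rewrite expr2 mulrA ler_wpM2r ?nrm_ge0 //.
    by rewrite mulrC -(nrm_star (y m)); exact: nrmM.
  rewrite E nrmZ cabs_real ger0_norm; last first.
    by rewrite mulr_ge0 ?exprn_ge0 ?invr_ge0 // mulr_ge0 // invr_ge0 nrm_ge0.
  have -> : nrm (cstar (y m) ** y m ** (cstar (y m) ** y m)) = nrm (y m) ^+ 4.
    have q : cstar (cstar (y m) ** y m) = cstar (y m) ** y m by rewrite cstarM cstarK.
    by rewrite -{1}q nrm_starM nrm_starM -exprM.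
  have -> : 4^-1 ^+ m * ((nrm (v m))^-1 * (nrm (y m))^-1) * nrm (y m) ^+ 4 =
     4^-1 ^+ m * nrm (y m) * (nrm (v m))^-1 * nrm (y m) ^+ 2.
    have fl (q V Y : R) : 0 < V -> 0 < Y ->
        q * (V^-1 * Y^-1) * Y ^+ 4 = q * Y * V^-1 * Y ^+ 2.
      by move=> V0 Y0; field; rewrite !lt0r_neq0.
    exact: fl.
  by rewrite ler_pM2r ?exprn_gt0 // ler_pdivrMr.
have hb m : 2 ^+ m <= nrm (T ZZ WW).
  have := key m; have := vy m => h1 h2.
  rewrite -(ler_pM2r (v0 m)); apply: le_trans h2.
  apply: (@le_trans _ _ (4^-1 ^+ m * (8 ^+ m * nrm (v m)))); last first.
    by rewrite ler_wpM2l // exprn_ge0 // invr_ge0.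
  by rewrite mulrA -exprMn; have -> : 4^-1 * 8 = 2 :> R by field.
have := hb (Num.truncn (nrm (T ZZ WW))).+1; apply/negP; rewrite -ltNge.
apply: (lt_trans (Num.Theory.truncnS_gt _)).
by rewrite -natrX ltr_nat ltn_expl.
Qed.

End BoundedIdeals.

(** * Orthogonal splitting and the minimal projection *)

Section MinimalProjection.
Variables (R : realType) (A : cstarAlgType R) (T : A -> A -> A).
Local Notation K := (pedersen_ideal A).
Hypothesis hT : quasi_centralizer K T.
Implicit Types (x y z w k a s t u c p : A) (D : set A).
Local Notation level := (level T).

Definition bounded_union : set A := [set x | exists n, level n x].

Definition unbounded_ideal : set A := [set u | forall n y, level n y -> u ** y = 0].

Lemma level_sub n : Defs.subspace (level n).
Proof. by have [[]] := level_closed T n. Qed.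

Lemma level_mul n a x : level n x -> level n (a ** x) /\ level n (x ** a).
Proof. by have [[_ h] _] := level_closed T n; exact: h. Qed.

Lemma level_star n x : level n x -> level n (cstar x).
Proof. exact: ideal_star (level_closed T n). Qed.

Lemma unbounded_ideal_closed : closed_two_sided_ideal unbounded_ideal.
Proof.
split; first split.
- split; first by move=> n y _; rewrite cmul0x.
  by move=> c x y hx hy n z hz; rewrite cmulDl cmulZl (hx n) // (hy n) // scaler0 addr0.
- move=> a x hx; split=> n y hy; first by rewrite -cmulA (hx n) // cmulx0.
  by rewrite -cmulA (hx n) //; have [] := level_mul a hy.
apply/closed_nrmP => x h n y hy; apply: nrm_small => e e0.
have c0 : 0 < nrm y + 1 by rewrite ltr_wpDl ?nrm_ge0.
have [z hz xz] := h _ (divr_gt0 e0 c0).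
have -> : x ** y = (x - z) ** y by rewrite cmulBx (hz n) // subr0.
apply: (le_trans (nrmM _ _)); move: xz; rewrite ltr_pdivlMr // => xz.
by apply: le_trans (ltW xz); rewrite ler_wpM2l ?nrm_ge0 // lerDl ler01.
Qed.

Lemma unbounded_level0 n x : unbounded_ideal x -> level n x -> x = 0.
Proof.
by move=> ux lx; apply: Mstar_eq0; apply: (ux n); exact: level_star.
Qed.

Lemma no_orthogonal_levels k (e : nat -> A) : sa k ->
  (forall n, unit_corner k (e n)) -> (forall n, sa (e n)) ->
  (forall m n, m != n -> e m ** e n = 0) -> exists n, level (8 ^ n) (e n).
Proof.
move=> ksa ek esa eo; apply: contrapT => h.
apply: (no_orthogonal_sequence hT ksa ek esa eo) => n hn; apply: h; exists n.
by apply: bounded_ideal_mono hn; rewrite -natrX ler_nat leqnSn.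
Qed.

(** The traces of the levels on [D] never become stationary. This is the property that passes to the
    orthogonal complement of a suitable element of [D]. *)
Definition increasing_levels D : Prop := forall M, exists N c,
  [/\ D c, sa c, level N c & ~ level M c].

(** An [e] in [D] outside level [M] yields [r = e a s <> 0]. As [D] meets [unbounded_ideal] only in
    zero, some [j] of a level [N] has [r r^* j <> 0]. With [q = r^* j], the element
    [c = r q (r q)^*] is in level [N]; it is not in level [M], which would give [c r = 0]. *)
Lemma essential_increasing_levels D : hereditary D ->
  (forall x, D x -> unbounded_ideal x -> x = 0) ->
  (forall n, exists2 x, D x & ~ level n x) -> increasing_levels D.
Proof.
move=> hD hess hlev M; have [e De eM] := hlev M.
have [z [w [s [a [Kz Kw [z1 w1] hs]]]]] := not_bounded_ideal eM.
set r := e ** a ** s => r0; have ssa : sa s by case: hs.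
have Drr : D (r ** cstar r).
  have -> : r ** cstar r = e ** (a ** s ** s ** cstar a) ** cstar e.
    by rewrite /r !cstarM ssa !cmulA.
  by apply: (hered_mid hD) => //; exact: (hered_star hD).
have [N [j [jN rj]]] : exists N j, level N j /\ r ** cstar r ** j <> 0.
  apply: contrapT => h; apply: r0; apply: Mstar_eq0; apply: hess => // N j jN.
  by apply: contrapT => h'; apply: h; exists N, j.
pose q := cstar r ** j.
have qN : level N q by have [] := level_mul (cstar r) jN.
pose c := r ** q ** cstar (r ** q).
have rq : r ** q <> 0 by rewrite /q cmulA.
exists N, c; split.
- have -> : c = e ** (a ** s ** q ** cstar q ** cstar s ** cstar a) ** cstar e.
    by rewrite /c cstarM /r !cstarM !cmulA.
  by apply: (hered_mid hD) => //; exact: (hered_star hD).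
- by rewrite /sa /c cstarM cstarK.
- have [h _] := level_mul r qN; have [_ h'] := level_mul (cstar (r ** q)) h.
  exact: h'.
- move=> cM; apply: rq; apply: Mstar_eq0; rewrite -/c.
  have csa : sa c by rewrite /sa /c cstarM cstarK.
  have [_ ceM] := level_mul e cM.
  have cr : c ** r = 0 by rewrite /r !cmulA; exact: (ceM z w s a Kz Kw z1 w1 hs).
  have cc : c ** c = c ** r ** (q ** cstar (r ** q)).
    by have -> : c ** c = c ** (r ** q ** cstar (r ** q)) by []; rewrite !cmulA.
  by apply: starM_eq0; rewrite csa cc cr cmul0x.
Qed.

(** [c] is a cut-down of [x], so its local unit [k] lies in level [N] like [x]. Compressing [d] by
    [1 - k], written out because [A] may lack a unit, moves it into [orth D c] and changes it only
    by elements of level [N]; hence [d] is taken outside level [maxn M' N]. *)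
Lemma increasing_levels_orth D M : hereditary D -> increasing_levels D ->
  exists c, [/\ D c, sa c, ~ level M c & hereditary (orth D c) /\ increasing_levels (orth D c)].
Proof.
move=> hD hinc; have [N [x [Dx xsa xN xM]]] := hinc M.
have [e e0 he] : exists2 e : R, 0 < e & forall y, nrm (x - y) <= e -> ~ level M y.
  apply: contrapT => h; apply: xM; have /closed_nrmP := (level_closed T M).2; apply => e e0.
  have e2 : 0 < e / 2 by rewrite divr_gt0.
  apply: contrapT => h'; apply: h; exists (e / 2) => // y xy yM; apply: h'.
  by exists y => //; lra.
have [c [k [csa ksa [kc ck] xc hS]]] := cutdown xsa e0.
have [Dc Dk] := hS _ (hered_stable hD Dx).
have [cN kN] := hS _ (ideal_stable (level_closed T N) xN).
exists c; split=> //; first exact: he.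
split; first exact: orth_hereditary.
move=> M'; have [N' [d [Dd dsa dN' dM]]] := hinc (maxn M' N).
pose d' := d - k ** d - d ** k + k ** d ** k.
have sD := hered_sub hD; have Mkd := hered_mul hD Dk Dd; have Mdk := hered_mul hD Dd Dk.
have Mkdk := hered_mul hD Mkd Dk.
have kmax : level (maxn M' N) k by apply: level_mono kN; exact: leq_maxr.
have sl n := level_sub n.
exists N', d'; split.
- split.
  + by apply: subspaceD => //; apply: subspaceB => //; exact: subspaceB.
  + by rewrite /d' cmulDl !cmulBx -!cmulA !kc; abel.
  + by rewrite /d' cmulDr !cmulxB !cmulA ck; abel.
- by rewrite /sa /d' !(cstarD, cstarN, cstarM) ksa dsa !cmulA; abel.
- have [l1 l2] := level_mul k dN'; have [_ l3] := level_mul k l1.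
  apply: (subspaceD (sl N')) => //; apply: (subspaceB (sl N')) => //.
  exact: (subspaceB (sl N')).
- move=> d'M; apply: dM.
  have -> : d = d' + k ** d + d ** k - k ** d ** k by rewrite /d'; abel.
  have d'M2 : level (maxn M' N) d' by apply: level_mono d'M; exact: leq_maxl.
  have [_ l1] := level_mul d kmax; have [l2 _] := level_mul d kmax.
  have [_ l3] := level_mul k l1.
  apply: (subspaceB (sl _)) => //; apply: (subspaceD (sl _)) => //.
  exact: (subspaceD (sl _)).
Qed.

Lemma corner_unbounded k : sa k -> (forall n, exists2 x, unit_corner k x & ~ level n x) ->
  exists x, [/\ unit_corner k x, unbounded_ideal x & x <> 0].
Proof.
move=> ksa hlev; apply: contrapT => h.
have hinc : increasing_levels (unit_corner k).
  apply: essential_increasing_levels => //; first exact: unit_corner_hereditary.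
  by move=> x kx ux; apply: contrapT => x0; apply: h; exists x.
have [|c [ck csa cl co]] := @orthogonal_sequence _ _
    (fun D => hereditary D /\ increasing_levels D) (fun n c => ~ level (8 ^ n) c)
    (unit_corner k) _ (conj (unit_corner_hereditary ksa) hinc).
  by move=> n D [hD hi]; exact: increasing_levels_orth.
by have [n /cl] := no_orthogonal_levels ksa ck csa co.
Qed.

Lemma unbounded_minimal_projection : ~ (forall x, closure bounded_union x) ->
  exists p, [/\ sa p, p ** p = p, p <> 0, unbounded_ideal p &
    forall a, exists c : R[i], p ** a ** p = c *: p].
Proof.
move=> hcl.
have [b [k [bsa ksa [kb bk] bl]]] : exists b k,
    [/\ sa b, sa k, k ** b = b /\ b ** k = b & forall n, ~ level n b].
  apply: contrapT => h; apply: hcl; apply: subspace_local_units.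
  - apply: closure_subspace; split; first by exists 0%N; case: (level_sub 0).
    move=> c x y [m hx] [n hy]; exists (maxn m n).
    have [_ hD] := level_sub (maxn m n); apply: hD.
      by apply: level_mono hx; exact: leq_maxl.
    by apply: level_mono hy; exact: leq_maxr.
  - exact: closed_closure.
  - move=> y k ysa ksa ky yk; apply: contrapT => h'; apply: h; exists y, k; split=> // n yn.
    by apply: h'; apply: subset_closure; exists n.
have [|x [kx ux x0]] := corner_unbounded ksa; first by move=> n; exists b.
pose D0 := unit_corner k `&` unbounded_ideal.
have hD0 : hereditary D0.
  apply: hereditaryI; first exact: unit_corner_hereditary.
  exact: ideal_hereditary unbounded_ideal_closed.
(* Otherwise every nonzero hereditary subalgebra of [D0] splits, which produces an orthogonal
   sequence of nonzero elements with the common unit [k]. One of them lies in a level, and it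
   vanishes because it also lies in [unbounded_ideal]. *)
have [D [hD sD [y Dy y0] hmin]] : exists D, [/\ hereditary D, D `<=` D0,
    exists2 y, D y & y <> 0 &
    forall y z, D y -> D z -> sa y -> sa z -> y ** z = 0 -> y = 0 \/ z = 0].
  apply: contrapT => h.
  pose P D := [/\ hereditary D, D `<=` D0 & exists2 y, D y & y <> 0].
  have [||c [cD csa cn co]] := @orthogonal_sequence _ _ P (fun=> fun c => c <> 0) D0.
  - move=> n D [hD sD Dn0].
    have [y [z [Dy Dz [ysa zsa] [yz y0 z0]]]] : exists y z,
        [/\ D y, D z, sa y /\ sa z & [/\ y ** z = 0, y <> 0 & z <> 0]].
      apply: contrapT => h'; apply: h; exists D; split=> // y z Dy Dz ysa zsa yz.
      apply: contrapT => /not_orP[y0 z0]; apply: h'; exists y, z; split=> //.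
    exists y; split=> //; split; first exact: orth_hereditary.
      by move=> w [/sD].
    by exists z => //; split=> //; rewrite -ysa -zsa -cstarM yz cstar0.
  - by split=> //; exists x.
  have [|n hn] := no_orthogonal_levels ksa _ csa co; first by move=> n; have [] := cD n.
  by apply: (cn n); apply: unbounded_level0 hn; have [] := cD n.
have [p [Dp psa pp p0 hp]] := hered_minimal_projection hD Dy y0 hmin.
by exists p; split=> //; have [] := sD p Dp.
Qed.

End MinimalProjection.

(** * Orthonormal systems and compact operators *)

Section InnerProduct.
Variables (R : realType) (H : normedModType R[i]) (ip : H -> H -> R[i]).
Implicit Types (u v h e : H) (s : seq H) (c : R[i]).

(** Common interface for the dot product of a given Hilbert space and for the scalar product to be
    constructed on [A p]. *)
Record inner_product : Prop := InnerProduct {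
  ipP : forall c u v h, ip (c *: u + v) h = c * ip u h + ip v h ;
  ipC : forall u v, ip u v = conjc (ip v u) ;
  ip_nrm : forall u, ip u u = (nrm u ^+ 2)%:C }.

Hypothesis hip : inner_product.

Lemma ip0l h : ip 0 h = 0.
Proof. by have := ipP hip (-1) 0 0 h; rewrite scaler0 addr0 mulN1r addNr. Qed.

Lemma ipDl u v h : ip (u + v) h = ip u h + ip v h.
Proof. by have := ipP hip 1 u v h; rewrite scale1r mul1r. Qed.

Lemma ipZl c u h : ip (c *: u) h = c * ip u h.
Proof. by have := ipP hip c u 0 h; rewrite addr0 ip0l addr0. Qed.

Lemma ipNl u h : ip (- u) h = - ip u h.
Proof. by rewrite -scaleN1r ipZl mulN1r. Qed.

Lemma ipBl u v h : ip (u - v) h = ip u h - ip v h.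
Proof. by rewrite ipDl ipNl. Qed.

Lemma ip_suml J (r : seq J) (P : pred J) (F : J -> H) h :
  ip (\sum_(i <- r | P i) F i) h = \sum_(i <- r | P i) ip (F i) h.
Proof.
by elim/big_rec2: _ => [|i x y _ <-]; rewrite ?ip0l // ipDl.
Qed.

Lemma ip_eq0C u v : ip u v = 0 -> ip v u = 0.
Proof. by move=> h; rewrite (ipC hip) h rmorph0. Qed.

Lemma ipDr h u v : ip h (u + v) = ip h u + ip h v.
Proof. by rewrite (ipC hip) ipDl rmorphD /= -!(ipC hip). Qed.

Lemma ipBr h u v : ip h (u - v) = ip h u - ip h v.
Proof. by rewrite (ipC hip) ipBl rmorphB /= -!(ipC hip). Qed.

Lemma ipZr h c u : ip h (c *: u) = conjc c * ip h u.
Proof. by rewrite (ipC hip) ipZl rmorphM /= -(ipC hip). Qed.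

Lemma ip0r h : ip h 0 = 0. Proof. by rewrite (ipC hip) ip0l rmorph0. Qed.

Lemma pythagoras u v : ip u v = 0 -> nrm (u + v) ^+ 2 = nrm u ^+ 2 + nrm v ^+ 2.
Proof.
move=> uv; apply: complexI; rewrite rmorphD /= -!(ip_nrm hip) ipDl !ipDr uv (ip_eq0C uv).
by rewrite addr0 add0r.
Qed.

Lemma ip_norm_le u v : cabs (ip u v) <= nrm u * nrm v.
Proof.
have [->|v0] := pselect (v = 0); first by rewrite ip0r nrm0 mulr0 /cabs normr0.
have nv := nrm_gt0 v0.
have nz : (nrm v ^+ 2)%:C != 0 :> R[i] by rewrite fmorph_eq0 expf_neq0 // lt0r_neq0.
pose c := ip u v / (nrm v ^+ 2)%:C.
have o : ip (u - c *: v) (c *: v) = 0.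
  by rewrite ipZr ipBl ipZl (ip_nrm hip) /c mulfVK // subrr mulr0.
have := pythagoras o; rewrite subrK nrmZ => hp.
have : cabs c * nrm v <= nrm u.
  by rewrite -(ler_pXn2r (ltn0Sn 1)) ?nnegrE ?nrm_ge0 ?mulr_ge0 ?cabs_ge0 ?nrm_ge0 // hp lerDr sqr_ge0.
rewrite cabsM cabsV cabs_real ger0_norm ?sqr_ge0 // expr2 invfM mulrA mulfVK ?lt0r_neq0 //.
by rewrite ler_pdivrMr.
Qed.

Fixpoint orthonormal s : Prop := if s is e :: s' then
  [/\ nrm e = 1, forall f, f \in s' -> ip e f = 0 & orthonormal s'] else True.

Lemma orthonormal_ip s (a : H -> R[i]) e : orthonormal s -> e \in s ->
  ip (\sum_(f <- s) a f *: f) e = a e.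
Proof.
elim: s => //= u s IHs [u1 us os]; rewrite inE big_cons ipDl ipZl.
have [<- _|ue /= es] := eqVneq u e.
  rewrite (ip_nrm hip) u1 expr1n mulr1 ip_suml big_seq big1 ?addr0 // => f fs.
  by rewrite ipZl (ip_eq0C (us f fs)) mulr0.
by rewrite us // mulr0 add0r IHs //; move: es; rewrite eq_sym (negbTE ue).
Qed.

Definition proj s h : H := \sum_(e <- s) ip h e *: e.

Lemma proj_orth s h e : orthonormal s -> e \in s -> ip (h - proj s h) e = 0.
Proof. by move=> os es; rewrite ipBl orthonormal_ip // subrr. Qed.

Lemma proj_orth_nrm s h : orthonormal s -> nrm (h - proj s h) <= nrm h.
Proof.
move=> os; have o : ip (h - proj s h) (proj s h) = 0.
  rewrite (ipC hip) ip_suml big_seq big1 ?rmorph0 // => e es.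
  by rewrite ipZl (ip_eq0C (proj_orth h os es)) mulr0.
have := pythagoras o; rewrite subrK => hp.
by rewrite -(ler_pXn2r (ltn0Sn 1)) ?nnegrE ?nrm_ge0 // hp lerDl sqr_ge0.
Qed.

Definition orthonormal_seq (e : nat -> H) : Prop :=
  forall m n, ip (e m) (e n) = (m == n)%:R.

(** Greedy extension either stops at a finite maximal system or goes on forever. The infinite branch
    is what contradicts compactness or the gliding hump, or what carries the discontinuous form. *)
Lemma maximal_orthonormal (W : set H) :
  (exists s, [/\ orthonormal s, forall e, e \in s -> W e &
     forall u, W u -> nrm u = 1 -> ~ forall e, e \in s -> ip u e = 0]) \/
  (exists e : nat -> H, orthonormal_seq e /\ forall n, W (e n)).
Proof.
pose good s u := [/\ W u, nrm u = 1 & forall e, e \in s -> ip u e = 0].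
pose step s := xget 0 (good s).
pose ss := fix ss n := if n is n'.+1 then step (ss n') :: ss n' else [::].
pose ons s := orthonormal s /\ forall e, e \in s -> W e.
have [hg|/existsNP hg] := pselect (forall n, good (ss n) (step (ss n))).
  right; exists (fun n => step (ss n)); split; last by move=> n; have [] := hg n.
  have mem m n : (n < m)%N -> step (ss n) \in ss m.
    elim: m => //= m IHm; rewrite ltnS leq_eqVlt inE => /orP[/eqP -> |/IHm ->].
      by rewrite eqxx.
    by rewrite orbT.
  move=> m n; case: ltngtP => [mn|mn|->].
  - have [_ _ h] := hg n; exact: ip_eq0C (h _ (mem _ _ mn)).
  - by have [_ _ h] := hg m; exact: h (mem _ _ mn).
  - by have [_ h _] := hg n; rewrite (ip_nrm hip) h expr1n.
left; have hs n : ons (ss n) \/ exists m, ons (ss m) /\ ~ good (ss m) (step (ss m)).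
  elim: n => [|n [IHn|]]; [by left; split|..|by right].
  have [[Wu u1 us]|h] := pselect (good (ss n) (step (ss n))); last by right; exists n.
  left; split; first by case: IHn.
  by move=> e; rewrite inE => /orP[/eqP ->//|]; case: IHn => _; exact.
have [m [[os Ws] ng]] : exists m, ons (ss m) /\ ~ good (ss m) (step (ss m)).
  by have [n hn] := hg; have [|//] := hs n; exists n.
exists (ss m); split=> // u Wu u1 us; apply: ng.
by apply: (@xgetPex _ 0); exists u.
Qed.

Lemma orthonormal_basis (V : set H) : V 0 -> (forall c u v, V u -> V v -> V (c *: u + v)) ->
  (exists s, (forall e, e \in s -> V e) /\ forall h, V h -> h = proj s h) \/
  (exists e : nat -> H, orthonormal_seq e /\ forall n, V (e n)).
Proof.
move=> V0 VD; have [[s [os sV hs]]|] := maximal_orthonormal V; last by right.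
left; exists s; split=> // h Vh; apply/eqP; rewrite -subr_eq0; apply/eqP.
apply: contrapT => r0; set r := h - proj s h in r0.
have Vr : V r.
  rewrite /r addrC -scaleN1r; apply: (VD (-1) (proj s h) h) => //; rewrite /proj big_seq.
  elim/big_ind: _ => // [x y Vx Vy|e es]; first by rewrite -[x]scale1r; exact: VD.
  by rewrite -[_ *: _]addr0; apply: (VD) => //; exact: sV.
have nr := nrm_gt0 r0.
apply: (hs ((nrm r)^-1%:C *: r)).
- by rewrite -[_ *: _]addr0; exact: VD.
- by rewrite nrmZ cabs_real gtr0_norm ?invr_gt0 // mulVf ?lt0r_neq0.
- by move=> e es; rewrite ipZl proj_orth // mulr0.
Qed.

Lemma orthonormal_seq_dist (e : nat -> H) m n : orthonormal_seq e -> m != n -> nrm (e m - e n) ^+ 2 = 2.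
Proof.
move=> oe mn; apply: complexI; rewrite -(ip_nrm hip) ipBl !ipBr !oe !eqxx (negbTE mn).
by rewrite eq_sym (negbTE mn) subr0 sub0r opprK -[2]natr1 rmorphD.
Qed.

Lemma orthonormal_seq_sum (e : nat -> H) (g : nat -> nat) N : orthonormal_seq e -> injective g ->
  nrm (\sum_(j < N) e (g j)) ^+ 2 = N%:R.
Proof.
move=> oe ig; elim: N => [|N IHN]; first by rewrite big_ord0 nrm0 expr0n.
rewrite big_ord_recr /= pythagoras ?IHN.
  have -> : nrm (e (g N)) ^+ 2 = 1 by apply: complexI; rewrite -(ip_nrm hip) oe eqxx.
  by rewrite natr1.
rewrite ip_suml big1 // => j _; rewrite oe; case: eqP => // /ig jN.
by have := ltn_ord j; rewrite jN ltnn.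
Qed.

End InnerProduct.

(** * Total boundedness and finite rank approximation *)

Section CompactOperators.
Variables (R : realType) (H : completeNormedModType R[i]).
Implicit Types (f : H -> H) (S : set H).

Lemma precompact_cluster S (u : nat -> H) : precompact S -> (forall n, S (u n)) ->
  exists y, forall (e : R) N, 0 < e -> exists2 n, (N <= n)%N & nrm (u n - y) < e.
Proof.
rewrite precompactE => cS Su.
have [|y [_ hy]] := cS (u @ \oo) _.
  by exists 0%N => // n _; exact: subset_closure.
exists y => e N e0.
have [||x [[n Nn <-] hn]] := hy (u @` [set n | (N <= n)%N]) [set x | nrm (y - x) < e].
- by exists N => // n Nn; exists n.
- by apply: open_nbhs_nbhs; split; [exact: open_nrm_ball|rewrite /= subrr nrm0].
by exists n => //; rewrite nrmBC.
Qed.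

Definition totally_bounded S : Prop := forall e : R, 0 < e ->
  exists L : seq H, forall x, S x -> exists2 c, c \in L & nrm (x - c) <= e.

(** An ultrafilter picks one ball out of every finite cover, hence is Cauchy. *)
Lemma totally_bounded_precompact S : totally_bounded S -> precompact S.
Proof.
move=> tb; rewrite precompactE compact_ultra => F uF FS.
have hF (e : R) : 0 < e -> exists c : H, F [set x | nrm (x - c) < e].
  move=> e0; have e2 : 0 < e / 2 by rewrite divr_gt0.
  have [L hL] := tb _ e2.
  have : F [set x | exists2 c, c \in L & nrm (x - c) < e].
    apply: filterS FS => x /closure_nrmP/(_ _ e2)[y Sy xy].
    have [c cL yc] := hL y Sy; exists c => //=.
    by have := nrm_triangle y x c; lra.
  elim: (L) => [|c L' IHL] FU.
    by exfalso; apply: (@filter_not_empty _ F); apply: filterS FU => x [].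
  have [Fc|Fc] := in_ultra_setVsetC [set x | nrm (x - c) < e] uF; first by exists c.
  apply: IHL; apply: filterS (filterI FU Fc) => x [[c' /= cL hc] hx].
  by move: cL; rewrite inE => /orP[/eqP cc|cL]; [case: hx; rewrite -cc|exists c'].
have cF : cauchy F.
  apply/cauchy_ballP => e e0; move: e0; rewrite ltcE => /andP[/eqP ei er].
  have e2 : 0 < complex.Re e / 2 by rewrite divr_gt0.
  have [c Fc] := hF _ e2.
  exists ([set x | nrm (x - c) < complex.Re e / 2], [set x | nrm (x - c) < complex.Re e / 2]) => //.
  move=> [a b] /= [ha hb]; rewrite -ball_normE /= norm_nrm ltcE /= ei eqxx /=.
  by have := nrm_triangle c a b; rewrite (nrmBC c b); lra.
have cF' : cvg F by exact/cauchy_cvgP.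
move: cF' => /cvg_ex[y Fy].
exists y; split=> //.
have : closure (closure S) y by move=> B /Fy FB; have [x [? ?]] := filter_ex (filterI FS FB); exists x.
by rewrite -(closure_id _).1 //; exact: closed_closure.
Qed.

Lemma totally_boundedS S S' : S `<=` S' -> totally_bounded S' -> totally_bounded S.
Proof. by move=> SS h e /h[L hL]; exists L => x /SS /hL. Qed.

Lemma totally_boundedD S S' : totally_bounded S -> totally_bounded S' ->
  totally_bounded [set x | exists y z, [/\ S y, S' z & x = y + z]].
Proof.
move=> h h' e e0; have e2 : 0 < e / 2 by rewrite divr_gt0.
have [L hL] := h _ e2; have [L' hL'] := h' _ e2.
exists [seq a + b | a <- L, b <- L'] => x [y [z [/hL[a aL ya] /hL'[b bL zb] ->]]].
exists (a + b); first exact: allpairs_f.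
have -> : y + z - (a + b) = (y - a) + (z - b) by abel.
by have := nrmD (y - a) (z - b); lra.
Qed.

Lemma totally_bounded_real_line (a : H) (C : R) :
  totally_bounded [set x | exists2 r : R, `|r| <= C & x = r%:C *: a].
Proof.
move=> e e0; have a0 : 0 < nrm a + 1 by rewrite ltr_wpDl ?nrm_ge0.
pose d := e / (nrm a + 1); have d0 : 0 < d by rewrite divr_gt0.
pose k (r : R) := Num.truncn ((r + C) / d).
exists [seq (d * n%:R - C)%:C *: a | n <- iota 0 (k C).+1] => x [r rC ->].
have rC0 : 0 <= (r + C) / d.
  by rewrite divr_ge0 ?(ltW d0) //; move: rC; rewrite ler_norml => /andP[h _]; lra.
have /andP[k1 k2] := truncn_itv rC0.
exists ((d * (k r)%:R - C)%:C *: a).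
  apply/mapP; exists (k r) => //; rewrite mem_iota add0n /= -(ltr_nat R).
  apply: (le_lt_trans k1); apply: le_lt_trans (Num.Theory.truncnS_gt _).
  by rewrite ler_pM2r ?invr_gt0 // lerD2r (le_trans (ler_norm r)).
rewrite -scalerBl -rmorphB nrmZ cabs_real.
move: k1 k2; rewrite -/(k r) ler_pdivlMr // ltr_pdivrMr // => k1 k2.
have : `|r - (d * (k r)%:R - C)| <= d.
  by rewrite ler_norml; apply/andP; rewrite -natr1 in k2; split; lra.
move=> h; apply: (@le_trans _ _ (d * nrm a)); first by rewrite ler_wpM2r ?nrm_ge0.
by rewrite /d mulrAC ler_pdivrMr // ler_wpM2l ?(ltW e0) // lerDl ler01.
Qed.

Lemma totally_bounded_line (a : H) (C : R) :
  totally_bounded [set x | exists2 c : R[i], cabs c <= C & x = c *: a].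
Proof.
have h := totally_boundedD (totally_bounded_real_line a C)
  (totally_bounded_real_line ('i *: a) C).
apply: totally_boundedS h => x [c cC ->].
have hRe (z : R[i]) : `|complex.Re z| <= cabs z.
  by rewrite -lecR -norm_cabs; exact: normc_ge_Re.
exists ((complex.Re c)%:C *: a), ((complex.Im c)%:C *: ('i *: a)); split.
- by exists (complex.Re c) => //; exact: le_trans (hRe c) cC.
- exists (complex.Im c) => //; apply: le_trans cC.
  have -> : `|complex.Im c| = `|complex.Re (c * 'i)|.
    by case: c => x1 y1 /=; rewrite mulr0 mulr1 sub0r normrN.
  by apply: (le_trans (hRe _)); rewrite cabsM /cabs normc_def /= expr0n add0r expr1n sqrtr1 mulr1.
- by rewrite scalerA -scalerDl {1}[c]complexE mulrC.
Qed.

Lemma totally_bounded_approx S :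
  (forall e : R, 0 < e -> exists S', totally_bounded S' /\
     forall x, S x -> exists2 y, S' y & nrm (x - y) <= e) -> totally_bounded S.
Proof.
move=> h e e0; have e2 : 0 < e / 2 by rewrite divr_gt0.
have [S' [/(_ _ e2)[L hL] hS]] := h _ e2; exists L => x /hS[y /hL[c cL yc] xy].
by exists c => //; have := nrm_triangle y x c; lra.
Qed.

Lemma totally_bounded_sum (g : H -> H -> R[i]) (a : H -> H) (C : H -> R) (s : seq H) (S : set H) :
  (forall h e, S h -> cabs (g h e) <= C e) ->
  totally_bounded ((fun h => \sum_(e <- s) g h e *: a e) @` S).
Proof.
move=> hg; elim: s => [|e s IHs].
  move=> d d0; exists [:: 0] => x [h _ <-]; exists 0; first by rewrite inE.
  by rewrite big_nil subrr nrm0 ltW.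
apply: totally_boundedS (totally_boundedD (totally_bounded_line (a e) (C e)) IHs).
move=> x [h Sh <-]; exists (g h e *: a e), (\sum_(f <- s) g h f *: a f).
by split; [exists (g h e) => //; exact: hg|exists h|rewrite big_cons].
Qed.

Lemma compact_operator_bounded f : compact_operators H f ->
  exists2 C, 0 < C & forall h, nrm (f h) <= C * nrm h.
Proof.
move=> [lf cf]; have fZ (c : R[i]) h : f (c *: h) = c *: f h.
  have f0 : f 0 = 0 by have := lf (-1) 0 0; rewrite scaler0 addr0 scaleN1r addNr.
  by have := lf c h 0; rewrite addr0 f0 addr0.
apply: contrapT => hC.
have /choice[u hu] : forall n : nat, exists u, nrm u <= 1 /\ n%:R < nrm (f u).
  move=> n; apply: contrapT => h; apply: hC; exists n.+1%:R => // v.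
  have [->|v0] := pselect (v = 0).
    by have := fZ 0 0; rewrite !scale0r => ->; rewrite nrm0 mulr0.
  have nv := nrm_gt0 v0; rewrite leNgt; apply/negP => hv; apply: h.
  exists ((nrm v)^-1%:C *: v); rewrite fZ !nrmZ cabs_real gtr0_norm ?invr_gt0 //.
  rewrite mulVf ?lt0r_neq0 //; split=> //.
  rewrite ltr_pdivlMl //; apply: le_lt_trans hv.
  by rewrite mulrC ler_wpM2r ?nrm_ge0 // ler_nat.
have [n|y hy] := precompact_cluster cf (u := fun n => f (u n)).
  by exists (u n) => //=; rewrite norm_nrm (lecR _ 1); have [] := hu n.
have [n hn /= un] := hy 1 (Num.truncn (nrm y + 1)).+1 ltr01.
have [_ h] := hu n; have := nrm_dist (f (u n)) y.
have : nrm y + 1 < n%:R by apply: lt_le_trans (Num.Theory.truncnS_gt _) _; rewrite ler_nat.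
by lra.
Qed.

End CompactOperators.

Section InnerProductCompact.
Variables (R : realType) (H : completeNormedModType R[i]) (ip : H -> H -> R[i]).
Hypothesis hip : inner_product ip.
Implicit Types (f : H -> H) (u v h : H) (s : seq H).

Lemma compact_operatorP f : compact_operators H f ->
  forall (c : R[i]) u v, f (c *: u + v) = c *: f u + f v.
Proof. by move=> [lf _]. Qed.

Lemma compact_operator0 f : compact_operators H f -> f 0 = 0.
Proof.
by move/compact_operatorP => /(_ (-1) 0 0); rewrite scaler0 addr0 scaleN1r addNr.
Qed.

Lemma compact_operatorZ f (c : R[i]) u : compact_operators H f -> f (c *: u) = c *: f u.
Proof.
move=> cf; have := compact_operatorP cf c u 0.
by rewrite (compact_operator0 cf) !addr0.
Qed.

Lemma compact_operator_sum f J (r : seq J) (F : J -> H) : compact_operators H f ->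
  f (\sum_(i <- r) F i) = \sum_(i <- r) f (F i).
Proof.
move=> cf; elim: r => [|i r IHr]; first by rewrite !big_nil compact_operator0.
by rewrite !big_cons -[F i]scale1r (compact_operatorP cf) !scale1r IHr.
Qed.

Lemma unit_ball1 u : [set u : H | `|u| <= 1] u = (nrm u <= 1).
Proof. by rewrite /= norm_nrm (lecR _ 1). Qed.

Lemma compact_operator_cluster f (u : nat -> H) : compact_operators H f ->
  (forall n, nrm (u n) <= 1) ->
  exists y, forall (e : R) N, 0 < e -> exists2 n, (N <= n)%N & nrm (f (u n) - y) < e.
Proof.
move=> [_ cf] u1; apply: (precompact_cluster cf (u := fun n => f (u n))) => n.
by exists (u n) => //; rewrite unit_ball1.
Qed.

Lemma orthonormal_seq_nrm (e : nat -> H) n : orthonormal_seq ip e -> nrm (e n) = 1.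
Proof.
move=> oe; have : nrm (e n) ^+ 2 = 1 by apply: complexI; rewrite -(ip_nrm hip) oe eqxx.
by move/eqP; rewrite sqrf_eq1 => /orP[/eqP//|/eqP h]; have := nrm_ge0 (e n); rewrite h ler0N1.
Qed.

(** Orthonormal vectors are at distance [sqrt 2] from each other, so the images of infinitely many
    fixed ones would have no cluster point. *)
Lemma compact_operator_fixed f : compact_operators H f ->
  exists s, forall h, f h = h -> h = proj ip s h.
Proof.
move=> cf; have [||[s [_ hs]]|[e [oe fe]]] := orthonormal_basis hip (V := [set h | f h = h]).
- exact: compact_operator0.
- by move=> c u v /= fu fv; rewrite (compact_operatorP cf) fu fv.
- by exists s.
have [|y hy] := compact_operator_cluster (u := e) cf.
  by move=> n; rewrite (orthonormal_seq_nrm n oe).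
have h2 : 0 < (1 / 2 : R) by lra.
have [m _ hm] := hy _ 0%N h2; have [n mn hn] := hy _ m.+1 h2.
rewrite !fe in hm hn.
have := orthonormal_seq_dist hip oe (negbT (ltn_eqF mn)).
have := nrm_triangle y (e m) (e n); rewrite (nrmBC y) => h3.
have : nrm (e m - e n) < 1 by lra.
have := nrm_ge0 (e m - e n); nra.
Qed.

(** A maximal orthonormal system of vectors with [|f e| > ep] is finite: otherwise infinitely many
    images lie within [ep / 2] of some [y] with [|y| >= ep], and the sum of [N] of them has norm at
    least [N ep / 2], but also at most [C sqrt N]. On the complement of a finite maximal system [f]
    is bounded by [ep]. *)
Lemma compact_operator_approx f (ep : R) : compact_operators H f -> 0 < ep ->
  exists s, forall h, nrm (f h - \sum_(e <- s) ip h e *: f e) <= ep * nrm h.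
Proof.
move=> cf ep0.
have [[s [os _ hs]]|[e [oe fe]]] := maximal_orthonormal hip [set u | ep < nrm (f u)].
  exists s => h; have -> : f h - \sum_(e <- s) ip h e *: f e = f (h - proj ip s h).
    rewrite -scaleN1r addrC -[in RHS](scaleN1r (proj ip s h)) [in RHS]addrC (compact_operatorP cf).
    congr (_ *: _ + _); rewrite (compact_operator_sum _ _ cf).
    by apply: eq_bigr => e _; rewrite compact_operatorZ.
  set r := h - _; apply: (@le_trans _ _ (ep * nrm r)); last first.
    by rewrite ler_wpM2l ?(ltW ep0) //; exact: proj_orth_nrm.
  have [->|r0] := pselect (r = 0).
    by rewrite compact_operator0 // nrm0 mulr0.
  have nr := nrm_gt0 r0; rewrite leNgt; apply/negP => hr.
  apply: (hs ((nrm r)^-1%:C *: r)) => /=.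
  - rewrite compact_operatorZ // nrmZ cabs_real gtr0_norm ?invr_gt0 //.
    by rewrite ltr_pdivlMl // mulrC.
  - by rewrite nrmZ cabs_real gtr0_norm ?invr_gt0 // mulVf ?lt0r_neq0.
  - by move=> e es; rewrite ipZl // proj_orth // mulr0.
have e1 n := orthonormal_seq_nrm n oe.
have [|y hy] := compact_operator_cluster (u := e) cf; first by move=> n; rewrite e1.
have ny : ep <= nrm y.
  apply/ler_addgt0Pl => d d0; have [n _ hn] := hy _ 0%N d0.
  have := nrm_dist (f (e n)) y; have /= := fe n; lra.
have e2 : 0 < ep / 2 by rewrite divr_gt0.
have /choice[g hg] : forall N, exists n, (N <= n)%N /\ nrm (f (e n) - y) < ep / 2.
  by move=> N; have [n hn hn'] := hy _ N e2; exists n.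
pose k := fix k j := if j is j'.+1 then g (k j').+1 else g 0%N.
have kS j : (k j < k j.+1)%N by have [] := hg (k j).+1.
have kmono i j : (i < j)%N -> (k i < k j)%N.
  elim: j => // j IHj; rewrite ltnS leq_eqVlt => /orP[/eqP -> //|/IHj h].
  exact: ltn_trans h (kS j).
have kinj : injective k.
  by move=> i j kij; case: (ltngtP i j) => // /kmono; rewrite kij ltnn.
have ky j : nrm (f (e (k j)) - y) < ep / 2 by case: j => [|j]; [have [] := hg 0%N|have [] := hg (k j).+1].
have [C C0 hC] := compact_operator_bounded cf.
have key N : N%:R * (ep / 2) <= C * nrm (\sum_(j < N) e (k j)).
  apply: le_trans (hC _); rewrite (compact_operator_sum _ _ cf).
  have : nrm (N%:R *: y - \sum_(j < N) f (e (k j))) <= N%:R * (ep / 2).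
    have -> : N%:R *: y = \sum_(j < N) y by rewrite sumr_const card_ord scaler_nat.
    rewrite -sumrB; apply: (le_trans (nrm_sum _ _ _)).
    apply: (@le_trans _ _ (\sum_(j < N) (ep / 2))).
      by apply: ler_sum => j _; rewrite nrmBC ltW.
    by rewrite sumr_const card_ord mulr_natl.
  have := nrm_dist (N%:R *: y) (\sum_(j < N) f (e (k j))).
  have -> : nrm (N%:R *: y) = N%:R * nrm y.
    by rewrite nrmZ -(rmorph_nat (real_complex R)) cabs_real ger0_norm.
  have : N%:R * ep <= N%:R * nrm y by rewrite ler_wpM2l.
  by lra.
pose N := (Num.truncn ((2 * C / ep) ^+ 2)).+1.
have hN : (2 * C / ep) ^+ 2 < N%:R by exact: Num.Theory.truncnS_gt.
have := key N; have := orthonormal_seq_sum hip N oe kinj.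
have := nrm_ge0 (\sum_(j < N) e (k j)); move: (nrm _) => t t0 tN ht.
have N0 : 0 < N%:R :> R by rewrite ltr0n.
rewrite -tN in ht hN N0; have t1 : 0 < t by rewrite lt_def t0 andbT; apply: contraTneq N0 => ->; rewrite expr0n ltxx.
have : t * (ep / 2) <= C by move: ht; rewrite expr2 -mulrA [C * t]mulrC ler_pM2l.
move=> h; have : t <= 2 * C / ep by rewrite ler_pdivlMr //; lra.
have : 2 * C / ep < t by rewrite -(ltr_pXn2r (ltn0Sn 1)) // nnegrE ?(ltW t1) // divr_ge0 ?mulr_ge0 // ltW.
lra.
Qed.

Lemma rank_one_compact (g : H -> R[i]) (C : R) (w : H) :
  (forall c u v, g (c *: u + v) = c * g u + g v) ->
  (forall h, cabs (g h) <= C * nrm h) -> compact_operators H (fun h => g h *: w).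
Proof.
move=> gl gC; split; first by move=> c u v; rewrite gl scalerDl scalerA.
apply: totally_bounded_precompact.
apply: totally_boundedS (totally_bounded_line w `|C|) => x [h]; rewrite unit_ball1 => h1 <-.
exists (g h) => //; apply: (le_trans (gC h)); apply: (@le_trans _ _ (`|C| * nrm h)).
  by rewrite ler_wpM2r ?nrm_ge0 // ler_norm.
by rewrite ler_piMr.
Qed.

Lemma ip_injl u v : (forall h, ip u h = ip v h) -> u = v.
Proof.
move=> h; apply/eqP; rewrite -subr_eq0; apply/eqP/nrm_eq0/eqP.
rewrite -sqrf_eq0; apply/eqP/complexI; rewrite -(ip_nrm hip) (ipBl hip).
by rewrite h subrr.
Qed.

End InnerProductCompact.

Lemma hilbert_inner_product (R : realType) (H : completeNormedModType R[i])
  (dot : {dot H for Num.conj}) : hilbert_dot dot -> inner_product dot.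
Proof.
move=> hd; split.
- move=> c u v h; exact: (linearPl dot).
- by move=> u v; rewrite (hermitian_subproof (s := dot)) expr0 mul1r.
- by move=> u; rewrite -hd norm_nrm rmorphXn.
Qed.

(** * Extension of linear forms *)

Section LinearExtension.
Variables (K : fieldType) (H : lmodType K).
Implicit Types (G X : set (H * K)).

Definition linear_graph G : Prop :=
  [/\ G (0, 0), forall c u a v b, G (u, a) -> G (v, b) -> G (c *: u + v, c * a + b) &
      forall a, G (0, a) -> a = 0].

Lemma linear_extension G : linear_graph G -> exists f : H -> K,
  (forall c u v, f (c *: u + v) = c * f u + f v) /\ forall u a, G (u, a) -> f u = a.
Proof.
move=> hG.
(* Adjoining [G] inside the predicate makes the empty chain harmless: its union is empty, but joined
   with [G] it is a linear graph. *)
have [F FP Ftot|X [[X0 XD Xf] maxX]] := @Zorn_bigcup _ (fun X => linear_graph (X `|` G)).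
  have [G0 GD Gf] := hG.
  have pair p q : ((\bigcup_(X in F) X) `|` G) p -> ((\bigcup_(X in F) X) `|` G) q ->
      exists Y, [/\ linear_graph Y, Y `<=` (\bigcup_(X in F) X) `|` G, Y p & Y q].
    have sub X : F X -> X `|` G `<=` (\bigcup_(X in F) X) `|` G.
      by move=> FX r [Xr|Gr]; [left; exists X|right].
    move=> [[X FX Xp]|Gp] [[X' FX' Xq]|Gq].
    - have [XX|XX] := Ftot X X' FX FX'.
        by exists (X' `|` G); split; [exact: FP|exact: sub|left; exact: XX|left].
      by exists (X `|` G); split; [exact: FP|exact: sub|left|left; exact: XX].
    - by exists (X `|` G); split; [exact: FP|exact: sub|left|right].
    - by exists (X' `|` G); split; [exact: FP|exact: sub|right|left].
    - by exists G; split=> // r Gr; right.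
  split; first by right.
    move=> c u a v b hu hv; have [Y [[_ YD _] sY Yu Yv]] := pair _ _ hu hv.
    by apply: sY; exact: YD.
  by move=> a ha; have [Y [[_ _ Yf] _ Ya _]] := pair _ _ ha ha; exact: Yf.
set Y := X `|` G in X0 XD Xf.
have total v : exists b, Y (v, b).
  apply: contrapT => nv.
  (* The extension takes the value zero at [v]. *)
  pose Z : set (H * K) := [set p | exists u c b, [/\ Y (u, b) & p = (u + c *: v, b)]].
  have XZ : Y `<=` Z by move=> [u b] Yu; exists u, 0, b; rewrite scale0r addr0.
  have ZG : Z `|` G = Z.
    by apply/seteqP; split=> p; [case=> // Gp; apply: XZ; right|left].
  apply: (maxX Z); last first.
    rewrite ZG; split; first exact: XZ.
      move=> c _ _ _ _ [u [d [a [Yu [-> ->]]]]] [w [d' [b [Yw [-> ->]]]]].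
      exists (c *: u + w), (c * d + d'), (c * a + b); split; first exact: XD.
      by congr pair; rewrite scalerDr scalerDl scalerA; abel.
    move=> a [u [c [b [Yu [/esym/eqP + ->]]]]].
    have [->|c0] := eqVneq c 0.
      by rewrite scale0r addr0 => /eqP u0; apply: Xf; rewrite -u0.
    rewrite addr_eq0 => /eqP uv; exfalso; apply: nv; exists (- c^-1 * b).
    have := XD (- c^-1) u b 0 0 Yu X0; rewrite !addr0 uv scalerN scaleNr opprK scalerA.
    by rewrite mulVf // scale1r.
  split; first by move=> p Xp; apply: XZ; left.
  move=> ZX; apply: nv; exists 0; left; apply: ZX; exists 0, 1, 0.
  by rewrite add0r scale1r.
have [f hf] := choice total; have fE u a : Y (u, a) -> f u = a.
  move=> Yu; apply/eqP; rewrite -subr_eq0; apply/eqP/Xf.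
  have := XD (-1) u a u (f u) Yu (hf u).
  by rewrite scaleN1r mulN1r addNr addrC.
exists f; split=> [c u v|u a Gu]; last by apply: fE; right.
by apply: fE; exact: XD.
Qed.

End LinearExtension.

(** * An unbounded quasi-centralizer from an elementary summand *)

Lemma finite_dimensional_seq (R : realType) (A : cstarAlgType R) (I : set A) J (r : seq J) (g : A -> J -> R[i]) (B : J -> A) :
  (forall j, I (B j)) -> (forall x, I x -> x = \sum_(j <- r) g x j *: B j) ->
  finite_dimensional I.
Proof.
move=> BI hB; exists (size r), (fun k => B (tnth (in_tuple r) k)); split=> [k|x Ix] //.
by exists (fun k => g x (tnth (in_tuple r) k)); rewrite {1}(hB x Ix) big_tnth.
Qed.

Section ElementarySummand.
Variables (R : realType) (A : cstarAlgType R) (A0 A1 : set A).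
Variables (H : completeNormedModType R[i]) (dot : {dot H for Num.conj}).
Variable phi : A -> H -> H.
Hypothesis hdec : direct_sum_decomposition A0 A1.
Hypothesis hdot : hilbert_dot dot.
Hypothesis hphi : star_isomorphism_compact_operators A1 dot phi.
Local Notation K := (pedersen_ideal A).
Implicit Types (x y z a t : A) (u v w h e : H) (c : R[i]).

Let hip : inner_product dot := hilbert_inner_product hdot.
Let hA0 : closed_two_sided_ideal A0. Proof. by case: hdec. Qed.
Let hA1 : closed_two_sided_ideal A1. Proof. by case: hdec. Qed.
Let sub0 : Defs.subspace A0. Proof. by have [[]] := hA0. Qed.
Let sub1 : Defs.subspace A1. Proof. by have [[]] := hA1. Qed.

Lemma summand_disjoint x : A0 x -> A1 x -> x = 0.
Proof. by move=> h0 h1; have [_ _ h _] := hdec; have : (A0 `&` A1) x by []; rewrite h. Qed.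

Definition summand_proj x : A := xget 0 [set y | A1 y /\ A0 (x - y)].
Local Notation pr := summand_proj.

Lemma summand_projP x : A1 (pr x) /\ A0 (x - pr x).
Proof.
apply: (@xgetPex _ 0 [set y | A1 y /\ A0 (x - y)]).
have [_ _ _ /(_ x)[x0 [x1 [h0 h1 ->]]]] := hdec.
by exists x1; split=> //; rewrite addrK.
Qed.

Lemma summand_proj_uniq x y : A1 y -> A0 (x - y) -> pr x = y.
Proof.
move=> y1 y0; have [p1 p0] := summand_projP x; apply/eqP; rewrite -subr_eq0; apply/eqP.
apply: summand_disjoint; last exact: subspaceB.
have -> : pr x - y = (x - y) - (x - pr x) by abel.
exact: subspaceB.
Qed.

Lemma summand_proj_id y : A1 y -> pr y = y.
Proof. by move=> y1; apply: summand_proj_uniq => //; rewrite subrr; case: sub0. Qed.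

Lemma summand_proj_linear c x y : pr (c *: x + y) = c *: pr x + pr y.
Proof.
have [x1 x0] := summand_projP x; have [y1 y0] := summand_projP y.
apply: summand_proj_uniq; first by apply: sub1.2.
have -> : c *: x + y - (c *: pr x + pr y) = c *: (x - pr x) + (y - pr y).
  by rewrite scalerBr; abel.
exact: sub0.2.
Qed.

Lemma summand_projM x y : pr (x ** y) = pr x ** pr y.
Proof.
have [x1 x0] := summand_projP x; have [y1 y0] := summand_projP y.
apply: summand_proj_uniq; first by have [] := ideal_mul (pr x) hA1 y1.
have -> : x ** y - pr x ** pr y = (x - pr x) ** y + pr x ** (y - pr y).
  by rewrite cmulBx cmulxB; abel.
by apply: subspaceD => //; [have [] := ideal_mul y hA0 x0|have [] := ideal_mul (pr x) hA0 y0].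
Qed.

Lemma summand_proj_mull a t : A1 t -> a ** t = pr a ** t.
Proof.
move=> t1; have [_ h] := summand_projP (a ** t).
by rewrite -{2}(summand_proj_id t1) -summand_projM summand_proj_id //; have [] := ideal_mul a hA1 t1.
Qed.

Lemma summand_proj_mulr a t : A1 t -> t ** a = t ** pr a.
Proof.
move=> t1; rewrite -{2}(summand_proj_id t1) -summand_projM summand_proj_id //.
by have [] := ideal_mul a hA1 t1.
Qed.

Lemma phi_compact x : A1 x -> compact_operators H (phi x).
Proof. by move=> x1; have [[h _ _] _ _ _] := hphi; exact: h. Qed.

Lemma phi_inj x y : A1 x -> A1 y -> phi x =1 phi y -> x = y.
Proof.
move=> x1 y1 xy; have [[_ h _] _ _ _] := hphi.
by apply: h; rewrite ?inE //; apply/funext.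
Qed.

Lemma phi_linear c x y h : A1 x -> A1 y -> phi (c *: x + y) h = c *: phi x h + phi y h.
Proof. by move=> x1 y1; have [_ hl _ _] := hphi; rewrite (hl c x y x1 y1). Qed.

Lemma phiM x y h : A1 x -> A1 y -> phi (x ** y) h = phi x (phi y h).
Proof. by move=> x1 y1; have [_ _ hm _] := hphi; rewrite (hm x y x1 y1). Qed.

Lemma phi0 h : phi 0 h = 0.
Proof.
have := phi_linear (-1) h sub1.1 sub1.1.
by rewrite scaler0 addr0 scaleN1r addNr.
Qed.

Lemma phiZ c x h : A1 x -> phi (c *: x) h = c *: phi x h.
Proof.
by move=> x1; have := phi_linear c h x1 sub1.1; rewrite phi0 !addr0.
Qed.

Lemma phi_sum J (r : seq J) (g : J -> R[i]) (E : J -> A) h : (forall j, A1 (E j)) ->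
  phi (\sum_(j <- r) g j *: E j) h = \sum_(j <- r) g j *: phi (E j) h.
Proof.
move=> E1; elim: r => [|j r IHr]; first by rewrite !big_nil phi0.
rewrite !big_cons phi_linear ?IHr //; apply: subspace_sum => // i.
exact: subspaceZ.
Qed.

Definition operator_elt (f : H -> H) : A := xget 0 [set x | A1 x /\ phi x = f].

Lemma operator_eltP f : compact_operators H f ->
  A1 (operator_elt f) /\ phi (operator_elt f) =1 f.
Proof.
move=> cf; have [[_ _ h] _ _ _] := hphi.
have [x x1 xf] := h f cf.
have [] := @xgetPex _ (0 : A) [set x | A1 x /\ phi x = f]; first by exists x.
by move=> h1 h2; split=> // u; rewrite h2.
Qed.

Definition summand_op x : H -> H := phi (pr x).
Local Notation F := summand_op.

Lemma op_compact x : compact_operators H (F x).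
Proof. by apply: phi_compact; have [] := summand_projP x. Qed.

Lemma op_linear c x y h : F (c *: x + y) h = c *: F x h + F y h.
Proof.
rewrite /F summand_proj_linear phi_linear //; first by have [] := summand_projP x.
by have [] := summand_projP y.
Qed.

Lemma opM x y h : F (x ** y) h = F x (F y h).
Proof.
rewrite /F summand_projM phiM //; first by have [] := summand_projP x.
by have [] := summand_projP y.
Qed.

Lemma op0 h : F 0 h = 0.
Proof. by have := op_linear (-1) 0 0 h; rewrite scaler0 addr0 scaleN1r addNr. Qed.

Lemma op_phi x h : A1 x -> F x h = phi x h.
Proof. by move=> x1; rewrite /F summand_proj_id. Qed.

Definition linear_form (g : H -> R[i]) : Prop :=
  forall c u v, g (c *: u + v) = c * g u + g v.

Lemma linear_form0 g : linear_form g -> g 0 = 0.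
Proof. by move=> /(_ (-1) 0 0); rewrite scaler0 addr0 mulN1r addNr. Qed.

Lemma linear_formZ g c u : linear_form g -> g (c *: u) = c * g u.
Proof.
by move=> gl; have := gl c u 0; rewrite linear_form0 // !addr0.
Qed.

(* A dense ideal, whose elements have finite rank on [H]. *)
Definition form_bounding : set A := [set x | forall g, linear_form g ->
  exists C : R, forall h, cabs (g (F x h)) <= C * nrm h].

Lemma form_bounding_ideal : two_sided_ideal form_bounding.
Proof.
split; first split.
- move=> g gl; exists 0 => h; rewrite op0 linear_form0 // mul0r.
  by rewrite /cabs normr0.
- move=> c x y hx hy g gl; have [C hC] := hx g gl; have [D hD] := hy g gl.
  exists (cabs c * C + D) => h; rewrite op_linear gl.
  apply: (le_trans (cabsD _ _)); rewrite cabsM mulrDl -mulrA.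
  by apply: lerD (hD h); rewrite ler_wpM2l ?cabs_ge0.
move=> a x hx; split=> g gl.
  have gl' : linear_form (fun h => g (F a h)).
    by move=> c u v; rewrite (compact_operatorP (op_compact a)) gl.
  by have [C hC] := hx _ gl'; exists C => h; rewrite opM.
have [C hC] := hx g gl; have [D D0 hD] := compact_operator_bounded (op_compact a).
exists (`|C| * D) => h; rewrite opM; apply: (le_trans (hC _)).
apply: (@le_trans _ _ (`|C| * nrm (F a h))); first by rewrite ler_wpM2r ?nrm_ge0 ?ler_norm.
by rewrite -mulrA ler_wpM2l.
Qed.

(** If [k y = y], the range of [F y] consists of vectors fixed by the compact operator [F k]. They
    have a finite orthonormal expansion, along which every linear form is bounded. *)
Lemma form_bounding_dense : dense form_bounding.
Proof.
have [hs _] := form_bounding_ideal.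
apply/dense_nrmP => x e e0; have : closure form_bounding x; last by move/closure_nrmP/(_ _ e0).
move: x; apply: subspace_local_units; first exact: closure_subspace.
  exact: closed_closure.
move=> y k _ _ ky _; apply: subset_closure => g gl.
have [s hs'] := compact_operator_fixed hip (op_compact k).
have [C C0 hC] := compact_operator_bounded (op_compact y).
exists (C * \sum_(u <- s) nrm u * cabs (g u)) => h.
have -> : F y h = proj dot s (F y h) by apply: hs'; rewrite -opM ky.
have -> : g (proj dot s (F y h)) = \sum_(u <- s) dot (F y h) u * g u.
  rewrite /proj; elim: (s) => [|u s' IHs]; first by rewrite !big_nil linear_form0.
  by rewrite !big_cons gl IHs.
apply: (le_trans (cabs_sum _ _ _)); rewrite mulrAC mulr_sumr; apply: ler_sum => u _.
rewrite cabsM mulrA ler_wpM2r ?cabs_ge0 //.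
by apply: (le_trans (ip_norm_le hip _ _)); rewrite ler_wpM2r ?nrm_ge0.
Qed.

Lemma pedersen_form_bounding x : K x -> form_bounding x.
Proof.
move/pedersenP; apply; [exact: form_bounding_ideal|exact: form_bounding_dense].
Qed.

Lemma rank_oneP u v : compact_operators H (fun h => dot h v *: u).
Proof.
apply: (@rank_one_compact _ _ _ (nrm v)) => [c x y|h]; first exact: (ipP hip).
by rewrite mulrC; exact: ip_norm_le.
Qed.

Definition rank_one u v : A := operator_elt (fun h => dot h v *: u).
Local Notation E := rank_one.

Lemma rank_one_A1 u v : A1 (E u v). Proof. by have [] := operator_eltP (rank_oneP u v). Qed.

Lemma phi_rank_one u v h : phi (E u v) h = dot h v *: u.
Proof. by have [_ ->] := operator_eltP (rank_oneP u v). Qed.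

Lemma infinite_orthonormal_seq : ~ finite_dimensional A1 -> exists e : nat -> H, orthonormal_seq dot e.
Proof.
move=> nf; have [||[s [_ hs]]|[e [oe _]]] := orthonormal_basis hip (V := setT) => //; last by exists e.
exfalso; apply: nf.
refine (@finite_dimensional_seq _ _ A1 _ [seq (u, v) | u <- s, v <- s]
  (fun x p => dot (phi x p.2) p.1) (fun p => E p.1 p.2) _ _).
  by move=> p; exact: rank_one_A1.
move=> x x1; apply: phi_inj => //.
  by apply: subspace_sum => // p; apply: subspaceZ => //; exact: rank_one_A1.
move=> h; rewrite phi_sum; last by move=> p; exact: rank_one_A1.
rewrite big_allpairs /= exchange_big /= {1}(hs h I) (compact_operator_sum _ _ (phi_compact x1)).
apply: eq_bigr => b _; rewrite (compact_operatorZ _ _ (phi_compact x1)) {1}(hs (phi x b) I).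
rewrite scaler_sumr; apply: eq_bigr => u _.
by rewrite phi_rank_one !scalerA mulrC.
Qed.

(** [f] is prescribed on the algebraic span of [e], encoded as the vectors that eventually equal
    their partial Fourier sums, and then extended. *)
Lemma unbounded_form (e : nat -> H) : orthonormal_seq dot e ->
  exists2 f, linear_form f & forall n, f (e n) = n%:R.
Proof.
move=> oe.
pose S u m := \sum_(k < m) dot u (e k) *: e k.
pose s u m : R[i] := \sum_(k < m) dot u (e k) * k%:R.
have SP c u v m : S (c *: u + v) m = c *: S u m + S v m.
  rewrite /S scaler_sumr -big_split; apply: eq_bigr => k _.
  by rewrite (ipP hip) scalerDl scalerA.
have sP c u v m : s (c *: u + v) m = c * s u m + s v m.
  rewrite /s mulr_sumr -big_split; apply: eq_bigr => k _.
  by rewrite (ipP hip) mulrDl mulrA.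
pose G : set (H * R[i]) := [set p | exists n, forall m, (n <= m)%N -> p.1 = S p.1 m /\ p.2 = s p.1 m].
have [|f [fl fG]] := @linear_extension _ _ G.
  split.
  - exists 0%N => m _ /=; rewrite /S /s.
    by split; rewrite big1 // => k _; rewrite (ip0l hip) ?scale0r ?mul0r.
  - move=> c u a v b [n1 h1] [n2 h2]; exists (maxn n1 n2) => m; rewrite geq_max => /andP[m1 m2] /=.
    have [/= E1 E2] := h1 m m1; have [/= E3 E4] := h2 m m2.
    by rewrite SP sP -E1 -E2 -E3 -E4.
  - move=> a [n /(_ n (leqnn n)) /= [_ ->]].
    by rewrite /s big1 // => k _; rewrite (ip0l hip) mul0r.
exists f => // n; apply: fG; exists n.+1 => m nm /=; rewrite /S /s.
rewrite (bigD1 (Ordinal nm)) //= big1 ?addr0; last first.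
  by move=> k kn; rewrite oe eq_sym -(inj_eq val_inj) /= in kn *; rewrite (negbTE kn) scale0r.
rewrite (bigD1 (Ordinal nm)) //= big1 ?addr0; last first.
  by move=> k kn; rewrite oe eq_sym -(inj_eq val_inj) /= in kn *; rewrite (negbTE kn) mul0r.
by rewrite oe eqxx scale1r mul1r.
Qed.

Section Centralizer.
Variables (f : H -> R[i]) (w : H).
Hypothesis fl : linear_form f.

Definition form_centralizer x y : A := operator_elt (fun h => f (F y h) *: F x w).
Local Notation T := form_centralizer.

Lemma form_centralizerP x y : K y -> A1 (T x y) /\ phi (T x y) =1 fun h => f (F y h) *: F x w.
Proof.
move=> /pedersen_form_bounding/(_ f fl)[C hC]; apply: operator_eltP.
apply: (rank_one_compact _ (g := fun h => f (F y h)) _ hC) => c u v.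
by rewrite (compact_operatorP (op_compact y)) fl.
Qed.

Lemma form_centralizer_qc : quasi_centralizer K T.
Proof.
have [sK mK] := pedersen_two_sided A.
split.
- move=> x y Kx Ky; have [t1 ht] := form_centralizerP x Ky.
  set v := F x w in ht.
  (* The range of [T x y] lies in the line of [v], so the projection onto this line is a left unit.
     For [v = 0] the inverse is zero by convention and [T x y] vanishes. *)
  apply: (@pedersen_left_unit _ _ ((dot v v)^-1 *: E v v)).
  have q1 : A1 ((dot v v)^-1 *: E v v) by apply: subspaceZ => //; exact: rank_one_A1.
  apply: phi_inj => // [|h]; first by have [] := ideal_mul (T x y) hA1 q1.
  rewrite phiM // ht phiZ ?phi_rank_one; last exact: rank_one_A1.
  rewrite (ipZl hip) !scalerA.
  have [->|v0] := pselect (v = 0); first by rewrite !scaler0.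
  congr (_ *: _); rewrite mulrCA mulVf ?mulr1 // (ip_nrm hip) fmorph_eq0 sqrf_eq0.
  by rewrite lt0r_neq0 // nrm_gt0.
- move=> c x y z Kx Ky Kz; have [? hx] := form_centralizerP x Kz.
  have [? hy] := form_centralizerP y Kz; have [? h] := form_centralizerP (c *: x + y) Kz.
  apply: phi_inj => // [|u]; first exact: sub1.2.
  by rewrite phi_linear // h hx hy op_linear scalerDr !scalerA mulrC.
- move=> c x y z Kx Ky Kz; have [? hx] := form_centralizerP z Kx.
  have [? hy] := form_centralizerP z Ky.
  have Kxy : K (c *: x + y) by exact: sK.2.
  have [? h] := form_centralizerP z Kxy.
  apply: phi_inj => // [|u]; first exact: sub1.2.
  by rewrite phi_linear // h hx hy op_linear fl scalerDl scalerA.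
- move=> b1 b2 b3 _ _ K3; have [? h] := form_centralizerP (b1 ** b2) K3.
  have [t1 ht] := form_centralizerP b2 K3.
  have [p1 _] := summand_projP b1.
  rewrite [RHS]summand_proj_mull //.
  apply: phi_inj => // [|u]; first by have [] := ideal_mul (pr b1) hA1 t1.
  by rewrite phiM // h ht opM (compact_operatorZ _ _ (phi_compact p1)).
- move=> b1 b2 b3 _ K2 _; have [_ K23] := mK b3 _ K2.
  have [? h] := form_centralizerP b1 K23.
  have [t1 ht] := form_centralizerP b1 K2.
  have [p1 _] := summand_projP b3.
  rewrite [RHS]summand_proj_mulr //.
  apply: phi_inj => // [|u]; first by have [] := ideal_mul (pr b3) hA1 t1.
  by rewrite phiM // h ht opM.
Qed.

Lemma rank_oneM u v u' v' : E u v ** E u' v' = dot u' v *: E u v'.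
Proof.
have [h1 h2] := (rank_one_A1 u v, rank_one_A1 u' v').
apply: phi_inj => [||h]; first by have [] := ideal_mul (E u' v') hA1 h1.
  by apply: subspaceZ => //; exact: rank_one_A1.
rewrite phiM // phiZ ?phi_rank_one; last exact: rank_one_A1.
by rewrite (ipZl hip) !scalerA mulrC.
Qed.

Lemma rank_one_star u v : cstar (E u v) = E v u.
Proof.
have s1 : A1 (cstar (E u v)) by apply: ideal_star => //; exact: rank_one_A1.
apply: phi_inj => // [|h]; first exact: rank_one_A1.
apply: (ip_injl hip) => g; have [_ _ _ ->] := hphi; last exact: rank_one_A1.
by rewrite !phi_rank_one (ipZr hip) (ipZl hip) mulrC -(ipC hip).
Qed.

Hypothesis w1 : nrm w = 1.

Let dww : dot w w = 1. Proof. by rewrite (ip_nrm hip) w1 expr1n. Qed.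

(** [phi] is only known to be algebraic; the norm comes from the C*-identity and from [E w w] being
    a nonzero projection. *)
Lemma rank_one_nrm1 u : nrm u = 1 -> nrm (E u w) = 1.
Proof.
have sq v : nrm v = 1 -> nrm (E v w) ^+ 2 = nrm (E w w).
  by move=> v1; rewrite -nrm_starM rank_one_star rank_oneM (ip_nrm hip) v1 expr1n scale1r.
have qE0 : E w w <> 0.
  move=> h; have := phi_rank_one w w w; rewrite h phi0 dww scale1r => w0.
  by move: w1; rewrite -w0 nrm0 => /eqP; rewrite eq_sym oner_eq0.
have nq := nrm_gt0 qE0.
have q1 : nrm (E w w) = 1.
  have := sq w w1; rewrite expr2 => /eqP; rewrite -subr_eq0 -{3}[nrm _]mulr1 -mulrBr mulf_eq0.
  by rewrite (gt_eqF nq) /= subr_eq0 => /eqP.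
move=> u1; have := sq u u1; rewrite q1 => /eqP; rewrite sqrf_eq1 => /orP[/eqP//|/eqP h].
by have := nrm_ge0 (E u w); rewrite h ler0N1.
Qed.

(** [q A q] is one-dimensional, so an ideal of the family contains [q] as soon as it contains some
    [a] with [q a q <> 0]; such an ideal exists because the sum of the family is dense. It then
    contains all [E u w], and [T q (E u w) = f(u) q]. *)
Lemma form_centralizer_bounded : locally_bounded T ->
  exists M : R, forall u, nrm u = 1 -> cabs (f u) <= M.
Proof.
move=> [J [I [hI hcl hb]]]; set q := E w w.
have qE : q ** q = q by rewrite rank_oneM dww scale1r.
have q1 : A1 q by exact: rank_one_A1.
have [j Ij] : exists j, I j q.
  apply: contrapT => h.
  have z x : sum_of_family I x -> q ** x ** q = 0.
    move=> [n [a [ha ->]]]; rewrite cmulx_sum cmul_sumx big1 // => k _.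
    have [j Ij] := ha k; apply: contrapT => qaq; apply: h; exists j.
    have [sI _] := (hI j).1.
    have E1 : q ** a k ** q = dot (F (a k) w) w *: q.
      have [p1 _] := summand_projP (a k).
      rewrite (summand_proj_mulr (a k) q1).
      have hqp : A1 (q ** pr (a k)) by have [] := ideal_mul q hA1 p1.
      apply: phi_inj; [by have [] := ideal_mul q hA1 hqp|exact: subspaceZ|move=> v].
      by rewrite !phiM // phiZ // !phi_rank_one (compact_operatorZ _ _ (phi_compact p1)) (ipZl hip) scalerA mulrC.
    move: qaq; rewrite E1; set c := dot _ _ => qaq.
    have c0 : c != 0 by apply: contra_notN qaq => /eqP ->; rewrite scale0r.
    have -> : q = c^-1 *: (q ** a k ** q) by rewrite E1 scalerA mulVf // scale1r.
    apply: subspaceZ => //; have [_ hr] := ideal_mul q (hI j) (ideal_mul q (hI j) Ij).1.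
    exact: hr.
  have : closed [set x | q ** x ** q = 0].
    apply: (@closed_lin_eq _ _ _ (nrm q * nrm q)) => x; first by move=> y; rewrite cmulxB cmulBx.
    apply: (le_trans (nrmM _ _)); rewrite -mulrA [nrm q * nrm x]mulrC mulrA.
    by rewrite ler_wpM2r ?nrm_ge0 // nrmM.
  move=> /closed_nrmP/(_ q) hq; have : q ** q ** q = 0.
    apply: hq => e e0; have : closure (sum_of_family I) q by rewrite hcl.
    by move=> /closure_nrmP/(_ _ e0)[y /z hy qy]; exists y.
  rewrite !qE => q0; have := rank_one_nrm1 w1; rewrite -/q q0 nrm0 => /eqP.
  by rewrite eq_sym oner_eq0.
have [M hM] := hb j; exists M => u u1.
have uq : E u w ** q = E u w by rewrite rank_oneM dww scale1r.
have Kq : K q by exact: pedersen_right_unit qE.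
have Ku : K (E u w) by exact: pedersen_right_unit uq.
have Iu : I j (E u w) by rewrite -uq; have [] := ideal_mul (E u w) (hI j) Ij.
have := hM q (E u w) (conj Kq Ij) (conj Ku Iu).
have -> : T q (E u w) = f u *: q.
  have [t1 ht] := form_centralizerP q Ku.
  apply: phi_inj => // [|h]; first exact: subspaceZ.
  rewrite ht !op_phi ?phiZ ?phi_rank_one //; try exact: rank_one_A1.
  by rewrite linear_formZ // dww scale1r scalerA mulrC.
rewrite !norm_nrm nrmZ !rank_one_nrm1 // !mulr1.
by rewrite lecR.
Qed.

End Centralizer.

Lemma unbounded_centralizer : ~ finite_dimensional A1 ->
  exists T, quasi_centralizer K T /\ ~ locally_bounded T.
Proof.
move=> /infinite_orthonormal_seq[e oe]; have [f fl fe] := unbounded_form oe.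
have e1 n := orthonormal_seq_nrm hip n oe.
exists (form_centralizer f (e 0%N)); split; first exact: form_centralizer_qc.
move=> /(form_centralizer_bounded fl (e1 _))[M hM].
have := hM _ (e1 (Num.truncn M).+1).
rewrite fe -(rmorph_nat (real_complex R)) cabs_real ger0_norm // leNgt.
by rewrite Num.Theory.truncnS_gt.
Qed.

End ElementarySummand.

(** * An elementary summand from a minimal projection *)

Section Column.
Variables (R : realType) (A : cstarAlgType R).

Definition right_fixed (p : A) : {pred A} := [pred x | x ** p == x].

Lemma right_fixed_submod p : submod_closed (right_fixed p).
Proof.
split; first by rewrite inE cmul0x.
by move=> c x y; rewrite !inE => /eqP xp /eqP yp; rewrite cmulDl cmulZl xp yp.
Qed.

HB.instance Definition _ p := GRing.isSubmodClosed.Build R[i] A (right_fixed p)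
  (right_fixed_submod p).

(** For idempotent [p] this is the left ideal [A p], with the module structure of a subtype and the
    norm of [A]. *)
Record column (p : A) := Column { colval : A; _ : colval \in right_fixed p }.

HB.instance Definition _ p := [isSub for @colval p].
HB.instance Definition _ p := [Choice of column p by <:].
HB.instance Definition _ p := [SubChoice_isSubLmodule of column p by <:].

Section Norm.
Variable p : A.
Implicit Types u v : column p.

Definition column_norm u : R[i] := `|val u|.

Lemma column_normD u v : column_norm (u + v) <= column_norm u + column_norm v.
Proof. by rewrite /column_norm raddfD ler_normD. Qed.

Lemma column_normZ (c : R[i]) u : column_norm (c *: u) = `|c| * column_norm u.
Proof. by rewrite /column_norm linearZ normrZ. Qed.

Lemma column_norm0_eq0 u : column_norm u = 0 -> u = 0.
Proof. by move=> /normr0_eq0 h; apply: val_inj; rewrite h raddf0. Qed.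

HB.instance Definition _ := @Lmodule_isNormed.Build R[i] (column p) column_norm
  column_normD column_normZ column_norm0_eq0.

Lemma nrm_column u : nrm u = nrm (val u). Proof. by []. Qed.

Lemma column_complete (F : set_system (column p)) : ProperFilter F -> cauchy F -> cvg F.
Proof.
move=> FF cF.
have cG : cauchy (val @ F).
  apply/cauchy_ballP => e e0; have /cauchy_ballP/(_ e e0)[[P Q] /= [FP FQ] hPQ] := cF.
  exists (val @` P, val @` Q) => /=.
    by split; [apply: filterS FP|apply: filterS FQ] => u hu; exists u.
  move=> [_ _] /= [[u Pu <-] [v Qv <-]].
  have := hPQ (u, v) (conj Pu Qv); rewrite -!ball_normE /=.
  by have -> : val u - val v = val (u - v) by rewrite raddfB.
have /cauchy_cvgP/cvg_ex[l Fl] := cG.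
have near (e : R) : 0 < e -> F [set u | nrm (l - val u) < e].
  move=> e0; have /Fl : nbhs l [set x | nrm (l - x) < e].
    by apply: open_nbhs_nbhs; split; [exact: open_nrm_ball|rewrite /= subrr nrm0].
  by [].
have lp : l \in right_fixed p.
  rewrite inE -subr_eq0; apply/eqP/nrm_small => e e0.
  have c0 : 0 < nrm p + 1 by rewrite ltr_wpDl ?nrm_ge0.
  have [u hu] := filter_ex (near _ (divr_gt0 e0 c0)).
  have /eqP up : val u ** p == val u := valP u.
  have -> : l ** p - l = (l - val u) ** p - (l - val u) by rewrite cmulBx up; abel.
  apply: (le_trans (nrmB _ _)); move: hu; rewrite /= ltr_pdivlMr // mulrDr mulr1 => hu.
  by have := nrmM (l - val u) p; lra.
apply/cvg_ex; exists (Column lp); apply/cvg_ballP => e.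
rewrite ltcE => /andP[/eqP ei er]; have := near _ er; apply: filterS => u /= hu.
by rewrite -ball_normE /= norm_nrm ltcE ei eqxx.
Qed.

HB.instance Definition _ := Uniform_isComplete.Build (column p) column_complete.

End Norm.

End Column.

Lemma inner_product_dot (R : realType) (H : completeNormedModType R[i]) (ip : H -> H -> R[i]) :
  inner_product ip -> exists dot : {dot H for Num.conj}, hilbert_dot dot /\ forall u v, dot u v = ip u v.
Proof.
move=> hip.
have h1 : forall v, zmod_morphism (ip^~ v) by move=> v x y; exact: ipBl.
have h2 : forall v, zmod_morphism (ip v) by move=> v x y; exact: ipBr.
have h3 : forall v, scalable_for *%R (ip^~ v) by move=> v c x; exact: ipZl.
have h4 : forall v, scalable_for ((Num.conj : R[i] -> R[i]) \; *%R) (ip v) by move=> v c x; exact: ipZr.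
have h5 : forall u v, ip u v = (-1) ^+ false * Num.conj (ip v u).
  by move=> u v; rewrite expr0 mul1r [LHS](ipC hip).
have h6 : forall u, u != 0 -> 0 < ip u u.
  by move=> u /eqP u0; rewrite (ip_nrm hip) (ltcR 0) exprn_gt0 // nrm_gt0.
pose b1 := @isBilinear.Build R[i] H H R[i] *%R ((Num.conj : R[i] -> R[i]) \; *%R) ip h1 h2 h3 h4.
pose b2 := @isHermitianSesquilinear.Build R[i] H false Num.conj ip h5.
pose b3 := @isDotProduct.Build R[i] H ip h6.
pose dot : {dot H for Num.conj} := HB.pack ip b1 b2 b3.
exists dot; split=> // u; rewrite /= /dot norm_nrm /= (ip_nrm hip) rmorphXn.
by [].
Qed.

(** [D e] collects the approximations with error [e] to an object not yet known to exist. This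
    serves for the closedness of [col_sum] and for the surjectivity of the representation. *)
Lemma cauchy_approx (R : realType) (V : completeNormedModType R[i]) (D : R -> set V) :
  (forall e : R, 0 < e -> exists y, D e y) ->
  (forall e e' y y', D e y -> D e' y' -> nrm (y - y') <= e + e') ->
  exists l, forall e : R, 0 < e -> exists d y, [/\ d <= e, D d y & nrm (l - y) < e].
Proof.
move=> hD hDD; pose d n : R := n.+1%:R^-1.
have d0 n : 0 < d n by rewrite invr_gt0.
have dN (e : R) : 0 < e -> exists N, forall n, (N <= n)%N -> d n < e.
  move=> e0; exists (Num.truncn e^-1) => n nN.
  rewrite /d -[e]invrK ltf_pV2 ?posrE ?invr_gt0 //.
  by apply: lt_le_trans (Num.Theory.truncnS_gt _) _; rewrite ler_nat.
have /choice[u hu] : forall n, exists y, D (d n) y by move=> n; exact: hD.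
have [|l hl] := @nrm_cauchy_cvg _ _ u.
  move=> e e0; have e2 : 0 < e / 2 by rewrite divr_gt0.
  have [N hN] := dN _ e2; exists N => m n Nm Nn.
  by have := hDD _ _ _ _ (hu m) (hu n); have := hN m Nm; have := hN n Nn; lra.
exists l => e e0; have [N hN] := dN _ e0; have [N' hN'] := hl _ e0.
exists (d (maxn N N')), (u (maxn N N')); split=> //; first by rewrite ltW // hN // leq_maxl.
by apply: hN'; rewrite leq_maxr.
Qed.

Lemma totally_boundedZ (R : realType) (H : completeNormedModType R[i]) (S : set H) (c : R[i]) :
  totally_bounded S -> totally_bounded [set x | exists2 y, S y & x = c *: y].
Proof.
move=> hS e e0; have c0 : 0 < cabs c + 1 by rewrite ltr_wpDl ?cabs_ge0.
have [L hL] := hS _ (divr_gt0 e0 c0).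
exists [seq c *: y | y <- L] => x [y /hL[z zL yz] ->].
exists (c *: z); first by apply/mapP; exists z.
rewrite -scalerBr nrmZ; move: yz; rewrite ler_pdivlMr // => yz.
by have := nrm_ge0 (y - z); lra.
Qed.

(* The representation on [A p] for a projection [p] with [p A p] one-dimensional. *)
Section MinimalColumn.
Variables (R : realType) (A : cstarAlgType R) (p : A).
Hypotheses (psa : sa p) (pp : p ** p = p) (p0 : p <> 0).
Hypothesis pmin : forall a, exists c : R[i], p ** a ** p = c *: p.
Local Notation H := (column p).
Implicit Types (a x y z k : A) (u v h e : H) (c : R[i]).

Lemma minimal_proj_nrm : nrm p = 1.
Proof.
have np := nrm_gt0 p0; have := nrm_starM p; rewrite psa pp => /eqP.
by rewrite expr2 -{1}[nrm p]mulr1 -subr_eq0 -mulrBr mulf_eq0 (gt_eqF np) /= subr_eq0 => /eqP.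
Qed.

Lemma scale_proj_inj c c' : c *: p = c' *: p -> c = c'.
Proof.
move=> h; apply/eqP; rewrite -subr_eq0; have : (c - c') *: p = 0 by rewrite scalerBl h subrr.
by move/eqP; rewrite scaler_eq0 => /orP[//|/eqP /p0].
Qed.

Lemma colvalP u : val u ** p = val u. Proof. by have /eqP := valP u. Qed.

Lemma colval_star u : p ** cstar (val u) = cstar (val u).
Proof. by rewrite -{1}psa -cstarM colvalP. Qed.

Definition col_ip u v : R[i] := xget 0 [set c | cstar (val v) ** val u = c *: p].
Local Notation ip := col_ip.

Lemma col_ipE u v : cstar (val v) ** val u = ip u v *: p.
Proof.
apply: (@xgetPex _ 0 [set c | cstar (val v) ** val u = c *: p]).
have [c hc] := pmin (cstar (val v) ** val u); exists c => /=.
by rewrite -hc cmulA colval_star -cmulA colvalP.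
Qed.

Lemma col_inner_product : inner_product ip.
Proof.
split.
- move=> c u v h; apply: scale_proj_inj.
  by rewrite -col_ipE linearP /= cmulDr cmulZr !col_ipE scalerDl scalerA.
- move=> u v; apply: scale_proj_inj.
  by rewrite -col_ipE -[in RHS]psa -cstarZc -col_ipE cstarM cstarK.
- move=> u; have E := col_ipE u u; have cC : conjc (ip u u) = ip u u.
    by apply: scale_proj_inj; rewrite -E -[in LHS]psa -cstarZc -E cstarM cstarK.
  have cR : ip u u = (complex.Re (ip u u))%:C.
    by case: (ip u u) cC => a b [] /eqP; rewrite -subr_eq0 -opprD oppr_eq0 -mulr2n mulrn_eq0 /= => /eqP ->.
  have r0 : 0 <= complex.Re (ip u u).
    by apply: (starM_scalar_ge0 psa pp p0 (colvalP u)); rewrite -cR.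
  have := congr1 (fun x => nrm x) E; rewrite nrm_starM cR nrmZ cabs_real minimal_proj_nrm mulr1.
  by rewrite ger0_norm // nrm_column => ->.
Qed.
Let hip := col_inner_product.

Lemma col_mul_subproof a u : a ** val u \in right_fixed p.
Proof. by rewrite inE -cmulA colvalP. Qed.

Definition col_mul a u : H := Column (col_mul_subproof a u).
Local Notation op := col_mul.

Lemma col_mulE a u : val (op a u) = a ** val u. Proof. by []. Qed.

Lemma nrm_col_mul a u : nrm (op a u) <= nrm a * nrm u.
Proof. by rewrite !nrm_column nrmM. Qed.

Lemma col_mul_linear a c u v : op a (c *: u + v) = c *: op a u + op a v.
Proof. by apply: val_inj; rewrite linearP /= cmulDr cmulZr. Qed.

Lemma col_mul_linearl c x y u : op (c *: x + y) u = c *: op x u + op y u.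
Proof. by apply: val_inj; rewrite linearP /= cmulDl cmulZl. Qed.

Lemma col_mulB x y u : op (x - y) u = op x u - op y u.
Proof. by apply: val_inj; rewrite raddfB /= cmulBx. Qed.

Lemma col_mulM x y u : op (x ** y) u = op x (op y u).
Proof. by apply: val_inj; rewrite /= cmulA. Qed.

Lemma col_mul_adjoint x u v : ip (op (cstar x) u) v = ip u (op x v).
Proof. by apply: scale_proj_inj; rewrite -!col_ipE /= cstarM cmulA. Qed.

Lemma col_mul_rank_one e e' u : op (val e ** cstar (val e')) u = ip u e' *: e.
Proof. by apply: val_inj; rewrite linearZ /= -cmulA col_ipE cmulZr colvalP. Qed.

Lemma col_mul_finite_rank (s : seq H) (g : H -> H) u :
  op (\sum_(e <- s) val (g e) ** cstar (val e)) u = \sum_(e <- s) ip u e *: g e.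
Proof.
elim: s => [|e s IHs]; first by rewrite !big_nil; apply: val_inj; rewrite /= cmul0x.
by rewrite !big_cons -IHs -col_mul_rank_one; apply: val_inj; rewrite /= cmulDl.
Qed.

Definition col_ker : set A := [set a | forall u, op a u = 0].

(** The annihilator of the kernel is the only candidate for a complement, since ideals with zero
    intersection annihilate each other. *)
Definition col_ideal : set A := [set x | forall y, col_ker y -> x ** y = 0].

Lemma col_ker_closed : closed_two_sided_ideal col_ker.
Proof.
split; first split.
- split=> [u|c x y hx hy u]; first by apply: val_inj; rewrite /= cmul0x.
  by rewrite col_mul_linearl hx hy scaler0 addr0.
- move=> a x hx; split=> u; rewrite col_mulM ?hx //.
  by apply: val_inj; rewrite /= cmulx0.
apply/closed_nrmP => x h u; apply: nrm_small => e e0.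
have c0 : 0 < nrm u + 1 by rewrite ltr_wpDl ?nrm_ge0.
have [y hy xy] := h _ (divr_gt0 e0 c0).
have -> : op x u = op (x - y) u by rewrite col_mulB hy subr0.
apply: (le_trans (nrm_col_mul _ _)); move: xy; rewrite ltr_pdivlMr // => xy.
by apply: le_trans (ltW xy); rewrite ler_wpM2l ?nrm_ge0 // lerDl ler01.
Qed.

Lemma col_ideal_closed : closed_two_sided_ideal col_ideal.
Proof.
have [[_ hm] _] := col_ker_closed.
split; first split.
- split=> [y _|c x y hx hy z hz]; first by rewrite cmul0x.
  by rewrite cmulDl cmulZl (hx z) // (hy z) // scaler0 addr0.
- move=> a x hx; split=> y hy; first by rewrite -cmulA (hx y) // cmulx0.
  by rewrite -cmulA (hx (a ** y)) //; have [] := hm a y hy.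
apply/closed_nrmP => x h y hy; apply: nrm_small => e e0.
have c0 : 0 < nrm y + 1 by rewrite ltr_wpDl ?nrm_ge0.
have [z hz xz] := h _ (divr_gt0 e0 c0).
have -> : x ** y = (x - z) ** y by rewrite cmulBx (hz y) // subr0.
apply: (le_trans (nrmM _ _)); move: xz; rewrite ltr_pdivlMr // => xz.
by apply: le_trans (ltW xz); rewrite ler_wpM2l ?nrm_ge0 // lerDl ler01.
Qed.

Let sub0 : Defs.subspace col_ker. Proof. by have [[]] := col_ker_closed. Qed.
Let sub1 : Defs.subspace col_ideal. Proof. by have [[]] := col_ideal_closed. Qed.

Lemma col_disjoint x : col_ker x -> col_ideal x -> x = 0.
Proof. by move=> x0 x1; apply: Mstar_eq0; apply: x1; exact: ideal_star col_ker_closed _. Qed.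

Lemma col_ideal_inj x y : col_ideal x -> col_ideal y -> op x =1 op y -> x = y.
Proof.
move=> hx hy xy; apply/eqP; rewrite -subr_eq0; apply/eqP.
apply: (col_disjoint (x := x - y)); last exact: (subspaceB sub1).
by move=> u; rewrite col_mulB xy subrr.
Qed.

Lemma col_ideal_val u : col_ideal (val u).
Proof.
move=> y /(ideal_star col_ker_closed) hy.
have pR : p \in right_fixed p by rewrite inE pp.
have := congr1 val (hy (Column pR)); rewrite /= => yp.
have py : p ** y = 0 by rewrite -[y]cstarK -{1}psa -cstarM yp cstar0.
by rewrite -colvalP -cmulA py cmulx0.
Qed.

Lemma col_ideal_rank_one x u : col_ideal (val u ** x).
Proof. by have [] := ideal_mul x col_ideal_closed (col_ideal_val u). Qed.

(* [op] is isometric on [col_ideal]: the part [s] of [x^* x] above [M^2] vanishes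
   on [H] as soon as [M] exceeds the norm of [op x]. *)
Lemma col_ideal_isometric x (m : R) : col_ideal x -> 0 <= m ->
  (forall u, nrm (op x u) <= m * nrm u) -> nrm x <= m.
Proof.
move=> hx m0 hm; apply/ler_addgt0Pr => e e0; have M0 : 0 < m + e by lra.
have [s [l [ssa sE h1 h2]]] := softcut (cstar x) M0; rewrite -nrm_star; apply: h2.
apply: col_disjoint; last first.
  have xs : col_ideal (cstar x) by exact: ideal_star col_ideal_closed hx.
  have [_ h] := ideal_mul (x ** l) col_ideal_closed xs.
  by rewrite sE cstarK -cmulA.
move=> u; apply: nrm_eq0; apply/eqP; rewrite eq_le nrm_ge0 andbT.
have := h1 (cstar (val u)).
have E : cstar (val u) ** s = cstar (val (op s u)) by rewrite /= cstarM ssa.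
rewrite E -cstarM -(col_mulE x) !nrm_star -!nrm_column => h3.
have := le_trans h3 (hm (op s u)); rewrite -subr_ge0 -mulrBl.
have -> : m - (m + e) = - e by lra.
by rewrite mulNr oppr_ge0 pmulr_rle0.
Qed.

Lemma col_ideal_isometricD x0 x1 : col_ker x0 -> col_ideal x1 -> nrm x1 <= nrm (x0 + x1).
Proof.
move=> h0 h1; apply: col_ideal_isometric => // [|u]; first exact: nrm_ge0.
have -> : op x1 u = op (x0 + x1) u.
  by apply: val_inj; rewrite /= cmulDl -[x0 ** _]col_mulE h0 add0r.
exact: nrm_col_mul.
Qed.

Definition col_sum : set A := [set x | exists x0 x1, [/\ col_ker x0, col_ideal x1 & x = x0 + x1]].

Lemma col_sum_sub : Defs.subspace col_sum.
Proof.
split; first by exists 0, 0; split; [exact: sub0.1|exact: sub1.1|rewrite addr0].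
move=> c x y [x0 [x1 [h0 h1 ->]]] [y0 [y1 [g0 g1 ->]]].
exists (c *: x0 + y0), (c *: x1 + y1); split; [exact: sub0.2|exact: sub1.2|].
by rewrite scalerDr; abel.
Qed.

Lemma col_sum_closed : closed col_sum.
Proof.
apply/closed_nrmP => x hx.
pose D (e : R) : set A := [set x1 | col_ideal x1 /\ exists2 x0, col_ker x0 & nrm (x - (x0 + x1)) <= e].
have [||l hl] := @cauchy_approx _ _ D.
- by move=> e /hx[y [x0 [x1 [h0 h1 ->]]] xy]; exists x1; split=> //; exists x0 => //; exact: ltW.
- move=> e e' x1 y1 [h1 [x0 h0 hx0]] [g1 [y0 g0 hy0]].
  have := @col_ideal_isometricD (x0 - y0) (x1 - y1).
  move=> /(_ (subspaceB sub0 h0 g0) (subspaceB sub1 h1 g1)).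
  have -> : x0 - y0 + (x1 - y1) = (x0 + x1) - (y0 + y1) by abel.
  have := nrm_triangle x (x0 + x1) (y0 + y1); rewrite (nrmBC (x0 + x1) x).
  by lra.
exists (x - l), l; split; last by rewrite subrK.
  have /closed_nrmP := col_ker_closed.2; apply => e e0.
  have e2 : 0 < e / 2 by rewrite divr_gt0.
  have [d [x1 [de [h1 [x0 h0 xd]] lx]]] := hl _ e2; exists x0 => //.
  have -> : x - l - x0 = (x - (x0 + x1)) - (l - x1) by abel.
  by have := nrmB (x - (x0 + x1)) (l - x1); lra.
have /closed_nrmP := col_ideal_closed.2; apply => e e0.
by have [d [x1 [_ [h1 _] lx]]] := hl _ e0; exists x1.
Qed.

(** A finiteness condition on local units, to be supplied by the gliding hump. *)
Hypothesis hfin : forall k (e : nat -> H), sa k -> orthonormal_seq ip e ->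
  (forall n, op k (e n) = e n) -> False.

Lemma local_unit_finite_rank k z : sa k -> k ** z = z ->
  exists s : seq H, forall u, op z u = \sum_(e <- s) ip (op z u) e *: e.
Proof.
move=> ksa kz; have [||[s [_ hs]]|[e [oe ke]]] := orthonormal_basis hip (V := [set u | op k u = u]).
- by apply: val_inj; rewrite /= cmulx0.
- by move=> c u v /= hu hv; rewrite col_mul_linear hu hv.
- by exists s => u; apply: hs; rewrite /= -col_mulM kz.
- by exfalso; exact: hfin ksa oe ke.
Qed.

(** For [z] with a local unit, the projection [q] onto a finite-dimensional space containing the
    range of [z] comes from [col_ideal], and [z - q z] acts as zero. *)
Lemma col_sumT x : col_sum x.
Proof.
move: x; apply: subspace_local_units; [exact: col_sum_sub|exact: col_sum_closed|].
move=> z k zsa ksa kz _; have [s hs] := local_unit_finite_rank ksa kz.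
pose q := \sum_(e <- s) val e ** cstar (val e); pose z1 := q ** z.
exists (z - z1), z1; split; last by rewrite subrK.
  move=> u; rewrite col_mulB {1}hs; by rewrite col_mulM (col_mul_finite_rank s id) subrr.
have [] // := ideal_mul z col_ideal_closed (x := q); by apply: subspace_sum => // e; exact: col_ideal_rank_one.
Qed.

Lemma col_decomposition : direct_sum_decomposition col_ker col_ideal.
Proof.
split; [exact: col_ker_closed|exact: col_ideal_closed| |exact: col_sumT].
apply/seteqP; split=> [x [x0 x1]|x ->]; first exact: col_disjoint.
by split; [exact: sub0.1|exact: sub1.1].
Qed.

Lemma col_mul_totally_bounded x : totally_bounded (op x @` [set u : H | `|u| <= 1]).
Proof.
move: x; apply: (@subspace_local_units _ _ [set x | totally_bounded (op x @` [set u : H | `|u| <= 1])]).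
- split=> [e e0|c x y hx hy].
    exists [:: 0] => _ [u _ <-]; exists 0; first by rewrite inE.
    have -> : op 0 u = 0 by apply: val_inj; rewrite /= cmul0x.
    by rewrite subrr nrm0 ltW.
  apply: totally_boundedS (totally_boundedD (totally_boundedZ c hx) hy) => _ [u u1 <-].
  exists (c *: op x u), (op y u); split; [exists (op x u) => //; by exists u|by exists u|].
  exact: col_mul_linearl.
- apply/closed_nrmP => x hx; apply: totally_bounded_approx => e e0.
  have [y hy xy] := hx _ e0; exists (op y @` [set u | `|u| <= 1]); split=> // _ [u u1 <-].
  exists (op y u); first by exists u.
  move: u1; rewrite unit_ball1 => u1; rewrite -col_mulB; apply: (le_trans (nrm_col_mul _ _)).
  by apply: le_trans (ltW xy); rewrite ler_piMr ?nrm_ge0.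
- move=> z k zsa ksa kz _ /=; have [s hs] := local_unit_finite_rank ksa kz.
  have -> : op z = fun u => \sum_(e <- s) ip (op z u) e *: e by apply/funext.
  apply: (@totally_bounded_sum _ _ _ id (fun e => nrm z * nrm e)) => u e.
  rewrite unit_ball1 => u1; apply: (le_trans (ip_norm_le hip _ _)).
  rewrite ler_wpM2r ?nrm_ge0 //; apply: (le_trans (nrm_col_mul _ _)).
  by rewrite ler_piMr ?nrm_ge0.
Qed.

Lemma col_mul_compact x : compact_operators H (op x).
Proof.
split; last exact/totally_bounded_precompact/col_mul_totally_bounded.
by move=> c u v; exact: col_mul_linear.
Qed.

(** Finite rank approximants of [f] are images of elements of [col_ideal], and by isometry these
    elements form a Cauchy family. *)
Lemma col_mul_surj f : compact_operators H f -> exists2 x, col_ideal x & op x =1 f.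
Proof.
move=> cf.
pose D (e : R) : set A := [set x | col_ideal x /\ forall u, nrm (f u - op x u) <= e * nrm u].
have [||l hl] := @cauchy_approx _ _ D.
- move=> e e0; have [s hs] := compact_operator_approx hip cf e0.
  exists (\sum_(a <- s) val (f a) ** cstar (val a)); split.
    by apply: subspace_sum => // a; exact: col_ideal_rank_one.
  by move=> u; rewrite col_mul_finite_rank.
- move=> e e' x y [hx fx] [hy fy].
  have ee u : nrm (op (x - y) u) <= (e + e') * nrm u.
    rewrite col_mulB; have := nrm_triangle (f u) (op x u) (op y u).
    by rewrite (nrmBC (op x u) (f u)); have := fx u; have := fy u; lra.
  apply: col_ideal_isometric (ee); first exact: (subspaceB sub1).
  have pR : p \in right_fixed p by rewrite inE pp.
  have := le_trans (nrm_ge0 _) (ee (Column pR)).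
  by rewrite nrm_column /= minimal_proj_nrm mulr1.
exists l.
  have /closed_nrmP := col_ideal_closed.2; apply => e e0.
  by have [d [x1 [_ [h1 _] lx]]] := hl _ e0; exists x1.
move=> u; apply/eqP; rewrite -subr_eq0; apply/eqP/nrm_small => e e0.
have c0 : 0 < (nrm u + 1) * 2 by rewrite mulr_gt0 // ltr_wpDl ?nrm_ge0.
have [d [x [de [_ fx] lx]]] := hl _ (divr_gt0 e0 c0).
have h1 : nrm (op l u - op x u) <= e / ((nrm u + 1) * 2) * nrm u.
  rewrite -col_mulB; apply: (le_trans (nrm_col_mul _ _)).
  by rewrite ler_wpM2r ?nrm_ge0 // ltW.
have h2 : nrm (f u - op x u) <= e / ((nrm u + 1) * 2) * nrm u.
  by apply: (le_trans (fx u)); rewrite ler_wpM2r ?nrm_ge0.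
have h3 : e / ((nrm u + 1) * 2) * nrm u <= e / 2.
  rewrite mulrAC ler_pdivrMr //; have := nrm_ge0 u; nra.
have := nrm_triangle (op x u) (op l u) (f u); rewrite (nrmBC (op x u) (f u)).
lra.
Qed.

Lemma col_elementary : elementary col_ideal.
Proof.
have [dot [hd dE]] := inner_product_dot hip.
exists (column p), dot, op; split=> //; split.
- split.
  + by move=> x _; exact: col_mul_compact.
  + by move=> x y; rewrite !inE => hx hy xy; apply: col_ideal_inj => // u; rewrite xy.
  + by move=> f /col_mul_surj[x hx /funext xf]; exists x.
- by move=> c x y _ _; apply/funext => u; exact: col_mul_linearl.
- by move=> x y _ _; apply/funext => u; exact: col_mulM.
- by move=> x u v _; rewrite !dE col_mul_adjoint.
Qed.

Lemma orthonormal_seq_infinite (e : nat -> H) : orthonormal_seq ip e -> ~ finite_dimensional col_ideal.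
Proof.
move=> oe [n [b [_ hb]]].
have /choice[C hC] : forall i : 'I_n.+1, exists c : 'I_n -> R[i], val (e i) = \sum_(k < n) c k *: b k.
  by move=> i; apply: hb; exact: col_ideal_val.
pose M : 'M[R[i]]_(n.+1, n) := \matrix_(i, k) C i k.
have : kermx M != 0.
  by rewrite kermx_eq0 /row_free; apply: contraTneq (rank_leq_col M) => ->; rewrite ltnn.
move/rowV0Pn => [r /sub_kermxP rM r0].
have : \sum_(i < n.+1) r 0 i *: val (e i) = 0.
  under eq_bigr do rewrite hC scaler_sumr.
  rewrite exchange_big big1 //= => k _; under eq_bigr do rewrite scalerA.
  rewrite -scaler_suml; have /matrixP/(_ 0 k) := rM; rewrite !mxE => rMk.
  by have -> : \sum_(i < n.+1) r 0 i * C i k = 0; rewrite ?scale0r // -[RHS]rMk; apply: eq_bigr => i _; rewrite mxE.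
move=> hr; have hr' : \sum_(i < n.+1) r 0 i *: e i = 0.
  by apply: val_inj; rewrite raddf_sum raddf0 -[RHS]hr; apply: eq_bigr => i _.
move/eqP: r0; apply; apply/rowP => j; rewrite mxE.
have := congr1 (ip^~ (e j)) hr'; rewrite (ip0l hip) (ip_suml hip) (bigD1 j) //= big1 ?addr0.
  by rewrite (ipZl hip) oe eqxx mulr1.
by move=> i ij; rewrite (ipZl hip) oe (inj_eq val_inj) (negbTE ij) mulr0.
Qed.

Lemma finite_dimensional_unit : finite_dimensional col_ideal -> exists q,
  [/\ col_ideal q, sa q & forall x, col_ideal x -> q ** x = x /\ x ** q = x].
Proof.
move=> fd; have [||[s [_ hs]]|[e [oe _]]] := orthonormal_basis hip (V := setT) => //; last first.
  by have := orthonormal_seq_infinite oe fd.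
pose q := \sum_(e <- s) val e ** cstar (val e).
have q1 : col_ideal q by apply: subspace_sum => // e; exact: col_ideal_rank_one.
have qsa : sa q by rewrite /sa cstar_sum; apply: eq_bigr => e _; rewrite cstarM cstarK.
have qx x : col_ideal x -> q ** x = x.
  move=> hx; apply: col_ideal_inj => // [|u]; first by have [] := ideal_mul q col_ideal_closed hx.
  by rewrite col_mulM [RHS](hs (op x u) I) (col_mul_finite_rank s id).
exists q; split=> // x hx; split; first exact: qx.
apply: (can_inj cstarK); rewrite cstarM qsa qx //.
exact: ideal_star col_ideal_closed hx.
Qed.

Lemma col_unit_central q : col_ideal q -> sa q ->
  (forall x, col_ideal x -> q ** x = x /\ x ** q = x) -> forall a, q ** a = a ** q.
Proof.
move=> q1 qsa hq a; have [a0 [a1 [h0 h1 ->]]] := col_sumT a.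
have qa : q ** a0 = 0 by exact: q1.
have aq : a0 ** q = 0.
  apply: (can_inj cstarK); rewrite cstarM qsa cstar0; apply: q1.
  exact: ideal_star col_ker_closed h0.
by rewrite cmulDr cmulDl qa aq; have [-> ->] := hq _ h1.
Qed.

End MinimalColumn.

(** * The gliding hump on the column space *)

Section ElementaryFromCentralizer.
Variables (R : realType) (A : cstarAlgType R) (T : A -> A -> A) (p : A).
Local Notation K := (pedersen_ideal A).
Hypothesis hT : quasi_centralizer K T.
Hypotheses (psa : sa p) (pp : p ** p = p) (p0 : p <> 0).
Hypothesis pmin : forall a, exists c : R[i], p ** a ** p = c *: p.
Hypothesis pu : unbounded_ideal T p.
Implicit Types (x y z w k q : A).

(** The projections [e_n e_n^*] are orthogonal with common unit [k], so one of them lies in a level.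
    As [e_n = e_n p] is in [unbounded_ideal], this projection would be zero. *)
Lemma local_unit_no_orthonormal_seq k (e : nat -> column p) : sa k ->
  orthonormal_seq (@col_ip _ _ p) e -> (forall n, col_mul k (e n) = e n) -> False.
Proof.
move=> ksa oe ke; have hip := col_inner_product psa pp p0 pmin.
pose q n := val (e n) ** cstar (val (e n)).
have ke' n : k ** val (e n) = val (e n) by rewrite -[in RHS]ke.
have kq n : k ** q n = q n by rewrite /q cmulA ke'.
have qsa n : sa (q n) by rewrite /sa cstarM cstarK.
have [] := @no_orthogonal_levels _ _ _ hT k q ksa _ qsa.
- by move=> n; split=> //; rewrite -[q n]qsa -[k]ksa -cstarM kq.
- move=> m n mn; rewrite /q cmulA -(cmulA (val (e m))) (col_ipE psa pmin) oe eq_sym (negbTE mn).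
  by rewrite scale0r cmulx0 cmul0x.
move=> n /unbounded_level0 h.
have q0 : q n = 0.
  apply: h; have hv : unbounded_ideal T (val (e n)).
    by rewrite -colvalP; have [] := ideal_mul (val (e n)) (unbounded_ideal_closed T) pu.
  by have [] := ideal_mul (cstar (val (e n))) (unbounded_ideal_closed T) hv.
have := orthonormal_seq_nrm hip n oe; rewrite nrm_column (Mstar_eq0 q0) nrm0 => /eqP.
by rewrite eq_sym oner_eq0.
Qed.

Let hfin := local_unit_no_orthonormal_seq.

(* If the summand is unital with unit [q] then [T z w] is [z T(q, q) w] on it, so
   that [T] is bounded there. *)
Lemma col_ideal_infinite_dimensional : ~ finite_dimensional (col_ideal p).
Proof.
move=> /(finite_dimensional_unit psa pp p0 pmin)[q [q1 qsa hq]].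
have qC := col_unit_central psa pp p0 pmin hfin q1 qsa hq.
have [qq _] := hq q q1; have Kq : K q by exact: pedersen_left_unit qq.
have Kp : K p by exact: pedersen_left_unit pp.
have p1 : col_ideal p p.
  have pR : p \in right_fixed p by rewrite inE pp.
  exact: (col_ideal_val psa pp (Column pR)).
(* The bound [|T q q| + 1] exceeds that of [T] on the summand: a threshold element would satisfy
   [(|T q q| + 1) |y| <= |y T(z, w)| <= |T q q| |y|], hence [y = 0]. *)
apply: p0; apply: (@unbounded_level0 _ _ T (Num.truncn (nrm (T q q) + 1))) => //.
apply: (@bounded_ideal_mono _ _ T (nrm (T q q) + 1)); first exact/ltW/Num.Theory.truncnS_gt.
move=> z w s a Kz Kw z1 w1 [ssa _ hs].
pose y := p ** a ** s; rewrite -/y.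
have y1 : col_ideal p y.
  have hI := col_ideal_closed p; have [_ h] := ideal_mul a hI p1.
  by have [] := ideal_mul s hI h.
have Ky : K y by apply: KMr; apply: KMr.
have E : y ** T z w = y ** z ** T q q ** w.
  rewrite -(qc_mull hT Ky Kz Kw).
  have [_ <-] := hq (y ** z) ((ideal_mul z (col_ideal_closed p) y1).2).
  have Kyz : K (y ** z) by exact: KMr.
  rewrite (qc_mull hT Kyz Kq Kw) -(cmulA (y ** z) q) -(cmulA (y ** z) _ w).
  congr (_ ** _); rewrite -(qc_mull hT Kq Kq Kq) qq -(qc_mulr hT Kq Kq Kw) qC.
  by rewrite (qc_mulr hT Kq Kw Kq) -qC -(qc_mull hT Kq Kq Kw) qq.
have ny : nrm (y ** T z w) <= nrm y * nrm (T q q).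
  rewrite E; apply: (le_trans (nrmM _ _)); apply: (@le_trans _ _ (nrm (y ** z ** T q q))).
    by rewrite ler_piMr ?nrm_ge0.
  apply: (le_trans (nrmM _ _)); rewrite ler_wpM2r ?nrm_ge0 //.
  by apply: (le_trans (nrmM _ _)); rewrite ler_piMr ?nrm_ge0.
apply: nrm_eq0; apply/eqP; rewrite eq_le nrm_ge0 andbT.
have := hs (p ** a); rewrite -/y; lra.
Qed.

Lemma elementary_summand : has_infinite_dimensional_elementary_summand A.
Proof.
exists (col_ker p), (col_ideal p); split.
- exact: col_decomposition psa pp p0 pmin hfin.
- exact: col_elementary psa pp p0 pmin hfin.
- exact: col_ideal_infinite_dimensional.
Qed.

End ElementaryFromCentralizer.

Theorem corollary4p9 (R : realType) (A : cstarAlgType R) :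
  (forall T : A -> A -> A,
     quasi_centralizer (pedersen_ideal A) T -> locally_bounded T) <->
  ~ has_infinite_dimensional_elementary_summand A.
Proof.
split=> [hT [A0 [A1 [hdec [H [dot [phi [hdot hphi]]]] nfd]]]|hA T hT].
  have [T [qT nT]] := unbounded_centralizer hdec hdot hphi nfd.
  exact: nT (hT T qT).
apply: (levels_dense_locally_bounded hT); apply: contrapT => hcl; apply: hA.
have [p [psa pp p0 pu pmin]] := unbounded_minimal_projection hT hcl.
exact: elementary_summand hT psa pp p0 pmin pu.
Qed.
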